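(* Suppose that $S$ and all $A(x)$, $x\in S$, are finite. Consider the linear program: minimize $\sum_{x\in S}\sum_{a\in A(x)}\frac1\alpha c_0(x,a)\eta(x,a)$ subject to $$\sum_{x\in S}\sum_{a\in A(x)}c_n(x,a)\eta(x,a)\le\alpha d_n,\quad n=1,\ldots,N,$$ $$\alpha\sum_{a\in A(x)}\eta(x,a)=\alpha\gamma(x)+\sum_{y\in S}\sum_{a\in A(y)}q(x|y,a)\eta(y,a)\quad\forall x\in S,$$ $$\eta(x,a)\ge0,\quad x\in S,\ a\in A(x).$$ Let $\eta^*$ be an optimal basic solution to this linear program. Then the policy $\phi^{\eta^*}$ is constrained optimal, where, for all $x\in S$ and $a\in A(x)$, with $\hat\eta^*(x):=\sum_{a\in A(x)}\eta^*(x,a)$, $$\phi^{\eta^*}(a|x)=\begin{cases}\eta^*(x,a)/\hat\eta^*(x), & \hat\eta^*(x)>0,\\ I_{\{a(x)\}}(a), & \hat\eta^*(x)=0,\end{cases}$$ and $a(x)\in A(x)$ is chosen arbitrarily. Further, $\#(\phi^{\eta^*})\le N$.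
   Context: Model. $S$ (states) and $A$ (actions) are Polish spaces with Borel $\sigma$-algebras $\mathcal B(S),\mathcal B(A)$; for each $x\in S$, $A(x)\subseteq A$ is a Borel set of admissible actions; $K:=\{(x,a): x\in S, a\in A(x)\}$ is a Borel subset of $S\times A$. The transition rates $q(\cdot|x,a)$, $(x,a)\in K$, satisfy: for fixed $(x,a)$, $q(\cdot|x,a)$ is a signed measure on $\mathcal B(S)$, and for fixed $D\in\mathcal B(S)$, $q(D|\cdot)$ is real-valued and Borel measurable on $K$; $0\le q(D|x,a)<\infty$ whenever $x\notin D\in\mathcal B(S)$; $q(S|x,a)=0$; and $q^*(x):=\sup_{a\in A(x)}|q(\{x\}|x,a)|<\infty$ for all $x\in S$. The reward $r$ and costs $c_1,\ldots,c_N$ are real-valued measurable functions on $K$; $c_0:=-r$; $d_1,\ldots,d_N$ are real constants. A discount factor $\alpha>0$ and a probability measure $\gamma$ on $S$ (initial distribution) are fixed. In the finite case write $q(x|y,a):=q(\{x\}|y,a)$, $\gamma(x):=\gamma(\{x\})$, $\phi(a|x):=\phi(\{a\}|x)$. State process. Adjoin isolated points: $S_\infty:=S\cup\{x_\infty\}$, $A_\infty:=A\cup\{a_\infty\}$, $A(x_\infty):=\{a_\infty\}$, $q(\cdot|x_\infty,a_\infty)\equiv 0$. $\mathbb R_+:=(0,\infty)$, $\mathbb R_+^0:=[0,\infty)$. $\Omega$ consists of all sequences $e=(x_0,\theta_1,x_1,\theta_2,x_2,\ldots)$ in $(S\times\mathbb R_+)^\infty$ together with all sequences $(x_0,\theta_1,x_1,\ldots,\theta_{k-1},x_{k-1},\infty,x_\infty,\infty,x_\infty,\ldots)$,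 $k\ge1$, $x_l\in S$, $\theta_l\in\mathbb R_+$; $\mathcal F$ is the natural (product) $\sigma$-algebra. Put $T_0:=0$, $T_k:=\theta_1+\cdots+\theta_k$, $T_\infty:=\lim_k T_k$, $X_k:=x_k$, $\Theta_k:=\theta_k$, $h_k:=(x_0,\theta_1,x_1,\ldots,\theta_k,x_k)$; $\xi_t:=x_k$ if $T_k\le t<T_{k+1}$ and $\xi_t:=x_\infty$ if $t\ge T_\infty$; $\xi_{t-}$ is the left limit ($\xi_{t-}=x_k$ for $T_k<t\le T_{k+1}$, $\xi_{0-}:=x_0$, $\xi_{t-}=x_\infty$ after absorption). Let $\mu^*(dt,dx):=\sum_{k\ge0}I_{\{T_k<\infty\}}\delta_{(T_k,X_k)}(dt,dx)$, $\mathcal F_t:=\sigma\{\mu^*([0,s]\times D): s\in[0,t], D\in\mathcal B(S)\}$, $\mathcal F_{s-}:=\bigvee_{t<s}\mathcal F_t$; the predictable $\sigma$-algebra on $\Omega\times\mathbb R_+^0$ is generated by the sets $B\times\{0\}$ ($B\in\mathcal F_0$) and $C\times(s,\infty)$ ($C\in\mathcal F_{s-}$, $s>0$). Policies. A policy is a transition probability $\pi(da|e,t)$ from $\Omega\times\mathbb R_+^0$ with the predictable $\sigma$-algebra to $(A_\infty,\mathcal B(A_\infty))$ such that $\pi(A(\xi_{t-}(e))|e,t)\equiv1$. $\Pi$ is the set of all policies. $\Pi_s$ (randomized stationary policies) is the set of stochastic kernels $\phi$ on $A$ given $S$ with $\phi(A(x)|x)=1$ for all $x\in S$, identified with the policies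 $\pi(da|e,t)=I_{\{t<T_\infty\}}(e)\phi(da|\xi_{t-}(e))+I_{\{t\ge T_\infty\}}(e)\delta_{a_\infty}(da)$. Probability measure. For $\pi\in\Pi$ and a probability measure $\gamma$ on $S$, the predictable intensity $m(D|e,t):=\int_A\pi(da|e,t)\,q(D\setminus\{\xi_{t-}(e)\}|\xi_{t-}(e),a)$ has a representation $m(D|e,t)=m_k(D|h_k(e),t-T_k)$ on $\{T_k<t\le T_{k+1}\}$. $P^\pi_\gamma$ is the unique probability measure on $(\Omega,\mathcal F)$ such that $x_0$ has law $\gamma$ and, given $h_k$ with $x_k\in S$, $P^\pi_\gamma(\Theta_{k+1}\in dt,X_{k+1}\in dx|h_k)=m_k(dx|h_k,t)e^{-\int_0^t m_k(S|h_k,v)dv}dt$ and $P^\pi_\gamma(\Theta_{k+1}=\infty,X_{k+1}=x_\infty|h_k)=e^{-\int_0^\infty m_k(S|h_k,v)dv}$. $E^\pi_\gamma$ is its expectation; $E^\pi_x$ denotes the case $\gamma=\delta_x$. Criteria. For measurable $u$ on $K$, $V_\alpha(x,\pi,u):=\int_0^\infty e^{-\alpha t}E^\pi_x\big[\int_A u(\xi_{t-},a)\pi(da|e,t)\big]dt$ and $V_\alpha(\pi,u):=\int_S V_\alpha(x,\pi,u)\gamma(dx)$; $V_r(\pi):=V_\alpha(\pi,r)$, $V_n(\pi):=V_\alpha(\pi,c_n)$. $U:=\{\pi\in\Pi: V_n(\pi)\le d_n,\ n=1,\ldots,N\}$. A policy $\pi^*\in U$ is constrained optimal if $V_r(\pi^*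 )=\sup_{\pi\in U}V_r(\pi)$. Number of randomizations. For $\phi\in\Pi_s$ and $x\in S$, $m(x,\phi)$ is the integer such that there are exactly $m(x,\phi)+1$ actions $a\in A(x)$ with $\phi(a|x)>0$; for finite $S$ and $A(x)$, $\#(\phi):=\sum_{x\in S}m(x,\phi)$. An optimal basic solution is an optimal solution that is a basic feasible solution of the linear program. *)

(* Defs.v *)
From HB Require Import structures.
From mathcomp Require Import all_boot all_order all_algebra finmap.
From mathcomp Require Import all_classical all_reals all_analysis.
From mathcomp Require Import measurable_realfun.

Set Implicit Arguments.
Unset Strict Implicit.
Unset Printing Implicit Defensive.

Import Order.TTheory GRing.Theory Num.Theory.
Import numFieldNormedType.Exports.

Local Open Scope classical_set_scope.
Local Open Scope ring_scope.

(* A finite Polish space is discrete: its Borel sigma-algebra is the power set.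
   [Measurable] entails nonemptiness, which costs nothing, since the state space
   carries a probability measure. *)
HB.mixin Record isDiscreteMeasurable d T & Measurable d T := {
  measurable_all : forall D : set T, measurable D }.

#[short(type="finStateType")]
HB.structure Definition FinState d :=
  {T of Finite T & Measurable d T & isDiscreteMeasurable d T}.

Definition polish (R : realType) (A : completePseudoMetricType R) : Prop :=
  hausdorff_space A /\ @second_countable A.

Definition Borel (A : ptopologicalType) := g_sigma_algebraType (@open A).
HB.instance Definition _ (A : ptopologicalType) := Measurable.on (Borel A).

(* [adjoin T] is T together with one isolated point, [None]. *)
Definition adjoin (T : Type) : Type := option T.

Definition adjoin_display (d : measure_display) : measure_display.
Proof. exact. Qed.

Section adjoin.
Context d (T : measurableType d).

Definition adjoin_measurable : set (set (adjoin T)) :=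
  [set D | measurable (Some @^-1` D)].

Lemma adjoin_measurable0 : adjoin_measurable set0.
Proof. exact: measurable0. Qed.

Lemma adjoin_measurableC D : adjoin_measurable D -> adjoin_measurable (~` D).
Proof. exact: (@measurableC _ _ (Some @^-1` D)). Qed.

Lemma adjoin_measurableU (F : (set (adjoin T))^nat) :
  (forall i, adjoin_measurable (F i)) -> adjoin_measurable (\bigcup_i F i).
Proof.
exact: (@bigcupT_measurable _ _ (fun i => Some @^-1` F i)).
Qed.

HB.instance Definition _ := Choice.copy (adjoin T) (option T).
HB.instance Definition _ := isPointed.Build (adjoin T) None.
HB.instance Definition _ := @isMeasurable.Build (adjoin_display d)
  (adjoin T) adjoin_measurable adjoin_measurable0 adjoin_measurableC
  adjoin_measurableU.

Lemma measurable_Some : measurable_fun [set: T] (Some : T -> adjoin T).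
Proof. by move=> _ Y mY; rewrite setTI. Qed.

(* A measure on T seen as a measure on T together with the isolated point. *)
Definition adjoin_measure (R : realType) (mu : {measure set T -> \bar R}) :
  {measure set (adjoin T) -> \bar R} :=
  measure_function_pushforward__canonical__measure_function_Measure
    mu measurable_Some.
End adjoin.

Section trajectories.
Context (R : realType) dS (S : finStateType dS).

(* The sequence x_0, theta_1, x_1, theta_2, ...: [x k] is x_k, with [None] for
   x_infty, and [theta k] is theta_(k+1). *)
Definition is_trajectory (x : nat -> adjoin S) (theta : nat -> \bar R) : Prop :=
  x 0%N <> None /\
  forall k, if x k.+1 is Some _
            then x k <> None /\ exists2 t : R, 0 < t & theta k = t%:E
            else theta k = +oo%E.

Record trajectory := Trajectory {
  state : nat -> adjoin S ;
  sojourn : nat -> \bar R ;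
  trajectoryP : is_trajectory state sojourn }.

Lemma absorbed_is_trajectory (x : S) :
  is_trajectory (fun k => if k is 0%N then Some x else None) (fun=> +oo%E).
Proof. by []. Qed.

HB.instance Definition _ := gen_eqMixin trajectory.
HB.instance Definition _ := gen_choiceMixin trajectory.
HB.instance Definition _ :=
  isPointed.Build trajectory (Trajectory (absorbed_is_trajectory point)).

(* Trace on [trajectory] of the product sigma-algebra. *)
Definition cylinders : set (set trajectory) :=
  [set H | (exists k (D : set (adjoin S)), H = [set e | D (state e k)]) \/
           (exists k (B : set (\bar R)),
              measurable B /\ H = [set e | B (sojourn e k)])].

Definition Omega := g_sigma_algebraType cylinders.
HB.instance Definition _ := Measurable.on Omega.

Definition jump_time (e : Omega) (k : nat) : \bar R :=
  (\sum_(0 <= i < k) sojourn e i)%E.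

Definition explosion_time (e : Omega) : \bar R :=
  (\sum_(0 <= i <oo) sojourn e i)%E.

(* xi_(t-); it is x_infty exactly when t >= T_infty. *)
Definition state_before (e : Omega) (t : R) : adjoin S :=
  if t == 0 then state e 0%N
  else xget None [set y | exists k,
         (jump_time e k < t%:E <= jump_time e k.+1)%E /\ y = state e k].

(* mu^*([0, s] x D) *)
Definition jump_measure (e : Omega) (s : R) (D : set S) : \bar R :=
  (\sum_(0 <= k <oo)
    ((jump_time e k <= s%:E)%E && (state e k \in Some @` D))%:R%:E)%E.

Definition filtration (t : R) : set (set Omega) :=
  <<s [set H | exists s D B, [/\ 0 <= s <= t, measurable B &
                                 H = [set e | B (jump_measure e s D)]]] >>.

Definition filtration_before (s : R) : set (set Omega) :=
  <<s \bigcup_(t in [set t | 0 <= t < s]) filtration t >>.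

(* Nonnegative times are encoded as elements of R, so that this is a
   sigma-algebra on the subset Omega x [0, +oo[ of Omega x R. *)
Definition predictable : set (set (Omega * R)) :=
  <<s [set p | 0 <= p.2],
      [set G | (exists2 B, filtration 0 B & G = B `*` [set 0]) \/
               (exists C s, [/\ 0 < s, filtration_before s C &
                                G = C `*` [set t | s < t]])] >>.

(* h_k = (x_0, theta_1, x_1, ..., theta_k, x_k) *)
Definition history : Type := (adjoin S * seq (\bar R * adjoin S))%type.

Definition hist (k : nat) (e : Omega) : history :=
  (state e 0%N, [seq (sojourn e i, state e i.+1) | i <- iota 0 k]).

Definition history_sigma (k : nat) : set (set Omega) :=
  <<s [set H | (exists j (D : set (adjoin S)),
                  (j <= k)%N /\ H = [set e | D (state e j)]) \/
               (exists j (B : set (\bar R)),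
                  [/\ (j < k)%N, measurable B & H = [set e | B (sojourn e j)]])] >>.

End trajectories.
Arguments Omega R {dS} S.
Arguments history R {dS} S.

Section model.
Context (R : realType) dS (S : finStateType dS) (A : completePseudoMetricType R).
Variable adm : S -> {fset A}.
Variable q : S -> A -> {charge set S -> \bar R}.

(* The remaining standing conditions (Borel measurability of K and of
   q(D|.), boundedness of |q({x}|x,.)|) hold automatically because K is finite. *)
Definition is_transition_rate : Prop :=
  forall x a, a \in adm x ->
    (forall D : set S, ~ D x -> (0 <= q x a D)%E) /\ q x a [set: S] = 0%E.

Definition admissible (y : adjoin S) : set (adjoin (Borel A)) :=
  if y is Some x then Some @` [set a | a \in adm x] else [set None].

Definition control : Type :=
  Omega R S -> R -> {measure set (adjoin (Borel A)) -> \bar R}.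

Definition is_policy (pi : control) : Prop :=
  (forall e t, 0 <= t ->
     pi e t [set: adjoin (Borel A)] = 1%E /\
     pi e t (admissible (state_before e t)) = 1%E) /\
  (forall B, measurable B -> forall Y : set (\bar R), measurable Y ->
     predictable [set p : Omega R S * R | 0 <= p.2 /\ Y (pi p.1 p.2 B)]).

(* The integral over A of u(xi_(t-), a) pi(da|e,t). Functions of (x, a) are
   meaningful on K only, whence the domain of integration, which carries
   pi(.|e,t); the integral over A vanishes when xi_(t-) is x_infty. *)
Definition action_integral (u : S -> A -> \bar R) (pi : control)
    (e : Omega R S) (t : R) : \bar R :=
  if state_before e t is Some x then
    (\int[pi e t]_(a in admissible (Some x))
       (if a is Some a' then u x a' else 0))%E
  else 0%E.

Definition intensity (pi : control) (e : Omega R S) (t : R) (D : set S)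
    : \bar R :=
  action_integral (fun x a => q x a (D `\ x)) pi e t.

(* The law P^pi_gamma: m is the representation (m_k) of the intensity, and the
   conditional distribution of (Theta_(k+1), X_(k+1)) given h_k is expressed by
   integrating over the events H of sigma(h_k) contained in {x_k in S}. *)
Definition is_law (pi : control) (gamma : probability S R)
    (P : probability (Omega R S) R) : Prop :=
  (forall D : set S, P [set e | (Some @` D) (state e 0%N)] = gamma D) /\
  exists m : nat -> history R S -> R -> set S -> \bar R,
    (forall k e t D, (jump_time e k < t%:E <= jump_time e k.+1)%E ->
       intensity pi e t D = m k (hist k e) (t - fine (jump_time e k)) D) /\
    (forall k H, history_sigma k H -> H `<=` [set e | state e k <> None] ->
       (forall (B : set R) (D : set S), measurable B -> B `<=` [set t | 0 < t] ->
          P (H `&` [set e | (EFin @` B) (sojourn e k) /\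
                            (Some @` D) (state e k.+1)]) =
          (\int[P]_(e in H) \int[lebesgue_measure]_(t in B)
             (m k (hist k e) t D *
              expeR (- \int[lebesgue_measure]_(v in `]0%R, t])
                         m k (hist k e) v [set: S])))%E) /\
       P (H `&` [set e | sojourn e k = +oo%E /\ state e k.+1 = None]) =
       (\int[P]_(e in H)
          expeR (- \int[lebesgue_measure]_(v in `]0%R, +oo[)
                     m k (hist k e) v [set: S]))%E).

Section criteria.
Variable P : control -> probability S R -> probability (Omega R S) R.

Definition is_law_family : Prop :=
  forall pi gamma, is_policy pi -> is_law pi gamma (P pi gamma).

Definition value_at (alpha : R) (x : S) (pi : control) (u : S -> A -> R)
    : \bar R :=
  (\int[lebesgue_measure]_(t in `[0%R, +oo[)
     ((expR (- alpha * t))%:E *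
      \int[P pi (dirac x)]_e
        action_integral (fun y a => (u y a)%:E) pi e t))%E.

Definition value (alpha : R) (gamma : probability S R) (pi : control)
    (u : S -> A -> R) : \bar R :=
  (\int[gamma]_x value_at alpha x pi u)%E.

Variables (alpha : R) (gamma : probability S R) (r : S -> A -> R).
Variables (N : nat) (c : 'I_N -> S -> A -> R) (d : 'I_N -> R).

Definition feasible_policy (pi : control) : Prop :=
  is_policy pi /\ forall n, (value alpha gamma pi (c n) <= (d n)%:E)%E.

Definition constrained_optimal (pi : control) : Prop :=
  feasible_policy pi /\
  value alpha gamma pi r =
    ereal_sup [set value alpha gamma pi' r | pi' in feasible_policy].

End criteria.

Definition is_stationary (phi : R.-pker S ~> Borel A) : Prop :=
  forall x, phi x [set a | a \in adm x] = 1%E.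

Definition stationary_control (phi : R.-pker S ~> Borel A) : control :=
  fun e t =>
    if (t%:E < explosion_time e)%E then
      if state_before e t is Some x then adjoin_measure (phi x)
      else dirac (None : adjoin (Borel A))
    else dirac (None : adjoin (Borel A)).

Definition randomizations_at (phi : R.-pker S ~> Borel A) (x : S) : nat :=
  #|` [fset a in adm x | (0 < phi x [set a])%E]%fset|.-1.

Definition randomizations (phi : R.-pker S ~> Borel A) : nat :=
  (\sum_(x : S) randomizations_at phi x)%N.

End model.

Section linear_program.
Context (R : realType) dS (S : finStateType dS) (A : completePseudoMetricType R).
Variable adm : S -> {fset A}.
Variable q : S -> A -> {charge set S -> \bar R}.
Variables (alpha : R) (gamma : probability S R) (r : S -> A -> R).
Variables (N : nat) (c : 'I_N -> S -> A -> R) (d : 'I_N -> R).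

Definition rate (x y : S) (a : A) : R := fine (q y a [set x]).

Definition lp_objective (eta : S -> A -> R) : R :=
  \sum_(x : S) \sum_(a <- adm x) alpha^-1 * (- r x a) * eta x a.

Definition lp_feasible (eta : S -> A -> R) : Prop :=
  [/\ forall n, \sum_(x : S) \sum_(a <- adm x) c n x a * eta x a <= alpha * d n,
      forall x, alpha * \sum_(a <- adm x) eta x a =
        alpha * fine (gamma [set x]) +
        \sum_(y : S) \sum_(a <- adm y) rate x y a * eta y a &
      forall x a, a \in adm x -> 0 <= eta x a].

Definition lp_optimal (eta : S -> A -> R) : Prop :=
  lp_feasible eta /\
  forall eta', lp_feasible eta' -> lp_objective eta <= lp_objective eta'.

(* z solves M z = b, and vanishes outside a basis, i.e. outside a set B of as
   many variables as there are equations whose columns are linearly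
   independent. *)
Definition basic_solution (I J : finType) (M : I -> J -> R) (b : I -> R)
    (z : J -> R) : Prop :=
  (forall i, \sum_j M i j * z j = b i) /\
  exists B : {set J},
    [/\ #|B| = #|I|,
        free [seq [ffun i => M i j] : {ffun I -> R^o} | j <- enum B] &
        forall j, j \notin B -> z j = 0].

(* Standard form of the program: one slack variable for each inequality. *)
Definition lp_var : finType := ({x : S & adm x} + 'I_N)%type.
Definition lp_row : finType := (S + 'I_N)%type.

Definition lp_matrix (i : lp_row) (j : lp_var) : R :=
  match i, j with
  | inl x, inl (existT y a) => alpha *+ (x == y) - rate x y (val a)
  | inl _, inr _ => 0
  | inr n, inl (existT y a) => c n y (val a)
  | inr n, inr n' => (n == n')%:R
  end.

Definition lp_rhs (i : lp_row) : R :=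
  match i with
  | inl x => alpha * fine (gamma [set x])
  | inr n => alpha * d n
  end.

Definition lp_point (eta : S -> A -> R) (j : lp_var) : R :=
  match j with
  | inl (existT y a) => eta y (val a)
  | inr n => alpha * d n - \sum_(x : S) \sum_(a <- adm x) c n x a * eta x a
  end.

Definition lp_basic_feasible (eta : S -> A -> R) : Prop :=
  lp_feasible eta /\ basic_solution lp_matrix lp_rhs (lp_point eta).

Definition optimal_basic_solution (eta : S -> A -> R) : Prop :=
  lp_optimal eta /\ lp_basic_feasible eta.

(* [act x] is the arbitrary action a(x). *)
Definition is_induced_policy (eta : S -> A -> R) (act : S -> A)
    (phi : R.-pker S ~> Borel A) : Prop :=
  is_stationary adm phi /\
  forall x a, a \in adm x ->
    let etahat := \sum_(a' <- adm x) eta x a' in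
    phi x [set a] =
      (if 0 < etahat then eta x a / etahat else (a == act x)%:R)%:E.

End linear_program.

(* Main.v *)
From HB Require Import structures.
Require Import Defs.
From mathcomp Require Import all_boot all_order all_algebra finmap.
From mathcomp Require Import all_classical all_reals all_analysis.
From mathcomp Require Import measurable_realfun.
From mathcomp Require Import ring lra.

Set Implicit Arguments.
Unset Strict Implicit.
Unset Printing Implicit Defensive.

Import Order.TTheory GRing.Theory Num.Theory.
Import numFieldNormedType.Exports.
Import HBNNSimple.

Local Open Scope classical_set_scope.
Local Open Scope ring_scope.

(** The value of a policy depends on it only through its discounted occupation
    measure: the expected discounted time spent in [x] while using [a], times
    [alpha]. Criteria are linear in this measure ([valueE]), so the theorem
    follows once occupation measures are matched with the feasible points of
    the linear program.

    Every policy, history-dependent ones included, yields a feasible point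
    ([occupation_measure_feasible]). The inequalities are the constraints on
    the values; the balance equation is a conservation law. Each entry into
    [x], discounted, is spent partly during the sojourn that it starts and
    partly carried over to the next jump ([entered_split]); and the expected
    discounted number of jumps from [z] to [y] is the expected discounted
    integral of the transition rate over the sojourns in [z]
    ([discounted_compensator]). The latter is proved sojourn by sojourn: given
    the history at the [k]-th jump, the waiting time has survival probability
    the exponential of minus the integrated rate, and density the rate times
    this probability; so both sides of the formula are the Laplace transform
    of the same function of the waiting time
    ([discounted_jump], [discounted_sojourn]).

    Conversely let [phi] be induced by a feasible [eta]. Under [phi] the action
    is drawn from [phi x] whatever the past, so its occupation measure is
    [phi] times its marginal on states ([stationary_occupation]); by
    construction [eta] splits in the same way ([induced_split]). Both marginals
    solve one linear system, whose solution is unique by diagonal dominance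
    ([balance_unique]): the occupation measure of [phi] is [eta]
    ([induced_occupation_measure]). An optimal [eta] therefore gives a feasible
    policy whose reward bounds that of any other feasible policy
    ([induced_constrained_optimal]).

    The bound on randomizations is a count of basic variables. No rate leads
    from a visited state to an unvisited one ([no_rate_to_unvisited]), so the
    columns of the positive variables are supported on the rows of the visited
    states and of the [N] constraints; being linearly independent, they are at
    most as many ([support_card]). In each visited state the first positive
    variable is not a randomization, which leaves at most [N] of them. *)

(** * Integrals weighted through a measurable map *)

Section weighted.
Local Open Scope ereal_scope.
Context (R : realType).

(** Monotone convergence along the simple approximations of [z]: the integral
    depends on [f] and [w] only through the weighted law
    [C |-> \int_(f^-1 C) w]. *)
Lemma weighted_integral_limn d d' (T : measurableType d) (T' : measurableType d')
    (mu : {measure set T -> \bar R}) (f : T -> T') (w : T -> \bar R)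
    (z : T' -> \bar R) (mz : measurable_fun setT z) :
  measurable_fun setT f -> measurable_fun setT w ->
  (forall x, 0 <= w x) -> (forall y, 0 <= z y) ->
  let g := nnsfun_approx measurableT mz in
  \int[mu]_x (z (f x) * w x) =
  limn (fun n => \sum_(r \in range (g n))
    r%:E * \int[mu]_(x in f @^-1` (g n @^-1` [set r])) w x).
Proof.
move=> mf mw w0 z0 g.
have mg n : measurable_fun setT (fun x => (g n (f x))%:E).
  by apply/measurable_EFinP/measurableT_comp.
have g0 n y : 0 <= (g n y)%:E by rewrite lee_fin; exact: fun_ge0.
have -> : \int[mu]_x (z (f x) * w x) =
    limn (fun n => \int[mu]_x ((g n (f x))%:E * w x)).
  rewrite -monotone_convergence//; last 3 first.
  - by move=> n; exact: emeasurable_funM.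
  - by move=> n x _; exact: mule_ge0.
  - move=> x _ a b ab; apply: lee_wpmul2r => //; rewrite lee_fin.
    exact/lefP/nd_nnsfun_approx.
  apply: eq_integral => x _; apply/esym/cvg_lim => //.
  have cg : EFin \o (g ^~ (f x)) @ \oo --> z (f x).
    by apply: cvg_nnsfun_approx.
  have [wx0|wx0] := eqVneq (w x) 0.
    by rewrite wx0 mule0; apply: cvg_near_cst; apply: nearW => n; rewrite mule0.
  have [zx0|zx0] := eqVneq (z (f x)) 0.
    rewrite zx0 mul0e; apply: cvg_near_cst; apply: nearW => n.
    suff -> : (g n (f x))%:E = 0 by rewrite mul0e.
    apply/eqP; rewrite eq_le g0 andbT.
    rewrite -[X in _ <= X]zx0 nnsfun_approxE; exact: le_approx.
  apply: cvgeM => //; last exact: cvg_cst.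
  rewrite mule_defE (negbTE zx0) (negbTE wx0)/=; move: (w0 x) (z0 (f x)).
  by case: (w x) => [r| |]; case: (z (f x)) => [s| |].
apply: congr_lim; apply/funext => n.
under eq_integral => x _.
  rewrite fimfunE -fsumEFin// ge0_mule_fsuml; last first.
    by move=> r; rewrite EFinM; exact: nnfun_muleindic_ge0.
  under eq_fsbigr do rewrite EFinM -muleA.
  over.
rewrite ge0_integral_fsum//; last 2 first.
- move=> r; apply: emeasurable_funM => //; apply: emeasurable_funM => //.
  by apply/measurable_EFinP/measurableT_comp.
- by move=> r x _; rewrite muleA; apply: mule_ge0 => //;
    exact: nnfun_muleindic_ge0.
apply: eq_fsbigr => r; rewrite inE => -[y _ <-{r}].
rewrite ge0_integralZl//; last 3 first.
- apply: emeasurable_funM => //.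
  by apply/measurable_EFinP/measurableT_comp.
- by move=> x _; apply: mule_ge0 => //; rewrite lee_fin.
- exact: g0.
congr (_ * _); rewrite [RHS]integral_mkcond; apply: eq_integral => x _.
rewrite patchE indicE -[x \in _]/(f x \in g n @^-1` [set g n y]).
by case: ifPn => _; rewrite ?mul1e ?mul0e.
Qed.

(** An identity between weighted laws becomes one between integrals; this
    stands in for conditional expectations, [f1] and [f2] being what is
    conditioned upon. *)
Lemma eq_weighted_integral d1 d2 d' (T1 : measurableType d1)
    (T2 : measurableType d2) (T' : measurableType d')
    (mu1 : {measure set T1 -> \bar R}) (mu2 : {measure set T2 -> \bar R})
    (f1 : T1 -> T') (f2 : T2 -> T') (w1 : T1 -> \bar R) (w2 : T2 -> \bar R) :
  measurable_fun setT f1 -> measurable_fun setT f2 ->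
  measurable_fun setT w1 -> measurable_fun setT w2 ->
  (forall x, 0 <= w1 x) -> (forall x, 0 <= w2 x) ->
  (forall C, measurable C ->
     \int[mu1]_(x in f1 @^-1` C) w1 x = \int[mu2]_(x in f2 @^-1` C) w2 x) ->
  forall z : T' -> \bar R, measurable_fun setT z -> (forall y, 0 <= z y) ->
  \int[mu1]_x (z (f1 x) * w1 x) = \int[mu2]_x (z (f2 x) * w2 x).
Proof.
move=> mf1 mf2 mw1 mw2 w10 w20 H z mz z0.
rewrite !(weighted_integral_limn _ mz)//.
by apply: congr_lim; apply/funext => n; apply: eq_fsbigr => r _; rewrite H.
Qed.

End weighted.

Section finite_integral.
Local Open Scope ereal_scope.

Lemma integral_seq d (T : measurableType d) (R : realType)
    (mu : {measure set T -> \bar R}) (D : set T) (s : seq T) (f : T -> R) :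
  uniq s -> measurable D -> (forall x, D x <-> x \in s) ->
  (forall x, x \in s -> measurable [set x]) -> mu D < +oo ->
  \int[mu]_(x in D) (f x)%:E = \sum_(x <- s) (f x)%:E * mu [set x].
Proof.
move=> us mD Ds ms muD.
have i1 y : y \in s -> mu.-integrable D (fun x => (\1_[set y] x)%:E).
  move=> ys; apply: measurable_bounded_integrable => //.
    by apply: measurable_indic; exact: ms.
  exists 1%R; split; first exact: real1.
  by move=> x x1 z _; rewrite /= indicE; case: (_ \in _); rewrite ?normr1 ?normr0 ltW//;
    rewrite (lt_trans _ x1).
pose h y := if y \in s then (fun x => (f y)%:E * (\1_[set y] x)%:E) else cst 0.
have ih y : mu.-integrable D (h y).
  rewrite /h; case: ifPn => ys; last exact: integrable0.
  by apply: integrableZl => //; exact: i1.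
rewrite (eq_integral (fun x => \sum_(y <- s) h y x)).
  rewrite integral_sum//; apply: eq_big_seq => y ys; rewrite /h ys.
  rewrite integralZl//; last exact: i1.
  rewrite integral_indic//; last exact: ms.
  congr (_ * mu _); apply/seteqP; split => [z []|z ->]//.
  by split => //; exact/Ds.
move=> x; rewrite inE => /Ds xs; rewrite (bigD1_seq x)//= {1}/h xs indicE.
rewrite mem_set// mule1 big1 ?adde0// => y yx; rewrite /h; case: ifP => // _.
by rewrite indicE memNset ?mule0//= => xy; rewrite xy eqxx in yx.
Qed.

End finite_integral.

(** * Waiting times with a bounded measurable rate *)

Section survival.
Context (R : realType).
Local Notation mu := (@lebesgue_measure R).

Lemma lebesgue_measure_shift (a : R) (A : set (measurableTypeR R)) : measurable A ->
  mu A = pushforward mu (fun x : measurableTypeR R => x + a : measurableTypeR R) A.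
Proof.
move=> mA.
have ma : measurable_fun setT (fun x : measurableTypeR R => x + a : measurableTypeR R).
  exact: measurable_funD.
pose nu : {measure set (measurableTypeR R) -> \bar R} :=
  measure_function_pushforward__canonical__measure_function_Measure mu ma.
apply: (@lebesgue_measure_unique _ nu) => //= _ [[b c]] _ <-.
rewrite /nu/= /pushforward/=.
have -> : (fun x => x + a) @^-1` `]b, c] = `]b - a, c - a]%classic :> set R.
  by apply/seteqP; split => x /=; rewrite !in_itv/= ltrBlDr lerBrDr.
rewrite !lebesgue_measure_itv/= !lte_fin ltrD2r -!EFinB.
by case: ifP => // _; congr (_%:E); lra.
Qed.

Lemma integral_shift (a : R) (f : R -> \bar R) :
  measurable_fun setT f -> (forall x, 0 <= f x)%E ->
  (\int[mu]_x f x = \int[mu]_x f ((x : R) + a)%R)%E.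
Proof.
move=> mf f0.
have ma : measurable_fun setT (fun x : measurableTypeR R => x + a : measurableTypeR R).
  exact: measurable_funD.
rewrite -[RHS](@ge0_integral_pushforward _ _ _ _ _ _ ma mu setT f)//.
by apply: eq_measure_integral => A mA _; exact: (lebesgue_measure_shift a mA).
Qed.

(** Cutting the interval from [0] to [t] into [n] equal pieces bounds the total increment by
    [C * t ^+ 2 / n]. This takes the place of differentiation for functions
    given by an integral of a rate that is only measurable. *)
Lemma quadratic_modulus_cst (D : R -> R) (C : R) :
  (forall s t : R, 0 <= s -> s <= t -> `|D t - D s| <= C * (t - s) ^+ 2) ->
  forall t : R, 0 <= t -> D t = D 0.
Proof.
move=> H t t0; apply/eqP; rewrite -subr_eq0 -normr_eq0; apply/negPn/negP => ne.
have x0 : 0 < `|D t - D 0| by rewrite lt_neqAle eq_sym ne normr_ge0.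
have step n (h : R) : 0 <= h -> `|D (n%:R * h) - D 0| <= n%:R * (C * h ^+ 2).
  move=> h0; elim: n => [|n ih]; first by rewrite !mul0r subrr normr0.
  rewrite -(subrKA (D (n%:R * h))) (le_trans (ler_normD _ _))//.
  rewrite -natr1 [leRHS]mulrDl mul1r addrC; apply: lerD => //.
  have := H (n%:R * h) ((n%:R + 1) * h).
  rewrite mulrDl mul1r [_ + h]addrC addrK; apply; first exact: mulr_ge0.
  by rewrite lerDr.
(* so many pieces that the bound falls below the supposed increment *)
pose n := Num.truncn (C * t ^+ 2 / `|D t - D 0|).
have := step n.+1 (t / n.+1%:R); rewrite mulrCA divff ?pnatr_eq0// mulr1.
move=> /(_ (divr_ge0 t0 (ler0n _ _))).
have m0 : n.+1%:R != 0 :> R by rewrite pnatr_eq0.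
have -> : n.+1%:R * (C * (t / n.+1%:R) ^+ 2) = C * t ^+ 2 / n.+1%:R.
  by move: m0; set m := n.+1%:R => m0; field.
rewrite ler_pdivlMr ?ltr0n// -ler_pdivlMl// leNgt => /negP; apply.
by rewrite mulrC Num.Theory.truncnS_gt.
Qed.

(** One step of the survival function [g], from [g0] to [g1], against an
    integral [j] of the rate times [g]: as [g] decreases, [j] is between
    [d * g1] and [d * g0], and so is the drop [g0 - g1], by [1 + x <= expR x]
    at [x = d] and [x = - d]. These bounds differ by at most [d ^+ 2]. *)
Lemma exp_decay_step (g0 g1 d j B : R) : 0 <= g0 <= 1 -> 0 <= d <= B ->
  g1 = g0 * expR (- d) -> d * g1 <= j <= d * g0 -> `|g1 + j - g0| <= B ^+ 2.
Proof.
move=> /andP[g00 g01] /andP[d0 dB] g1E /andP[j1 j2].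
have e1 : g0 - g1 <= d * g0.
  have := ler_wpM2l g00 (expR_ge1Dx (- d)); rewrite -g1E; lra.
have g0E : g0 = g1 * expR d by rewrite g1E -mulrA -expRD addNr expR0 mulr1.
have g10 : 0 <= g1 by rewrite g1E mulr_ge0// expR_ge0.
have e2 : d * g1 <= g0 - g1.
  have := ler_wpM2l g10 (expR_ge1Dx d); rewrite -g0E; lra.
apply: (@le_trans _ _ (d * (d * g0))).
  have := ler_wpM2l d0 e1; rewrite ler_norml mulrBr => e3.
  by apply/andP; split; lra.
rewrite mulrA expr2 -[leRHS]mulr1 ler_pM// ?mulr_ge0//.
by rewrite ler_pM.
Qed.

Section exponential_survival.
Variables (lam : R -> R) (Q : R).
Hypothesis mlam : measurable_fun setT lam.
Hypothesis lam0 : forall x, 0 <= lam x.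
Hypothesis lamQ : forall x, lam x <= Q.

Definition hazard (t : R) : R := \int[mu]_(v in `]0, t]) lam v.

Lemma bounded_integrable_itv (f : R -> R) (C : R) (a b : R) :
  measurable_fun setT f -> (forall x, `|f x| <= C) ->
  mu.-integrable `]a, b] (EFin \o f).
Proof.
move=> mf fC; apply: measurable_bounded_integrable => //.
- by rewrite /= lebesgue_measure_itv/=; case: ifP => // _; rewrite -EFinB ltry.
- exact: measurable_funS mf.
- exists C; split; first by rewrite num_real.
  by move=> x Cx y _; apply: le_trans (fC y) _; exact: ltW.
Qed.

Lemma Rintegral_itv_le (f : R -> R) (C : R) (a b : R) : a <= b ->
  measurable_fun setT f -> (forall x, 0 <= f x <= C) ->
  0 <= \int[mu]_(v in `]a, b]) f v <= C * (b - a).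
Proof.
move=> ab mf fC.
have f0 x : 0 <= f x by case/andP: (fC x).
have C0 : 0 <= C by case/andP: (fC 0) => /le_trans; exact.
rewrite Rintegral_ge0//=.
have -> : C * (b - a) = \int[mu]_(v in `]a, b]) C.
  rewrite Rintegral_cst//= lebesgue_measure_itv/= lte_fin.
  move: ab; rewrite le_eqVlt => /predU1P[->|->]; last by rewrite -EFinB.
  by rewrite subrr ltxx.
apply: le_Rintegral => //.
- apply: (@bounded_integrable_itv _ C) => // x; case/andP: (fC x) => *.
  by rewrite ger0_norm.
- apply: (@bounded_integrable_itv _ C) => // x.
  by rewrite ger0_norm.
- by move=> x _; case/andP: (fC x).
Qed.

Lemma Rintegral_itvD (f : R -> R) (C : R) (s t : R) : 0 <= s -> s <= t ->
  measurable_fun setT f -> (forall x, `|f x| <= C) ->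
  \int[mu]_(v in `]0, t]) f v =
  \int[mu]_(v in `]0, s]) f v + \int[mu]_(v in `]s, t]) f v.
Proof.
move=> s0 st mf fC; rewrite -(@Rintegral_itvB _ f (BRight 0) (BRight t) s)//.
  by rewrite addrC subrK.
exact: bounded_integrable_itv fC.
Qed.

Lemma hazard_ge0 t : 0 <= hazard t.
Proof. exact: Rintegral_ge0. Qed.

Let lam_norm x : `|lam x| <= Q. Proof. by rewrite ger0_norm. Qed.
Let lam_itv x : 0 <= lam x <= Q. Proof. by rewrite lam0 lamQ. Qed.

Lemma hazard0 t : t <= 0 -> hazard t = 0.
Proof. by move=> t0; rewrite /hazard set_itv_ge ?Rintegral_set0// bnd_simp -leNgt. Qed.

Lemma nondecreasing_hazard : {homo hazard : s t / s <= t}.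
Proof.
move=> s t st; have [s0|/ltW s0] := leP 0 s; last first.
  by rewrite hazard0// hazard_ge0.
rewrite /hazard (Rintegral_itvD s0 st mlam lam_norm) lerDl.
by case/andP: (Rintegral_itv_le st mlam lam_itv).
Qed.

(** The sum of the survival function and of the integral of its density has
    increments of second order by [exp_decay_step], hence is constant. The
    integral is the probability that a jump occurs before [t]. *)
Lemma integral_survival (t : R) : 0 <= t ->
  (\int[mu]_(v in `]0%R, t[) (lam v * expR (- hazard v))%:E =
   (1 - expR (- hazard t))%:E)%E.
Proof.
move=> t0.
have mh : measurable_fun setT hazard.
  by apply: nondecreasing_measurable => //; exact: nondecreasing_hazard.
have Q0 : 0 <= Q by apply: le_trans (lam0 0) (lamQ 0).
pose G v := expR (- hazard v).
have G1 v : 0 <= G v <= 1 by rewrite expR_ge0 -expR0 ler_expR oppr_le0 hazard_ge0.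
have mf : measurable_fun setT (fun v => lam v * G v).
  apply: measurable_funM => //; apply: measurableT_comp => //.
  exact: measurableT_comp.
have fQ x : 0 <= lam x * G x <= Q.
  case/andP: (G1 x) => a b; rewrite mulr_ge0//=.
  by rewrite -[Q]mulr1 ler_pM.
have fQn x : `|lam x * G x| <= Q by case/andP: (fQ x) => *; rewrite ger0_norm.
rewrite integral_itv_bndo_bndc//; last first.
  by apply/measurable_EFinP; exact: measurable_funS mf.
pose J t := \int[mu]_(v in `]0, t]) (lam v * G v).
have -> : (\int[mu]_(v in `]0%R, t]) (lam v * G v)%:E = (J t)%:E)%E.
  rewrite /J /Rintegral fineK//; apply: integrable_fin_num => //.
  exact: (@bounded_integrable_itv _ Q).
congr (_%:E); suff : G t + J t = 1 by move=> <-; rewrite addrC addKr.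
have -> : 1 = G 0 + J 0.
  by rewrite /G /J hazard0// set_itv_ge ?Rintegral_set0 ?bnd_simp ?ltxx// oppr0 expR0 addr0.
apply: (@quadratic_modulus_cst (fun t => G t + J t) (Q ^+ 2)) => // {t t0} s t s0 st.
have hD : hazard t = hazard s + \int[mu]_(v in `]s, t]) lam v.
  exact: (Rintegral_itvD s0 st mlam lam_norm).
have /andP[d0 dQ] := Rintegral_itv_le st mlam lam_itv.
set d := \int[mu]_(v in `]s, t]) lam v in hD d0 dQ.
have -> : J t = J s + \int[mu]_(v in `]s, t]) (lam v * G v).
  exact: (Rintegral_itvD s0 st mf fQn).
set j := \int[mu]_(v in `]s, t]) (lam v * G v).
have Gts : G t <= G s by rewrite ler_expR lerN2 nondecreasing_hazard.
have il (k : R) : mu.-integrable `]s, t] (EFin \o (fun v => lam v * k)).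
  apply: (@bounded_integrable_itv _ (Q * `|k|)) => //.
    by apply: measurable_funM.
  by move=> x; rewrite normrM ler_wpM2r.
have dE k : d * k = \int[mu]_(v in `]s, t]) (lam v * k).
  rewrite (@RintegralZr _ _ _ mu _ lam)//.
  exact: (@bounded_integrable_itv lam Q).
have fint : mu.-integrable `]s, t] (EFin \o (fun v => lam v * G v)).
  exact: (@bounded_integrable_itv (fun v => lam v * G v) Q).
have Gmono (x y : R) : x <= y -> G y <= G x.
  by move=> xy; rewrite ler_expR lerN2 nondecreasing_hazard.
have lowG (x : R) : `]s, t]%classic x -> lam x * G t <= lam x * G x.
  by rewrite /= in_itv/= => /andP[_ xt]; exact: ler_wpM2l (lam0 x) _ _ (Gmono _ _ xt).
have highG (x : R) : `]s, t]%classic x -> lam x * G x <= lam x * G s.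
  by rewrite /= in_itv/= => /andP[/ltW sx _]; exact: ler_wpM2l (lam0 x) _ _ (Gmono _ _ sx).
clearbody d.
have jl : d * G t <= j.
  by rewrite dE; apply: le_Rintegral; [exact: measurable_itv|exact: il|exact: fint|exact: lowG].
have ju : j <= d * G s.
  by rewrite dE; apply: le_Rintegral; [exact: measurable_itv|exact: fint|exact: il|exact: highG].
clearbody j J.
have -> : G t + (J s + j) - (G s + J s) = G t + j - G s by ring.
rewrite -exprMn; apply: (@exp_decay_step _ _ d) => //.
- by rewrite d0 dQ.
- by rewrite /G hD opprD expRD.
- by rewrite jl ju.
Qed.

End exponential_survival.
End survival.

(** * The linear program: uniqueness and supports *)

Section balance.
Context (R : realType) (S : finType).

(** [B] is a generator, so [alpha - B] is diagonally dominant: isolating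
    the diagonal gives [alpha * `|h x| <= \sum_y B y x * `|h y|], whose sum over
    [x] has a vanishing right-hand side. *)
Lemma balance_unique (alpha : R) (B : S -> S -> R) (h : S -> R) :
  0 < alpha ->
  (forall x y, x != y -> 0 <= B y x) -> (forall y, \sum_x B y x = 0) ->
  (forall x, alpha * h x = \sum_y B y x * h y) ->
  forall x, h x = 0.
Proof.
move=> a0 B0 Bsum hE.
have Bd x : B x x <= 0.
  have := Bsum x; rewrite (bigD1 x)//= => /eqP; rewrite addr_eq0 => /eqP->.
  by rewrite oppr_le0 sumr_ge0// => y yx; apply: B0.
have le x : alpha * `|h x| <= \sum_y B y x * `|h y|.
  rewrite (bigD1 x)//= -lerBlDl -mulrBl.
  have c0 : 0 < alpha - B x x by have := Bd x; lra.
  rewrite -{1}(gtr0_norm c0) -normrM.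
  have -> : (alpha - B x x) * h x = \sum_(y | y != x) B y x * h y.
    by rewrite mulrBl hE (bigD1 x)//= addrC addrK.
  apply: le_trans (ler_norm_sum _ _ _) _; apply: ler_sum => y yx.
  by rewrite normrM ger0_norm// B0// eq_sym.
have : alpha * \sum_x `|h x| <= 0.
  rewrite mulr_sumr; apply: le_trans (ler_sum _ (fun x _ => le x)) _.
  rewrite exchange_big/= big1// => y _.
  by rewrite -mulr_suml Bsum mul0r.
rewrite pmulr_rle0// => h0 x; apply/eqP; rewrite -normr_le0.
apply: le_trans h0; rewrite (bigD1 x)//= lerDl; exact: sumr_ge0.
Qed.

End balance.

Section support.
Context (R : realType) (I J : finType).

(** The columns in [B] lie in the span of the unit vectors of the rows [K]. *)
Lemma free_columns_card (M : I -> J -> R) (B : {set J}) (K : {set I}) :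
  free [seq [ffun i => M i j] : {ffun I -> R^o} | j <- enum B] ->
  (forall i j, j \in B -> i \notin K -> M i j = 0) ->
  (#|B| <= #|K|)%N.
Proof.
move=> fB M0.
pose e (i : I) : {ffun I -> R^o} := [ffun i' => (i == i')%:R].
have sub : (<<[seq [ffun i => M i j] : {ffun I -> R^o} | j <- enum B]>>
            <= <<[seq e i | i <- enum K]>>)%VS.
  apply/span_subvP => v /mapP[j]; rewrite mem_enum => jB ->.
  have -> : [ffun i => M i j] = \sum_(i in K) M i j *: e i.
    apply/ffunP => i; rewrite ffunE sum_ffunE.
    under eq_bigr do rewrite !ffunE.
    have [iK|iK] := boolP (i \in K).
      rewrite (bigD1 i)//= eqxx big1 ?addr0 => [|k /andP[_ /negbTE->]].
        by rewrite [RHS]mulr1.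
      by rewrite scaler0.
    rewrite M0// big1// => k kK; case: eqP => [ki|_]; last by rewrite scaler0.
    by rewrite -ki kK in iK.
  apply: memv_suml => i iK; apply: memvZ; apply: memv_span.
  by apply/mapP; exists i; rewrite ?mem_enum.
have := dimvS sub; move: fB; rewrite /free => /eqP->.
rewrite size_map -cardE => /leq_trans; apply.
by apply: leq_trans (dim_span _) _; rewrite size_map -cardE.
Qed.

Lemma subset_free (M : I -> J -> R) (B C : {set J}) : C \subset B ->
  free [seq [ffun i => M i j] : {ffun I -> R^o} | j <- enum B] ->
  free [seq [ffun i => M i j] : {ffun I -> R^o} | j <- enum C].
Proof.
move=> CB.
rewrite (perm_free (_ : perm_eq _ ([seq [ffun i => M i j] : {ffun I -> R^o} | j <- enum C] ++
  [seq [ffun i => M i j] : {ffun I -> R^o} | j <- enum (B :\: C)]))).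
  exact: catl_free.
rewrite -map_cat; apply: perm_map; apply: uniq_perm.
- exact: enum_uniq.
- rewrite cat_uniq !enum_uniq andbT/=; apply/hasPn => j.
  by rewrite !mem_enum inE => /andP[].
- move=> j; rewrite mem_cat !mem_enum inE; have := fintype.subsetP CB j.
  by case: (j \in C) => //= ->.
Qed.

End support.

Section randomizations.
Context (R : realType) dS (S : finStateType dS) (A : completePseudoMetricType R).
Variables (adm : S -> {fset A}) (q : S -> A -> {charge set S -> \bar R}).
Hypothesis q_rate : is_transition_rate adm q.
Variables (alpha : R) (gamma : probability S R) (N : nat).
Variables (c : 'I_N -> S -> A -> R) (d : 'I_N -> R).
Variable eta : S -> A -> R.

Definition marginal (x : S) : R := \sum_(a <- adm x) eta x a.

Lemma rate_ge0 x y a : a \in adm y -> x != y -> 0 <= rate q x y a.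
Proof.
move=> ay xy; apply: fine_ge0; have [+ _] := q_rate ay; apply.
by move=> /= yx; rewrite yx eqxx in xy.
Qed.

Lemma marginal_gt0 x a : (forall a, a \in adm x -> 0 <= eta x a) ->
  a \in adm x -> 0 < eta x a -> 0 < marginal x.
Proof.
move=> e0 ax ea; apply: lt_le_trans ea _.
rewrite /marginal (big_rem a)//= lerDl big_seq; apply: sumr_ge0 => b /mem_rem.
exact: e0.
Qed.

Lemma marginal_ge0 x : (forall a, a \in adm x -> 0 <= eta x a) -> 0 <= marginal x.
Proof. by move=> e0; rewrite /marginal big_seq; apply: sumr_ge0 => a; exact: e0. Qed.

Lemma unvisited_action x a : (forall a, a \in adm x -> 0 <= eta x a) ->
  marginal x <= 0 -> a \in adm x -> eta x a = 0.
Proof.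
move=> e0 mx ax; apply/eqP; rewrite eq_le e0// andbT leNgt; apply/negP => ea.
by have := marginal_gt0 e0 ax ea; rewrite ltNge mx.
Qed.

(** In the balance equation at an unvisited state the left-hand side is zero
    and the terms on the right are nonnegative, hence all zero. *)
Lemma no_rate_to_unvisited x y a :
  lp_feasible adm q alpha gamma c d eta -> 0 <= alpha ->
  marginal x <= 0 -> a \in adm y -> 0 < eta y a -> rate q x y a = 0.
Proof.
move=> [_ bal e0] al0 mx ay eya.
have xy : x != y.
  apply: contraTneq mx => ->; rewrite -ltNge.
  by apply: marginal_gt0 ay eya => b; exact: e0.
have mx0 : marginal x = 0.
  by apply/eqP; rewrite eq_le mx/= marginal_ge0// => b; exact: e0.
have ex0 b : b \in adm x -> eta x b = 0 by apply: unvisited_action mx; exact: e0.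
have t0 z b : b \in adm z -> 0 <= rate q x z b * eta z b.
  move=> bz; have [xz|xz] := eqVneq x z; first by rewrite -xz ex0 ?mulr0// xz.
  by rewrite mulr_ge0 ?e0// rate_ge0.
have s0 z : 0 <= \sum_(b <- adm z) rate q x z b * eta z b.
  by rewrite big_seq; apply: sumr_ge0 => b; exact: t0.
have := bal x; rewrite -/(marginal x) mx0 mulr0 => /esym/eqP.
have g0 : 0 <= alpha * fine (gamma [set x]) by rewrite mulr_ge0// fine_ge0.
rewrite paddr_eq0// => [/andP[_]|]; last by apply: sumr_ge0.
rewrite psumr_eq0// => /allP/(_ y (mem_index_enum _)) /= /eqP.
rewrite (big_rem a)//= => /eqP; rewrite paddr_eq0 ?t0//.
  by move=> /andP[/eqP /eqP + _]; rewrite mulf_eq0 (gt_eqF eya) orbF => /eqP.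
by rewrite big_seq; apply: sumr_ge0 => b /mem_rem; exact: t0.
Qed.

Definition support_at (x : S) : {fset A} := [fset a in adm x | 0 < eta x a]%fset.

(** The positive variables are basic, so their columns are free, and by
    [no_rate_to_unvisited] these columns vanish on the rows of the unvisited
    states. *)
Lemma support_card : lp_basic_feasible adm q alpha gamma c d eta -> 0 <= alpha ->
  (\sum_x #|` support_at x| <= #|[pred x | (0 < marginal x)%R]| + N)%N.
Proof.
move=> [feas [_ [B [_ fB B0]]]] al0.
have e0 : forall x a, a \in adm x -> 0 <= eta x a by case: feas.
pose C : {set lp_var adm N} :=
  [set j | if j is inl (existT y a) then 0 < eta y (val a) else false]%SET.
pose K : {set lp_row S N} :=
  [set i | if i is inl x then 0 < marginal x else true]%SET.
have CB : C \subset B.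
  apply/fintype.subsetP => -[[y a]|n]; rewrite inE//= => ey; apply/negPn/negP => jB.
  by have := B0 _ jB; rewrite /= => e; rewrite e ltxx in ey.
have CK : (#|C| <= #|K|)%N.
  apply: (@free_columns_card R _ _ (@lp_matrix R dS S A adm q alpha N c)).
    exact: subset_free CB fB.
  move=> [x|n] [[y a]|n']; rewrite !inE//= -leNgt => ey mx.
  have -> : (x == y) = false.
    apply: contra_leF mx => /eqP ->.
    by apply: (@marginal_gt0 y (val a)) ey; [exact: e0|exact: valP].
  by rewrite mulr0n (no_rate_to_unvisited feas) ?subr0//; exact: valP.
have cardC : #|C| = (\sum_x #|` support_at x|)%N.
  rewrite -sum1_card big_sumType/= [X in (_ + X)%N]big1 ?addn0; last first.
    by move=> n; rewrite inE.
  rewrite [RHS](eq_bigr (fun x => \sum_(a : adm x | (0 < eta x (val a))%R) 1)%N); last first.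
    move=> x _.
    by rewrite -(big_seq_fsetE _ _ (fun a => 0 < eta x a) (fun _ => 1%N)) big_fset_condE sum1_size.
  rewrite (sig_big_dep xpredT (fun x (a : adm x) => 0 < eta x (val a)) (fun _ _ => 1%N)).
  by apply: eq_bigl => -[y a]; rewrite inE.
have cardK : #|K| = (#|[pred x | (0 < marginal x)%R]| + N)%N.
  rewrite -sum1_card big_sumType/=; congr addn.
    by rewrite -sum1_card; apply: eq_bigl => x; rewrite !inE.
  rewrite (eq_bigl xpredT) ?sum1_card ?card_ord//.
  by move=> n; rewrite inE.
by rewrite -cardC -cardK.
Qed.

(** An unvisited state uses the single action [act x]; a visited one has as
    many actions of positive probability as [eta] has positive entries there. *)
Lemma randomizations_le (act : S -> A) (phi : R.-pker S ~> Borel A) :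
  lp_basic_feasible adm q alpha gamma c d eta -> 0 <= alpha ->
  is_induced_policy adm eta act phi -> (randomizations adm phi <= N)%N.
Proof.
move=> bas al0 [_ phiE].
have e0 : forall x a, a \in adm x -> 0 <= eta x a by case: bas => -[].
have rE x : randomizations_at adm phi x =
    if 0 < marginal x then #|` support_at x|.-1 else 0%N.
  rewrite /randomizations_at; case: ifPn => mx.
    congr (#|` _ |.-1); apply/fsetP => a; rewrite !inE.
    have [ax|//] := boolP (a \in adm x).
    by rewrite /= phiE// -/(marginal x) mx lte_fin pmulr_lgt0 ?invr_gt0.
  have : (#|` [fset a in adm x | (0 < phi x [set a])%E]%fset| <= #|` [fset act x]%fset|)%N.
    apply: fsubset_leq_card; apply/fsubsetP => a; rewrite !inE => /andP[/= ax].
    rewrite phiE// -/(marginal x) (negbTE mx) lte_fin.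
    by case: (a == act x) => //; rewrite ltxx.
  by rewrite cardfs1; case: #|` _ | => [|[]].
have := support_card bas al0.
rewrite (bigID (fun x => 0 < marginal x))/= [X in (_ + X <= _)%N]big1 ?addn0; last first.
  move=> x mx; apply/eqP; rewrite cardfs_eq0; apply/eqP/fsetP => a; rewrite !inE.
  apply/negP => /andP[/= ax ea]; move/negP : mx; apply.
  exact: marginal_gt0 (e0 x) ax ea.
have -> : (\sum_(x | (0 < marginal x)%R) #|` support_at x| =
    \sum_(x | (0 < marginal x)%R) randomizations_at adm phi x + #|[pred x | (0 < marginal x)%R]|)%N.
  rewrite -sum1_card (eq_bigl (fun x => 0 < marginal x) (fun=> 1%N)); last first.
    by move=> x; rewrite inE.
  rewrite -big_split/=; apply: eq_bigr => x mx; rewrite rE mx addn1 prednK// cardfs_gt0.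
  apply: contraTneq mx => s0; rewrite -leNgt /marginal big_seq; apply: sumr_le0 => a ax.
  rewrite leNgt; apply/negP => ea.
  by have : a \in support_at x by [rewrite !inE ax]; rewrite s0 inE.
rewrite addnC leq_add2l; apply: leq_trans.
rewrite /randomizations (bigID (fun x => 0 < marginal x))/= [X in (_ + X <= _)%N]big1 ?addn0//.
by move=> x /negbTE mx; rewrite rE mx.
Qed.

End randomizations.

(** * Trajectories *)

Section trajectory_theory.
Context (R : realType) dS (S : finStateType dS).
Implicit Types e : Omega R S.

Lemma sojourn_gt0 e k : (0 < sojourn e k)%E.
Proof.
have [_ /(_ k)] := trajectoryP e; case: (state e k.+1) => [x [_ [t t0 ->]]|->].
  by rewrite lte_fin.
exact: ltry.
Qed.

Lemma sojourn_fin e k : state e k.+1 <> None ->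
  exists2 t : R, 0 < t & sojourn e k = t%:E.
Proof. by have [_ /(_ k)] := trajectoryP e; case: (state e k.+1) => // x [_]. Qed.

Lemma sojourn_absorbed e k : state e k.+1 = None -> sojourn e k = +oo%E.
Proof. by have [_ /(_ k)] := trajectoryP e; case: (state e k.+1). Qed.

Lemma alive_le e j k : (j <= k)%N -> state e k <> None -> state e j <> None.
Proof.
move=> /subnKC <-; elim: (k - j)%N => [|n ih]; rewrite ?addn0// addnS => h.
apply: ih; have [_ /(_ (j + n)%N)] := trajectoryP e.
by case: (state e (j + n).+1) h => // x _ [].
Qed.

Lemma alive0 e : state e 0 <> None.
Proof. by have [] := trajectoryP e. Qed.

Lemma jump_time0 e : jump_time e 0 = 0%E.
Proof. by rewrite /jump_time big_geq. Qed.

Lemma jump_timeS e k : jump_time e k.+1 = (jump_time e k + sojourn e k)%E.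
Proof. by rewrite /jump_time big_nat_recr. Qed.

Lemma jump_time_ge0 e k : (0 <= jump_time e k)%E.
Proof. by apply: sume_ge0 => i _; apply: ltW; exact: sojourn_gt0. Qed.

Lemma jump_time_le e j k : (j <= k)%N -> (jump_time e j <= jump_time e k)%E.
Proof.
move=> /subnKC <-; elim: (k - j)%N => [|n ih]; first by rewrite addn0.
apply: le_trans ih _; rewrite addnS jump_timeS leeDl// ltW//; exact: sojourn_gt0.
Qed.

Lemma jump_time_fin e k : state e k <> None -> jump_time e k \is a fin_num.
Proof.
elim: k => [|k ih]; first by rewrite jump_time0.
move=> h; rewrite jump_timeS fin_numD ih; last exact: alive_le h.
by have [t _ ->] := sojourn_fin h.
Qed.

Lemma jump_time_alive e k : (jump_time e k < +oo)%E -> state e k <> None.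
Proof.
case: k => [_|k]; first exact: alive0.
rewrite jump_timeS => + /sojourn_absorbed ek; rewrite ek.
by have := jump_time_ge0 e k; case: (jump_time e k).
Qed.

Lemma jump_time_lt e k : state e k <> None -> (jump_time e k < jump_time e k.+1)%E.
Proof.
move=> h; rewrite jump_timeS lteDl ?sojourn_gt0//; exact: jump_time_fin.
Qed.

(** Sojourns contain their right end point but not the left one, as left
    limits are taken. *)
Definition sojourning e k (t : R) := (jump_time e k < t%:E <= jump_time e k.+1)%E.

Lemma sojourning_inj e t j k : sojourning e j t -> sojourning e k t -> j = k.
Proof.
wlog jk : j k / (j < k)%N => [hw|] hj hk.
  have [jk|kj|//] := ltngtP j k; first exact: hw.
  by apply/esym; exact: hw.
have /andP[_ tj] := hj; have /andP[kt _] := hk.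
by have := lt_le_trans kt (le_trans tj (jump_time_le e jk)); rewrite ltxx.
Qed.

Lemma sojourning_gt0 e k t : sojourning e k t -> 0 < t.
Proof. by case/andP=> h _; rewrite -lte_fin; apply: le_lt_trans h; exact: jump_time_ge0. Qed.

Lemma sojourning_alive e k t : sojourning e k t -> state e k <> None.
Proof. by case/andP=> h _; apply: jump_time_alive; apply: lt_trans h _; rewrite ltry. Qed.

Lemma state_before0 e : state_before e 0 = state e 0.
Proof. by rewrite /state_before eqxx. Qed.

Lemma state_before_sojourning e k t : sojourning e k t -> state_before e t = state e k.
Proof.
move=> h; rewrite /state_before gt_eqF ?(sojourning_gt0 h)//.
case: xgetP => [y _ [j [hj ->]]|/(_ (state e k))]; last by case; exists k.
by rewrite (sojourning_inj h hj).
Qed.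

Lemma state_before_Some e t x : 0 < t ->
  state_before e t = Some x <-> exists2 k, sojourning e k t & state e k = Some x.
Proof.
move=> t0; split=> [|[k h <-]]; last exact: state_before_sojourning.
rewrite /state_before gt_eqF//.
by case: xgetP => [y -> [k [hk ->]] ekx|_ //]; exists k.
Qed.

Lemma explosionP e t : 0 < t ->
  (t%:E < explosion_time e)%E <-> exists k, sojourning e k t.
Proof.
move=> t0; split.
  move=> tT.
  have [k tk] : exists k, (t%:E <= jump_time e k)%E.
    apply/not_existsP => h; move: tT; apply/negP; rewrite -leNgt.
    apply: lime_le.
      by apply: is_cvg_nneseries => n _ _; apply: ltW; exact: sojourn_gt0.
    by apply: nearW => n; apply: ltW; rewrite ltNge; apply/negP; exact: h.
  have hex : exists k, (t%:E <= jump_time e k)%E by exists k.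
  case: (ex_minnP hex) => -[|m] tm mmin.
    by move: tm; rewrite jump_time0 lee_fin leNgt t0.
  exists m; rewrite /sojourning tm andbT ltNge; apply/negP => /mmin.
  by rewrite ltnn.
move=> [k hk]; have /andP[kt tk] := hk.
have lim n : (jump_time e n <= explosion_time e)%E.
  by apply: nneseries_lim_ge => i _ _; apply: ltW; exact: sojourn_gt0.
have [ek|ek] := pselect (state e k.+1 = None).
  apply: lt_le_trans (ltry t) _; apply: le_trans (lim k.+1).
  by rewrite jump_timeS (sojourn_absorbed ek) addey// -ltNye (lt_le_trans _ (jump_time_ge0 e k)).
apply: le_lt_trans tk _; apply: lt_le_trans (lim k.+2).
exact: jump_time_lt.
Qed.

Lemma explosion_gt0 e : (0 < explosion_time e)%E.
Proof.
apply: lt_le_trans (sojourn_gt0 e 0) _.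
have := @nneseries_lim_ge R (sojourn e) xpredT 0 1 (fun i _ _ => ltW (sojourn_gt0 e i)).
by rewrite big_nat1.
Qed.

Lemma measurable_state k (D : set (adjoin S)) : measurable [set e : Omega R S | D (state e k)].
Proof. by apply: sub_sigma_algebra; left; exists k, D. Qed.

Lemma measurable_sojourn k : measurable_fun setT (fun e : Omega R S => sojourn e k).
Proof.
move=> _ B mB; rewrite setTI; apply: sub_sigma_algebra; right.
by exists k, B.
Qed.

Lemma measurable_jump_time k : measurable_fun setT (fun e : Omega R S => jump_time e k).
Proof.
rewrite /jump_time; apply: emeasurable_sum => i.
exact: measurable_sojourn.
Qed.

End trajectory_theory.

(** * Freezing a trajectory after its k-th jump *)

Section absorb.
Context (R : realType) dS (S : finStateType dS).

Lemma absorb_is_trajectory (k : nat) (e : Omega R S) :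
  is_trajectory (fun j => if (j <= k)%N then state e j else None)
                (fun j => if (j < k)%N then sojourn e j else +oo%E).
Proof.
split; first exact: alive0.
move=> j; case: ifPn => // jk; rewrite (ltnW jk).
by have [_] := trajectoryP e; apply.
Qed.

(** The trajectory that agrees with [e] up to its [k]-th jump and never jumps
    again. It depends on the history [hist k e] only, and is in its [k]-th
    state at every later time; evaluating a control along it therefore
    yields the intensity after the [k]-th jump as a function of the history
    and of the elapsed time. *)
Definition absorb (k : nat) (e : Omega R S) : Omega R S :=
  Trajectory (absorb_is_trajectory k e).

Lemma state_absorb k e j : (j <= k)%N -> state (absorb k e) j = state e j.
Proof. by move=> /= ->. Qed.

Lemma jump_time_absorb k e j : (j <= k)%N -> jump_time (absorb k e) j = jump_time e j.
Proof.
move=> jk; rewrite /jump_time; apply: eq_big_nat => i /andP[_ ij] /=.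
by rewrite (leq_trans ij jk).
Qed.

Lemma jump_time_absorbS k e : jump_time (absorb k e) k.+1 = +oo%E.
Proof.
rewrite jump_timeS /= ltnn addey// -ltNye (lt_le_trans _ (jump_time_ge0 _ k))//.
Qed.

Lemma hist_absorb k e : hist k (absorb k e) = hist k e.
Proof.
rewrite /hist; congr pair => /=; apply/eq_in_map => i.
by rewrite mem_iota /= => ik; rewrite ik.
Qed.

(** Coordinates beyond the [k]-th jump are constant along frozen trajectories,
    so they contribute the empty or the full event. *)
Lemma absorb_history k (C : set (Omega R S)) : measurable C -> history_sigma k (absorb k @^-1` C).
Proof.
move=> mC; rewrite /history_sigma; set G := (X in <<s X >>).
have GT : <<s G >> setT.
  by have := sigma_algebraCD (@sigma_algebra0 _ setT G); rewrite setD0.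
have h : sigma_algebra setT [set C | <<s G >> (absorb k @^-1` C)].
  split.
  - by rewrite /= preimage_set0; exact: sigma_algebra0.
  - by move=> A /= hA; rewrite setTD preimage_setC -setTD; exact: sigma_algebraCD.
  - by move=> F hF /=; rewrite preimage_bigcup; exact: sigma_algebra_bigcup.
apply: (smallest_sub h _ mC) => _ [[j [D ->]]|[j [B [mB ->]]]] /=.
- have [jk|kj] := leqP j k.
    apply: sub_sigma_algebra; left; exists j, D; split => //.
    by apply/seteqP; split => e /=; rewrite jk.
  have [N|N] := pselect (D None).
    suff -> : absorb k @^-1` [set e | D (state e j)] = setT by exact: GT.
    by apply/seteqP; split => e //= _; rewrite leqNgt kj.
  suff -> : absorb k @^-1` [set e | D (state e j)] = set0 by exact: sigma_algebra0.
  by apply/seteqP; split => e //=; rewrite leqNgt kj.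
- have [jk|kj] := ltnP j k.
    apply: sub_sigma_algebra; right; exists j, B; split => //.
    by apply/seteqP; split => e /=; rewrite jk.
  have [N|N] := pselect (B +oo%E).
    suff -> : absorb k @^-1` [set e | B (sojourn e j)] = setT by exact: GT.
    by apply/seteqP; split => e //= _; rewrite ltnNge kj.
  suff -> : absorb k @^-1` [set e | B (sojourn e j)] = set0 by exact: sigma_algebra0.
  by apply/seteqP; split => e //=; rewrite ltnNge kj.
Qed.

Lemma history_measurable k (H : set (Omega R S)) : history_sigma k H -> measurable H.
Proof.
move=> hH; apply: (smallest_sub (@sigma_algebra_measurable _ (Omega R S)) _ hH).
move=> _ [[j [D [_ ->]]]|[j [B [_ mB ->]]]].
  exact: measurable_state.
by rewrite -[X in measurable X]setTI; exact: measurable_sojourn.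
Qed.

Lemma measurable_absorb k : measurable_fun setT (absorb k).
Proof. by move=> _ C mC; rewrite setTI; apply: (@history_measurable k); exact: absorb_history. Qed.

End absorb.

(** * Predictability of the state just before t *)

Lemma sigma_algebra_countU (T : Type) (I : countType) (D : set T) (M : set (set T))
    (F : I -> set T) :
  sigma_algebra D M -> (forall i, M (F i)) -> M (\bigcup_i F i).
Proof.
move=> [M0 _ MU] MF.
pose F' n := if @choice.unpickle I n is Some i then F i else set0.
have -> : \bigcup_i F i = \bigcup_n F' n.
  apply/seteqP; split=> [x [i _ xi]|x [n _]].
    by exists (choice.pickle i) => //; rewrite /F' choice.pickleK.
  by rewrite /F'; case: (@choice.unpickle I n) => // i xi; exists i.
by apply: MU => n; rewrite /F'; case: (@choice.unpickle I n).
Qed.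

Lemma sigma_algebra_setD (T : Type) (D : set T) (M : set (set T)) (X Y : set T) :
  sigma_algebra D M -> X `<=` D -> M X -> M Y -> M (X `\` Y).
Proof.
move=> sM XD MX MY; have [M0 MD _] := sM.
have -> : X `\` Y = D `\` \bigcup_b (if b then D `\` X else Y).
  apply/seteqP; split=> x /=.
    by move=> [Xx nYx]; split; [exact: XD|move=> [[] _ //= []]].
  move=> [Dx h]; split; last by move=> Yx; apply: h; exists false.
  by apply: contrapT => nXx; apply: h; exists true.
by apply: (MD); apply: (sigma_algebra_countU sM) => -[|//]; apply: (MD).
Qed.

Section predictability.
Context (R : realType) dS (S : finStateType dS).
Implicit Types e : Omega R S.

Definition visits e (k : nat) (D : set S) : nat :=
  (\sum_(i < k) (state e i \in Some @` D))%N.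

Lemma jump_measure_sojourn e k s D :
  (jump_time e k <= s%:E < jump_time e k.+1)%E ->
  jump_measure e s D = ((visits e k.+1 D)%:R : R)%:E.
Proof.
move=> /andP[ks sk]; rewrite /jump_measure (nneseries_split 0 k.+1)//.
rewrite add0n eseries0 ?adde0; last first.
  move=> i ki _; rewrite leNgt (lt_le_trans sk)//; exact: jump_time_le.
rewrite sumEFin /visits natr_sum big_mkord; congr (_%:E); apply: eq_bigr => i _.
by rewrite (le_trans _ ks)//; apply: jump_time_le; rewrite -ltnS.
Qed.

Lemma visitsT e k : state e k <> None -> visits e k.+1 setT = k.+1.
Proof.
move=> h; rewrite /visits (eq_bigr (fun=> 1%N)) ?sum1_card ?card_ord// => i _.
have : state e i <> None by apply: alive_le h; rewrite -ltnS.
by case E : (state e i) => [x|] // _; rewrite mem_set//; exists x.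
Qed.

(** The total count is finite only before explosion, and then it determines
    the current sojourn. *)
Lemma jump_measureTP e k s : 0 <= s ->
  jump_measure e s setT = (k%:R : R)%:E ->
  exists2 k', k = k'.+1 & (jump_time e k' <= s%:E < jump_time e k'.+1)%E.
Proof.
move=> s0 h.
have [all|] := pselect (forall m, (jump_time e m <= s%:E)%E).
  have alive m : state e m <> None.
    by apply: jump_time_alive; apply: le_lt_trans (all m) _; rewrite ltry.
  have : (\sum_(0 <= i < k.+1) ((jump_time e i <= s%:E)%E && (state e i \in Some @` [set: S]))%:R%:E
      <= (k%:R : R)%:E)%E.
    by rewrite -h; apply: nneseries_lim_ge => i _ _; rewrite lee_fin.
  rewrite (eq_bigr (fun=> 1%E)) => [|i _].
    rewrite sumEFin lee_fin big_mkord sumr_const card_ord ler_nat ltnn//.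
  rewrite all; have := alive i; case E : (state e i) => [x|]// _.
  by rewrite mem_set//; exists x.
move=> /existsNP hex.
have {}hex : exists m, (s%:E < jump_time e m)%E.
  by case: hex => m /negP; rewrite -ltNge; exists m.
case: (ex_minnP hex) => -[|m]; first by rewrite jump_time0 lte_fin ltNge s0.
move=> sm mmin; exists m.
  have hm : (jump_time e m <= s%:E < jump_time e m.+1)%E.
    by rewrite sm andbT leNgt; apply/negP => /mmin; rewrite ltnn.
  move: h; rewrite (jump_measure_sojourn _ hm) visitsT; last first.
    by apply: jump_time_alive; case/andP: hm => h _; apply: le_lt_trans h (ltry _).
  by move=> [] /eqP; rewrite eqr_nat => /eqP.
by rewrite sm andbT leNgt; apply/negP => /mmin; rewrite ltnn.
Qed.

Definition counts (x : S) (k j : nat) (s : R) : set (Omega R S) :=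
  [set e | jump_measure e s setT = (k%:R : R)%:E /\
           jump_measure e s [set x] = (j%:R : R)%:E].

Lemma counts_filtration x k j s : 0 <= s -> filtration s (counts x k j s).
Proof.
move=> s0.
have h D l : filtration s [set e : Omega R S | jump_measure e s D = (l%:R : R)%:E].
  apply: sub_sigma_algebra; exists s, D, [set l%:R%:E]; split => //.
  by rewrite s0 lexx.
have -> : counts x k j s = [set e : Omega R S | jump_measure e s setT = (k%:R : R)%:E] `&`
   [set e | jump_measure e s [set x] = (j%:R : R)%:E] by [].
exact: (@measurableI _ (g_sigma_algebraType _) _ _ (h _ _) (h _ _)).
Qed.

(** The nonnegative rational times, indexed by all of [rat] in order to have a
    countable index type. *)
Definition rtime (r : rat) : R := `|ratr r : R|.

Lemma rtime_between (a b : R) : 0 <= a -> a < b -> exists r, a <= rtime r < b.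
Proof.
move=> a0 ab; have [r] := rat_in_itvoo ab; rewrite in_itv/= => /andP[ar rb].
by exists r; rewrite /rtime ger0_norm ?rb ?(ltW ar)// (le_trans a0)// ltW.
Qed.

(** Just before [t], [k] jumps have occurred, [j] of them into [x], counting
    the initial state as a jump. Rational times suffice since the counts are
    step functions; this makes [settled] a countable combination of events. *)
Definition settled (x : S) (k j : nat) : set (Omega R S * R) :=
  [set p | exists2 r, rtime r < p.2 &
     forall r', rtime r <= rtime r' -> rtime r' < p.2 -> counts x k j (rtime r') p.1].

(** What identifies [x] is that the last jump before [t] raised the number of
    visits to [x], which two rational times before [t] detect. The case
    [k = j = 0] is that of the initial state, before which there is no time at
    which to count. *)
Lemma state_before_counts e (t : R) x : 0 < t ->
  state_before e t = Some x <->
  exists k j, ((k = 0%N /\ j = 0%N) \/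
     (exists2 r0, rtime r0 < t & counts x k j (rtime r0) e)) /\
     settled x k.+1 j.+1 (e, t).
Proof.
move=> t0; rewrite state_before_Some//; split=> [[k kt ekx]|].
  have ek := sojourning_alive kt; have /andP[Tt tT] := kt.
  have Tf := jump_time_fin ek.
  have xin D : (state e k \in Some @` D) = (x \in D).
    by rewrite ekx; apply/idP/idP; rewrite !inE; [move=> [y Dy [<-]]|move=> Dx; exists x].
  exists k, (visits e k [set x]); split.
    case: k kt ekx ek Tt tT Tf xin => [|k] kt ekx ek Tt tT Tf xin.
      by left; rewrite /visits big_ord0.
    right.
    (* a rational time in the previous sojourn witnesses the smaller count *)
    have ek' : state e k <> None by apply: alive_le ek.
    have := jump_time_lt ek'.
    rewrite -(fineK Tf) -(fineK (jump_time_fin ek')) lte_fin => /(rtime_between _)[|r /andP[r1 r2]].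
      by rewrite fine_ge0// jump_time_ge0.
    exists r.
      by rewrite -lte_fin; apply: lt_trans Tt; rewrite -(fineK Tf) lte_fin.
    have hr : (jump_time e k <= (rtime r)%:E < jump_time e k.+1)%E.
      by rewrite -(fineK Tf) -(fineK (jump_time_fin ek')) lee_fin lte_fin r1.
    by split; rewrite (jump_measure_sojourn _ hr)// visitsT.
  have : fine (jump_time e k) < t by rewrite -lte_fin fineK.
  move=> /(rtime_between _)[|r /andP[r1 r2]]; first by rewrite fine_ge0// jump_time_ge0.
  exists r => //= r' rr' r't.
  have hr : (jump_time e k <= (rtime r')%:E < jump_time e k.+1)%E.
    by rewrite -(fineK Tf) lee_fin (le_trans r1 rr')/= (lt_le_trans _ tT)// lte_fin.
  split; rewrite (jump_measure_sojourn _ hr) ?visitsT// /visits big_ord_recr/= xin.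
  by rewrite mem_set// addn1.
move=> [k [j [hkj [r /= rt hr]]]].
have S0 (r' : rat) : 0 <= rtime r' by exact: normr_ge0.
have between r' : rtime r <= rtime r' -> rtime r' < t ->
    (jump_time e k <= (rtime r')%:E < jump_time e k.+1)%E.
  move=> rr' r't; have [+ _] := hr r' rr' r't.
  by move=> /(jump_measureTP (S0 _))[k' [<-]].
have /andP[Tr rT] := between r (lexx _) rt.
have kt : sojourning e k t.
  rewrite /sojourning (le_lt_trans Tr)/= ?lte_fin// leNgt; apply/negP => Tt.
  have Tf : jump_time e k.+1 \is a fin_num.
    by apply: jump_time_fin; apply: jump_time_alive; apply: lt_trans Tt (ltry _).
  move: Tt rT; rewrite -(fineK Tf) !lte_fin => Tt rT.
  have [r' /andP[r1 r2]] := rtime_between (le_trans (S0 r) (ltW rT)) Tt.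
  have := between r' (le_trans (ltW rT) r1) r2.
  by rewrite -(fineK Tf) lte_fin ltNge r1 andbF.
exists k => //.
have vj1 : visits e k.+1 [set x] = j.+1.
  have [_] := hr r (lexx _) rt; rewrite (jump_measure_sojourn _ (between r (lexx _) rt)).
  by move=> [] /eqP; rewrite eqr_nat => /eqP.
have vj : visits e k [set x] = j.
  case: hkj => [[-> ->]|[r0 r0t [n0 n1]]]; first by rewrite /visits big_ord0.
  have [k' kk' hk'] := jump_measureTP (S0 _) n0.
  by move: n1; rewrite (jump_measure_sojourn _ hk') -kk' => -[] /eqP; rewrite eqr_nat => /eqP.
move: vj1; rewrite /visits big_ord_recr/= -/(visits e k [set x]) vj.
case: (boolP (state e k \in _)); last by rewrite addn0 => _ /esym/eqP; rewrite eqn_leq ltnn.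
by rewrite inE => -[y -> ->].
Qed.

Let predD : sigma_algebra [set p : Omega R S * R | 0 <= p.2] (@predictable R dS S).
Proof. exact: smallest_sigma_algebra. Qed.

(** The times after [s] are exhausted by the times after [s + 1/n], and
    [filtration s] is contained in [filtration_before (s + 1/n)]. *)
Lemma predictable_after (s : R) (C : set (Omega R S)) : 0 <= s -> filtration s C ->
  predictable (C `*` [set t | s < t]).
Proof.
move=> s0 FC.
have -> : C `*` [set t | s < t] = \bigcup_n (C `*` [set t | s + n.+1%:R^-1 < t]).
  apply/seteqP; split=> [[e t] [/= Ce st]|[e t] [n _ [/= Ce st]]]; last first.
    by split => //=; apply: lt_trans st; rewrite ltrDl invr_gt0.
  have ts0 : 0 < t - s by rewrite subr_gt0.
  exists (Num.truncn (t - s)^-1) => //; split => //=.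
  by rewrite -ltrBrDl invf_plt ?posrE// Num.Theory.truncnS_gt.
case: predD => _ _; apply => n.
apply: sub_sigma_algebra; right; exists C, (s + n.+1%:R^-1); split => //.
  by rewrite ltr_wpDl// invr_gt0.
apply: sub_sigma_algebra; exists s => //=.
by apply/andP; split; [exact: s0|rewrite ltrDl invr_gt0 ltr0n].
Qed.

Lemma settled_predictable x k j : predictable (settled x k j).
Proof.
pose W r := (setT `*` [set t | rtime r < t]) `\`
  \bigcup_r' (if rtime r <= rtime r'
              then (~` counts x k j (rtime r')) `*` [set t | rtime r' < t] else set0).
have S0 (r' : rat) : 0 <= rtime r' by exact: normr_ge0.
have -> : settled x k j = \bigcup_r W r.
  apply/seteqP; split=> [[e t] [r /= rt h]|[e t] [r _ [[_ /= rt] h]]].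
    exists r => //; split => //= -[r' _]; case: ifPn => // rr' [/= + r't]; apply.
    exact: h.
  exists r => //= r' rr' r't; apply: contrapT => hc; apply: h.
  by exists r' => //; rewrite rr'.
have setTF s : filtration s (setT : set (Omega R S)).
  exact: (@measurableT _ (g_sigma_algebraType _)).
apply: (sigma_algebra_countU predD) => r.
apply: (sigma_algebra_setD predD) => [[e t] [_ /= /ltW]||].
- exact: le_trans.
- exact: predictable_after.
apply: (sigma_algebra_countU predD) => r'; case: ifP => _; last by case: predD.
apply: predictable_after => //.
by apply: sigma_algebraC; exact: counts_filtration.
Qed.

Lemma state0_predictable x : predictable [set p : Omega R S * R | p.2 = 0 /\ state p.1 0 = Some x].
Proof.
apply: sub_sigma_algebra; left; exists [set e : Omega R S | state e 0 = Some x]; last first.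
  by apply/seteqP; split=> [[e t] [/= -> ->]|[e t] [/= ->]].
have -> : [set e : Omega R S | state e 0 = Some x] =
    [set e | jump_measure e 0 [set x] = 1%:E].
  apply/seteqP; split=> e /=; rewrite (@jump_measure_sojourn e 0);
      try by rewrite jump_time0 lexx jump_timeS jump_time0 add0e sojourn_gt0.
    by move=> ex; rewrite /visits big_ord1 ex mem_set//; exists x.
  rewrite /visits big_ord1; case: (boolP (_ \in _)) => [|_ [] /eqP].
    by rewrite inE => -[y -> ->].
  by rewrite eq_sym oner_eq0.
apply: sub_sigma_algebra; exists 0, [set x], [set 1%:E]; split => //.
  by rewrite lexx.
Qed.

Lemma state_before_predictable x :
  predictable [set p : Omega R S * R | 0 <= p.2 /\ state_before p.1 p.2 = Some x].
Proof.
have S0 (r' : rat) : 0 <= rtime r' by exact: normr_ge0.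
pose started k j : set (Omega R S * R) :=
  \bigcup_r0 (counts x k j (rtime r0) `*` [set t | rtime r0 < t]).
(* intersections below are written as [X `\` (X `\` Y)], which stays within a
   sigma-algebra on a subset *)
pose first_or k j : set (Omega R S * R) :=
  if (k == 0%N) && (j == 0%N) then [set p | 0 <= p.2] `\` set0 else started k j.
have -> : [set p : Omega R S * R | 0 <= p.2 /\ state_before p.1 p.2 = Some x] =
    \bigcup_(i : option (nat * nat))
      (if i is Some (k, j) then settled x k.+1 j.+1 `\` (settled x k.+1 j.+1 `\` first_or k j)
       else [set p | p.2 = 0 /\ state p.1 0 = Some x]).
  apply/seteqP; split=> [[e t] [/= t0 ex]|[e t] [[[k j]|] _]] /=.
  - move: t0; rewrite le_eqVlt => /predU1P[t0|t0].
      by exists None => //=; rewrite -state_before0 t0.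
    move: ex; rewrite state_before_counts// => -[k [j [h1 h2]]].
    exists (Some (k, j)) => //; split => // -[_]; apply.
    rewrite /first_or; case: h1 => [[-> ->]|[r0 r0t h]].
      by rewrite eqxx; split => //; exact: ltW.
    case: ifPn => _; first by split => //; exact: ltW.
    by exists r0.
  - move=> [h1 /not_andP[//|/contrapT h2]].
    have t0 : 0 < t by case: h1 => r /= rt _; apply: le_lt_trans rt.
    split; first exact: ltW.
    rewrite state_before_counts//; exists k, j; split=> //.
    move: h2; rewrite /first_or; case: ifPn => [/andP[/eqP-> /eqP->] _|_ [r0 _ [h /= r0t]]].
      by left.
    by right; exists r0.
  - by move=> [-> <-]; rewrite state_before0 lexx.
apply: (sigma_algebra_countU predD) => -[[k j]|]; last exact: state0_predictable.
have sp := settled_predictable x k.+1 j.+1.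
have sD : settled x k.+1 j.+1 `<=` [set p | 0 <= p.2].
  by move=> [e t] [r /= /ltW rt _]; apply: le_trans rt.
apply: (sigma_algebra_setD predD) => //; apply: (sigma_algebra_setD predD) => //.
rewrite /first_or; case: ifP => _.
  by case: predD => p0 pD _; exact: pD.
apply: (sigma_algebra_countU predD) => r0; apply: predictable_after => //.
exact: counts_filtration.
Qed.

(** Predictable sets are jointly measurable in the trajectory and in time, as
    Fubini's theorem requires. *)
Lemma predictable_measurable (X : set (Omega R S * R)) : predictable X ->
  measurable (X : set (Omega R S * measurableTypeR R)%type).
Proof.
have mF s C : filtration s C -> @measurable _ (Omega R S) C.
  move=> h; apply: (smallest_sub (@sigma_algebra_measurable _ (Omega R S)) _ h).
  move=> _ [s' [D [B [_ mB ->]]]].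
  rewrite -[X in measurable X]setTI.
  suff : measurable_fun [set: Omega R S] (fun e => jump_measure e s' D) by apply.
  apply: ge0_emeasurable_sum => [k e _ _|k _]; first by rewrite lee_fin.
  apply/measurable_EFinP.
  rewrite (_ : (fun e : Omega R S => _) = \1_([set e : Omega R S | (jump_time e k <= s'%:E)%E] `&`
      [set e : Omega R S | state e k \in Some @` D])); last first.
    apply/funext => e; rewrite indicE; congr ((nat_of_bool _)%:R).
    by apply/idP/idP; [move=> /andP[h1 h2]; rewrite mem_set|rewrite inE => -[/= -> ->]].
  apply: measurable_indic; apply: measurableI; last first.
    exact: (@measurable_state _ _ _ k [set y | y \in Some @` D]).
  rewrite -[X in measurable X]setTI; apply: emeasurable_fun_le => //.
  exact: measurable_jump_time.
have mFb s C : filtration_before s C -> @measurable _ (Omega R S) C.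
  move=> h; apply: (smallest_sub (@sigma_algebra_measurable _ (Omega R S)) _ h).
  by move=> C' [s' _]; exact: mF.
move=> pX.
have mD : measurable ([set p | 0 <= p.2] : set (Omega R S * measurableTypeR R)%type).
  rewrite -[X in measurable X]setTI.
  exact: (measurable_fun_ler (measurable_cst _) (@measurable_snd _ _ _ _)).
have sa : sigma_algebra [set p | 0 <= p.2]
    (@measurable _ (Omega R S * measurableTypeR R)%type).
  split => //; first by move=> Y mY; exact: measurableD.
  by move=> F mF'; exact: bigcup_measurable.
apply: (smallest_sub sa _ pX) => _ [[B /mF mB ->]|[C [s [_ /mFb mC ->]]]].
  by apply: measurableX => //; exact: measurable_set1.
by apply: measurableX => //; rewrite (_ : [set t | s < t] = `]s, +oo[%classic) //;
  apply/seteqP; split => t /=; rewrite in_itv/= andbT.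
Qed.

End predictability.

(** * Stationary controls are policies *)

Section stationary.
Context (R : realType) dS (S : finStateType dS) (A : completePseudoMetricType R).
Variable adm : S -> {fset A}.

Lemma state_before_None (e : Omega R S) t : 0 <= t ->
  (t%:E < explosion_time e)%E = (state_before e t != None).
Proof.
rewrite le_eqVlt => /predU1P[<-|t0].
  by rewrite explosion_gt0 state_before0; case: (state e 0) (@alive0 _ _ _ e).
apply/idP/idP.
  move=> /(explosionP _ t0)[k kt]; rewrite (state_before_sojourning kt).
  by case: (state e k) (sojourning_alive kt).
case ex : (state_before e t) => [x|] // _.
by move: ex => /(state_before_Some _ _ t0)[k kt _]; apply/(explosionP _ t0); exists k.
Qed.

Lemma stationary_controlE (phi : R.-pker S ~> Borel A) e t : 0 <= t ->
  stationary_control phi e t =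
  if state_before e t is Some x then adjoin_measure (phi x) else dirac (None : adjoin (Borel A)).
Proof.
move=> t0; rewrite /stationary_control state_before_None//.
by case: (state_before e t).
Qed.

(** The control is a function of the state just before [t], which takes
    countably many values, each on a predictable set. *)
Lemma stationary_is_policy (phi : R.-pker S ~> Borel A) :
  is_stationary adm phi -> is_policy adm (stationary_control phi).
Proof.
move=> st; split=> [e t t0|B mB Y mY].
  rewrite stationary_controlE//; case: (state_before e t) => [x|].
    split; rewrite /adjoin_measure/= /pushforward/=.
      by rewrite preimage_setT prob_kernel.
    rewrite (_ : _ @^-1` _ = [set a | a \in adm x])//.
    apply/seteqP; split=> [a [b bx [<-]]//|a ax]; by exists a.
  by split; rewrite /= diracE mem_set.
have sp : sigma_algebra [set p : Omega R S * R | 0 <= p.2] (@predictable R dS S).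
  exact: smallest_sigma_algebra.
pose E x : set (Omega R S * R) := [set p | 0 <= p.2 /\ state_before p.1 p.2 = Some x].
pose m (y : adjoin S) := if y is Some x then adjoin_measure (phi x) B
  else dirac (None : adjoin (Borel A)) B.
have -> : [set p | 0 <= p.2 /\ Y (stationary_control phi p.1 p.2 B)] =
    \bigcup_(y : option S)
      (if y is Some x then (if `[< Y (m (Some x)) >] then E x else set0)
       else if `[< Y (m None) >] then [set p | 0 <= p.2] `\` \bigcup_x E x else set0).
  apply/seteqP; split=> [[e t] [/= t0]|[e t] [[x|] _]] /=.
  - rewrite stationary_controlE// => h.
    exists (state_before e t) => //; case ex : (state_before e t) h => [x|] h.
      by rewrite asboolT.
    by rewrite asboolT//; split=> // -[x _ [_ /=]]; rewrite ex.
  - by case: asboolP => // h [/= t0 ex]; split => //; rewrite stationary_controlE// ex.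
  - case: asboolP => // h [/= t0 nE]; split => //; rewrite stationary_controlE//.
    case ex : (state_before e t) => [x|] //; by exfalso; apply: nE; exists x.
have EP x : predictable (E x) by exact: state_before_predictable.
apply: (sigma_algebra_countU sp) => -[x|].
  by case: ifP => // _; case: sp.
case: ifP => h; last by case: sp.
by case: (sp) => _ pD _; apply: pD; exact: (sigma_algebra_countU sp).
Qed.

End stationary.

(** * The intensity as a finite sum over states and actions *)

Section action_sets.
Context (R : realType) (A : completePseudoMetricType R).
Hypothesis A_hausdorff : hausdorff_space A.

Lemma measurable_point (a : A) : measurable ([set a] : set (Borel A)).
Proof.
rewrite -(setCK [set a]); apply: measurableC; apply: sub_sigma_algebra.
by rewrite openC; apply: accessible_closed_set1; exact: hausdorff_accessible.
Qed.

Lemma measurable_fset (D : {fset A}) : measurable ([set a | a \in D] : set (Borel A)).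
Proof.
pose s : seq (Borel A) := D.
have -> : [set a | a \in D] = \big[setU/set0]_(a <- s) [set a] :> set (Borel A).
  by rewrite -bigcup_seq; apply/seteqP; split=> [a ax|a [b /= bx ->]//]; exists a.
by apply: bigsetU_measurable => a _; exact: measurable_point.
Qed.

Lemma measurable_image_Some (D : set (Borel A)) : measurable D ->
  measurable (Some @` D : set (adjoin (Borel A))).
Proof.
move=> mD; have -> : measurable (Some @` D : set (adjoin (Borel A))) =
    @measurable _ (Borel A) (Some @^-1` (Some @` D)) by [].
suff -> : Some @^-1` (Some @` D) = D by [].
by apply/seteqP; split=> [a [b Db [<-]]|a Da] //; exists a.
Qed.

Lemma measurable_action (a : A) : measurable ([set Some a] : set (adjoin (Borel A))).
Proof. by rewrite -image_set1; apply: measurable_image_Some; exact: measurable_point. Qed.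

End action_sets.

Section policy.
Context (R : realType) dS (S : finStateType dS) (A : completePseudoMetricType R).
Hypothesis A_hausdorff : hausdorff_space A.
Variables (adm : S -> {fset A}) (q : S -> A -> {charge set S -> \bar R}).
Hypothesis q_rate : is_transition_rate adm q.
Variable pi : control S A.
Hypothesis pi_policy : is_policy adm pi.

(** The probability that the action [a] is in force, on the event that the
    state just before [t] is [x]. It is through these functions, one for each
    of the finitely many admissible pairs, that a policy enters the criteria
    and the intensity. *)
Definition weight (x : S) (a : A) (p : Omega R S * R) : R :=
  if (0 <= p.2) && (state_before p.1 p.2 == Some x)
  then fine (pi p.1 p.2 [set Some a]) else 0.

Lemma pi_action_le1 e t a : 0 <= t -> (pi e t [set Some a] <= 1)%E.
Proof.
move=> t0; have [/(_ e t t0)[<- _] _] := pi_policy.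
by apply: le_measure => //; rewrite inE //; exact: measurable_action.
Qed.

Lemma pi_action_fin e t a : 0 <= t -> pi e t [set Some a] \is a fin_num.
Proof. by move=> /(pi_action_le1 e a) h; rewrite ge0_fin_numE// (le_lt_trans h)// ltry. Qed.

Lemma weight_ge0 x a p : 0 <= weight x a p.
Proof. by rewrite /weight; case: ifP => // _; rewrite fine_ge0. Qed.

Lemma weight_le1 x a p : weight x a p <= 1.
Proof.
rewrite /weight; case: ifP => // /andP[t0 _].
by rewrite -lee_fin fineK ?pi_action_fin// pi_action_le1.
Qed.

Lemma action_integralE (u : S -> A -> R) e t : 0 <= t ->
  action_integral adm (fun x a => (u x a)%:E) pi e t =
  (\sum_x \sum_(a <- adm x) u x a * weight x a (e, t))%:E.
Proof.
move=> t0; rewrite /action_integral; case ex : (state_before e t) => [x|]; last first.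
  by rewrite big1// => x _; rewrite big1// => a _; rewrite /weight/= ex andbF mulr0.
pose f (a : adjoin (Borel A)) : R := if a is Some a' then u x a' else 0.
rewrite (eq_integral (fun a => (f a)%:E)); last by move=> [a|].
pose s : seq (adjoin (Borel A)) := [seq Some a | a <- adm x].
rewrite (@integral_seq _ _ _ _ _ s).
- rewrite (bigD1 x)//= [X in _ + X]big1 ?addr0; last first.
    move=> y yx; rewrite big1// => a _; rewrite /weight/= ex.
    by rewrite (_ : (Some x == Some y) = (x == y))// eq_sym (negbTE yx) andbF mulr0.
  rewrite big_map -sumEFin; apply: eq_bigr => a _.
  by rewrite /weight/= ex eqxx t0 EFinM fineK// pi_action_fin.
- by rewrite map_inj_uniq// => a b [].
- by apply: measurable_image_Some; exact: measurable_fset.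
- move=> a; split=> [[b bx <-]|/mapP[b bx ->]]; last by exists b.
  exact: map_f.
- by move=> _ /mapP[a _ ->]; exact: measurable_action.
- have [/(_ e t t0)[_ +] _] := pi_policy; rewrite ex => ->.
  by rewrite ltry.
Qed.

Lemma weight_sum x e t : 0 <= t ->
  \sum_(a <- adm x) weight x a (e, t) = (state_before e t == Some x)%:R.
Proof.
move=> t0; have := action_integralE (fun y _ => (y == x)%:R) e t0.
rewrite (bigD1 x)//= eqxx [X in (_ + X)%:E]big1 ?addr0 => [|y yx]; last first.
  by rewrite big1// => a _; rewrite (negbTE yx) mul0r.
under eq_bigr do rewrite mul1r.
move=> h; apply/EFin_inj; rewrite -h /action_integral; case ex : (state_before e t) => [y|//].
rewrite (_ : (Some y == Some x) = (y == x))//.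
have [/(_ e t t0)[_ +] _] := pi_policy; rewrite ex => h1.
case: (y == x) => /=.
  rewrite (eq_integral (fun=> 1%E)); last by move=> [a|]//; rewrite inE => -[].
  rewrite integral_cst ?mul1e//.
  by apply: measurable_image_Some; exact: measurable_fset.
rewrite (eq_integral (fun=> 0%E)) ?integral0//; by move=> [a|].
Qed.

Lemma measurable_weight x a : measurable_fun setT (weight x a : Omega R S * R -> R).
Proof.
pose B : set (adjoin (Borel A)) := [set Some a].
have mB : measurable B by exact: measurable_action.
have mD : measurable ([set p | 0 <= p.2] : set (Omega R S * R)%type).
  rewrite -[X in measurable X]setTI.
  exact: (measurable_fun_ler (measurable_cst _) (@measurable_snd _ _ _ _)).
pose h (p : Omega R S * R) : \bar R := if 0 <= p.2 then pi p.1 p.2 B else 0%E.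
have mh : measurable_fun setT h.
  move=> _ Y mY; rewrite setTI.
  have -> : h @^-1` Y = [set p | 0 <= p.2 /\ Y (pi p.1 p.2 B)] `|`
     (if `[< Y 0%E >] then ~` [set p | 0 <= p.2] else set0).
    apply/seteqP; split=> [p|p [[/= t0]|]]; rewrite /h /=.
    - case: ifPn => t0 Yp; first by left.
      by right; rewrite asboolT//=; exact/negP.
    - by rewrite t0.
    - by case: asboolP => // Y0 /= /negP/negbTE ->.
  apply: measurableU; last by case: ifP => _ //; exact: measurableC.
  by apply: predictable_measurable; have [_] := pi_policy; apply.
have -> : weight x a =
    \1_[set p : Omega R S * R | 0 <= p.2 /\ state_before p.1 p.2 = Some x] \* (fine \o h).
  apply/funext => p; rewrite /weight /h /= indicE.
  case: ifP => [/andP[t0 /eqP ex]|hn]; first by rewrite mem_set// mul1r t0.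
  rewrite memNset ?mul0r// => -[t0 ex]; by rewrite t0 ex eqxx in hn.
apply: measurable_funM; last exact: measurableT_comp.
apply: measurable_indic; apply: predictable_measurable.
exact: state_before_predictable.
Qed.

Definition jump_rate (D : set S) (x : S) (a : A) : R := fine (q x a (D `\ x)).

Lemma jump_rate_ge0 D x a : a \in adm x -> 0 <= jump_rate D x a.
Proof. by move=> ax; apply: fine_ge0; have [+ _] := q_rate ax; apply => -[_]; exact. Qed.

Definition total_rate (D : set S) (p : Omega R S * R) : R :=
  \sum_x \sum_(a <- adm x) jump_rate D x a * weight x a p.

Lemma intensityE e t D : 0 <= t -> intensity adm q pi e t D = (total_rate D (e, t))%:E.
Proof.
move=> t0; rewrite -action_integralE// /intensity /action_integral.
case: (state_before e t) => // x; apply: eq_integral => -[a|]// _.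
by rewrite fineK// fin_num_measure//; exact: measurable_all.
Qed.

Lemma measurable_total_rate D : measurable_fun setT (total_rate D : Omega R S * R -> R).
Proof.
apply: measurable_sum => x; apply: measurable_sum => a.
by apply: measurable_funM => //; exact: measurable_weight.
Qed.

Lemma total_rate_ge0 D p : 0 <= total_rate D p.
Proof.
apply: sumr_ge0 => x _; rewrite big_seq; apply: sumr_ge0 => a ax.
by rewrite mulr_ge0 ?jump_rate_ge0 ?weight_ge0.
Qed.

Definition rate_bound : R := \sum_x \sum_(a <- adm x) jump_rate setT x a.

Lemma total_rate_le p : total_rate setT p <= rate_bound.
Proof.
apply: ler_sum => x _; rewrite big_seq [leRHS]big_seq; apply: ler_sum => a ax.
by rewrite -[leRHS]mulr1 ler_wpM2l ?jump_rate_ge0 ?weight_le1.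
Qed.

End policy.

(** * The law of one sojourn, given the history *)

Section integral_on.
Local Open Scope ereal_scope.
Context (R : realType) d1 d2 (T1 : measurableType d1) (T2 : measurableType d2).
Variables (m1 : {sigma_finite_measure set T1 -> \bar R})
          (m2 : {sigma_finite_measure set T2 -> \bar R}).

Lemma integral_indicr d (T : measurableType d) (m : {measure set T -> \bar R})
    (B : set T) (f : T -> \bar R) :
  \int[m]_(x in B) f x = \int[m]_x (f x * (\1_B x)%:E).
Proof.
rewrite integral_mkcond; apply: eq_integral => x _; rewrite patchE indicE.
by case: ifP; rewrite ?mule1 ?mule0.
Qed.

Variables (f : T1 * T2 -> \bar R) (B : set T2).
Hypotheses (mf : measurable_fun setT f) (f0 : forall p, 0 <= f p) (mB : measurable B).

Let g (p : T1 * T2) := f p * (\1_B p.2)%:E.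

Let mg : measurable_fun setT g.
Proof.
apply: emeasurable_funM => //; apply/measurable_EFinP.
by apply: measurableT_comp => //; exact: measurable_indic.
Qed.

Let g0 p : 0 <= g p. Proof. by rewrite mule_ge0// lee_fin. Qed.

Lemma measurable_integral_on : measurable_fun setT (fun x => \int[m2]_(y in B) f (x, y)).
Proof.
have := @measurable_fun_fubini_tonelli_F _ _ _ _ R m2 g mg g0.
by apply: eq_measurable_fun => x _; rewrite integral_indicr.
Qed.

Lemma fubini_tonelli_on :
  \int[m1]_x \int[m2]_(y in B) f (x, y) = \int[m2]_(y in B) \int[m1]_x f (x, y).
Proof.
rewrite (eq_integral (fun x => \int[m2]_y g (x, y))); last first.
  by move=> x _; rewrite integral_indicr.
transitivity (\int[m2]_y \int[m1]_x g (x, y)); first exact: fubini_tonelli.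
rewrite [RHS]integral_indicr; apply: eq_integral => y _.
rewrite /g/= ge0_integralZr ?lee_fin//; exact: measurable_fun_pair1.
Qed.

End integral_on.

Section compensator.
Context (R : realType) dS (S : finStateType dS) (A : completePseudoMetricType R).
Hypothesis A_hausdorff : hausdorff_space A.
Variables (adm : S -> {fset A}) (q : S -> A -> {charge set S -> \bar R}).
Hypothesis q_rate : is_transition_rate adm q.
Variable pi : control S A.
Hypothesis pi_policy : is_policy adm pi.
Variables (gamma : probability S R) (P : probability (Omega R S) R).
Hypothesis P_law : is_law adm q pi gamma P.

Local Notation rho := (total_rate adm q pi).
Local Notation mu := (@lebesgue_measure R).
Implicit Types e : Omega R S.

Definition jump_clock k e : R := fine (jump_time e k).

Lemma measurable_jump_clock k : measurable_fun setT (jump_clock k).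
Proof.
rewrite (_ : jump_clock k = fine \o (fun e => jump_time e k))//.
by apply: measurableT_comp; [exact: fine_measurable|exact: measurable_jump_time].
Qed.

Lemma jump_clock_ge0 k e : 0 <= jump_clock k e.
Proof. by apply: fine_ge0; exact: jump_time_ge0. Qed.

(** A measurable version of the rates [m_k] of the definition of the law: the
    intensity at elapsed time [p.2] along the trajectory frozen after its
    [k]-th jump. *)
Definition hist_rate k D (p : Omega R S * R) : R :=
  if 0 < p.2 then rho D (absorb k p.1, jump_clock k p.1 + p.2) else 0.

Lemma measurable_hist_rate k D : measurable_fun setT (hist_rate k D : Omega R S * R -> R).
Proof.
have -> : (hist_rate k D : Omega R S * R -> R) =
    (fun p => (if 0 < p.2 then 1 else 0) * rho D (absorb k p.1, jump_clock k p.1 + p.2)).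
  by apply/funext => p; rewrite /hist_rate; case: ifP; rewrite ?mul1r ?mul0r.
apply: measurable_funM.
  by apply: measurable_fun_ifT => //; apply: measurable_fun_ltr.
have mr : measurable_fun setT (rho D : Omega R S * R -> R) by exact: measurable_total_rate.
pose g (p : Omega R S * R) : Omega R S * R := (absorb k p.1, jump_clock k p.1 + p.2).
suff mg : measurable_fun setT g by exact: (measurableT_comp mr mg).
apply: measurable_fun_pair.
  by apply: measurableT_comp => //; exact: measurable_absorb.
apply: measurable_funD => //.
by apply: measurableT_comp => //; exact: measurable_jump_clock.
Qed.

Lemma hist_rate_ge0 k D p : 0 <= hist_rate k D p.
Proof. by rewrite /hist_rate; case: ifP => // _; exact: total_rate_ge0. Qed.

Lemma hist_rate_le k p : hist_rate k setT p <= rate_bound adm q.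
Proof.
rewrite /hist_rate; case: ifP => _; first exact: total_rate_le.
exact: le_trans (total_rate_ge0 q_rate pi setT p) (total_rate_le A_hausdorff q_rate pi_policy p).
Qed.

Definition hist_hazard k (p : Omega R S * R) : R :=
  hazard (fun v => hist_rate k setT (p.1, v)) p.2.

Lemma measurable_hist_rate2 k D e : measurable_fun setT (fun v : R => hist_rate k D (e, v)).
Proof. exact: (measurable_fun_pair2 e (measurable_hist_rate k D)). Qed.

Lemma measurable_hist_hazard k : measurable_fun setT (hist_hazard k : Omega R S * R -> R).
Proof.
pose f (z : (Omega R S * R) * R) : \bar R :=
  (((if (0 < z.2) && (z.2 <= z.1.2) then 1 else 0) * hist_rate k setT (z.1.1, z.2))%:E).
have mf : measurable_fun setT f.
  apply/measurable_EFinP; apply: measurable_funM.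
    apply: measurable_fun_ifT => //; apply: measurable_and.
      exact: measurable_fun_ltr.
    apply: measurable_fun_ler => //.
    exact: measurableT_comp.
  pose g (z : (Omega R S * R) * R) : Omega R S * R := (z.1.1, z.2).
  suff mg : measurable_fun setT g.
    exact: (measurableT_comp (measurable_hist_rate k setT) mg).
  by apply: measurable_fun_pair => //; exact: measurableT_comp.
have f0 z : (0 <= f z)%E.
  by rewrite lee_fin mulr_ge0 ?hist_rate_ge0//; case: ifP.
have := @measurable_fun_fubini_tonelli_F _ _ _ _ R mu f mf f0.
move=> /(measurableT_comp (@fine_measurable R setT measurableT)).
apply: eq_measurable_fun => p _ /=.
rewrite /fubini_F /hist_hazard /hazard /Rintegral [in RHS]integral_mkcond; congr fine.
apply: eq_integral => v _; rewrite patchE /f /=.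
case: ifPn; case: ifPn => //=; rewrite ?mul1r ?mul0r//.
  by rewrite notin_setE /= in_itv/= => /negP/negbTE ->.
by rewrite inE /= in_itv/= => ->.
Qed.

(** The conditional probability, given the history at the [k]-th jump, that
    the sojourn lasts at least [p.2]. *)
Definition hist_survival k (p : Omega R S * R) : R := expR (- hist_hazard k p).

Lemma measurable_hist_survival k : measurable_fun setT (hist_survival k : Omega R S * R -> R).
Proof. by do 2 apply: measurableT_comp => //; exact: measurable_hist_hazard. Qed.

Lemma hist_survival_ge0 k p : 0 <= hist_survival k p.
Proof. exact: expR_ge0. Qed.

Lemma hist_survival_le1 k p : hist_survival k p <= 1.
Proof. by rewrite -expR0 ler_expR oppr_le0; exact: hazard_ge0 (fun v => hist_rate_ge0 _ _ _) _. Qed.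

Definition alive k : set (Omega R S) := [set e | state e k <> None].

(** At time [t] both [e] and its frozen copy are in their [k]-th sojourn, with
    the same history, so [m_k] gives both intensities. *)
Lemma rate_at_sojourn k e t D : sojourning e k t ->
  rho D (e, t) = hist_rate k D (e, t - jump_clock k e).
Proof.
move=> kt; have ek := sojourning_alive kt; have t0 := ltW (sojourning_gt0 kt).
have [_ [m [mE _]]] := P_law.
have Tf := jump_time_fin ek.
have s0 : 0 < t - jump_clock k e.
  by case/andP: kt => h _; rewrite subr_gt0 -lte_fin /jump_clock fineK.
apply/EFin_inj; rewrite /hist_rate /= s0 addrC subrK -!(intensityE A_hausdorff)//.
rewrite (mE _ _ _ _ kt) -(hist_absorb k e) -(jump_time_absorb e (leqnn k)).
apply/esym; apply: mE; rewrite jump_time_absorb// jump_time_absorbS leey andbT.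
by case/andP: kt.
Qed.

(** Along the frozen trajectory the [k]-th sojourn lasts for ever, so [m_k]
    can be read off it at all positive elapsed times. *)
Lemma law_jump k H (B : set R) (D : set S) :
  history_sigma k H -> H `<=` alive k -> measurable B -> B `<=` [set t | 0 < t] ->
  P (H `&` [set e | (EFin @` B) (sojourn e k) /\ (Some @` D) (state e k.+1)]) =
  (\int[P]_(e in H) \int[mu]_(t in B) (hist_rate k D (e, t) * hist_survival k (e, t))%:E)%E.
Proof.
move=> hH Ha mB B0; have [_ [m [mE /(_ k H hH Ha)[+ _]]]] := P_law.
move=> /(_ B D mB B0) ->; apply: eq_integral => e; rewrite inE => /Ha ek.
have mrate D' t : 0 < t -> m k (hist k e) t D' = (hist_rate k D' (e, t))%:E.
  move=> t0; rewrite /hist_rate /= t0 -(intensityE A_hausdorff)//; last first.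
    by rewrite addr_ge0 ?jump_clock_ge0// ltW.
  rewrite -(hist_absorb k e) (mE k (absorb k e) (jump_clock k e + t)).
    by rewrite hist_absorb jump_time_absorb// addrC addKr.
  rewrite jump_time_absorb// jump_time_absorbS leey andbT EFinD fineK ?jump_time_fin//.
  by rewrite lteDl ?jump_time_fin// lte_fin.
have mhaz (t : R) : (\int[mu]_(v in `]0%R, t]) m k (hist k e) v [set: S] =
    (hist_hazard k (e, t))%:E)%E.
  rewrite /hist_hazard /hazard /Rintegral fineK/=.
    by apply: eq_integral => v; rewrite inE/= in_itv/= => /andP[v0 _]; exact: mrate.
  apply: integrable_fin_num => //.
  apply: (@bounded_integrable_itv _ (fun v => hist_rate k setT (e, v)) (rate_bound adm q)).
    exact: measurable_hist_rate2.
  by move=> v; rewrite ger0_norm ?hist_rate_ge0 ?hist_rate_le.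
by apply: eq_integral => t; rewrite inE => /B0 t0; rewrite mrate// mhaz.
Qed.

Lemma alive_history k : history_sigma k (alive k).
Proof.
apply: sub_sigma_algebra; left; exists k, [set y | y <> None]; by split.
Qed.

Lemma history_sigmaI k (G H : set (Omega R S)) :
  history_sigma k G -> history_sigma k H -> history_sigma k (G `&` H).
Proof. by move=> hG hH; exact: (@measurableI _ (g_sigma_algebraType _) _ _ hG hH). Qed.

(** The complementary event is a jump before [s], of conditional probability
    [1 - hist_survival k (e, s)] by [law_jump] and [integral_survival]. *)
Lemma law_sojourn_ge k H (s : R) : history_sigma k H -> H `<=` alive k -> 0 < s ->
  P (H `&` [set e | (s%:E <= sojourn e k)%E]) =
  (\int[P]_(e in H) (hist_survival k (e, s))%:E)%E.
Proof.
move=> hH Ha s0.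
have mH := history_measurable hH.
pose L : set (Omega R S) := [set e | (EFin @` `]0, s[%classic) (sojourn e k) /\
  (Some @` [set: S]) (state e k.+1)].
have mL : measurable L.
  have -> : L = (fun e => sojourn e k) @^-1` (EFin @` `]0, s[%classic) `&`
    [set e | (Some @` [set: S]) (state e k.+1)] by [].
  apply: measurableI; last exact: measurable_state.
  rewrite -[X in measurable X]setTI; apply: measurable_sojourn => //.
  by apply: measurable_image_EFin; exact: measurable_itv.
have -> : H `&` [set e | (s%:E <= sojourn e k)%E] = H `\` L.
  apply/seteqP; split=> e [He /=].
    move=> st; split => // -[[t + tE] _]; move: st; rewrite /= -tE lee_fin in_itv/=.
    by move=> st /andP[_]; rewrite ltNge st.
  move=> nL; split => //; rewrite leNgt; apply/negP => ts; apply: nL.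
  case ek : (state e k.+1) => [y|]; last by move: ts; rewrite sojourn_absorbed.
  have [|t t0 tE] := @sojourn_fin _ _ _ e k; first by rewrite ek.
  split; last by exists y.
  by exists t => //=; rewrite in_itv/= t0 -lte_fin -tE.
have mS : measurable_fun H (fun e => (hist_survival k (e, s))%:E).
  apply: measurable_funTS; apply/measurable_EFinP.
  exact: measurable_fun_pair1 (measurable_hist_survival k).
have mS' : measurable_fun H (fun e => (1 - hist_survival k (e, s))%:E).
  apply/measurable_EFinP; apply: measurable_funB => //; exact/measurable_EFinP.
have PL : P (H `&` L) = (\int[P]_(e in H) (1 - hist_survival k (e, s))%:E)%E.
  rewrite /L law_jump//; last by move=> t /=; rewrite in_itv/= => /andP[].
  apply: eq_integral => e _.
  rewrite -(@integral_survival R (fun v => hist_rate k setT (e, v)) (rate_bound adm q)) ?ltW//.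
  - exact: measurable_hist_rate2.
  - by move=> v; exact: hist_rate_ge0.
  - by move=> v; exact: hist_rate_le.
have tot : (\int[P]_(e in H) (1 - hist_survival k (e, s))%:E +
    \int[P]_(e in H) (hist_survival k (e, s))%:E = P H)%E.
  rewrite -ge0_integralD//.
  - rewrite (eq_integral (cst 1%E)); last by move=> e _; rewrite -EFinD subrK.
    by rewrite integral_cst// mul1e.
  - by move=> e _; rewrite lee_fin subr_ge0 hist_survival_le1.
  - by move=> e _; rewrite lee_fin hist_survival_ge0.
have split : P H = (P (H `&` L) + P (H `\` L))%E.
  rewrite -measureU//; first by rewrite setUIDK.
  - exact: measurableI.
  - exact: measurableD.
  - by apply/seteqP; split=> e //= [[_ ?] [_]].
have fin X : measurable X -> P X \is a fin_num.
  by move=> mX; rewrite ge0_fin_numE// (le_lt_trans (probability_le1 P mX))// ltry.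
have fX := fin _ (measurableI _ _ mH mL).
move: tot; rewrite -PL split => /(congr1 (fun x => x - P (H `&` L))%E).
by rewrite !(addeC (P (H `&` L))) !addeK.
Qed.

End compensator.

(** * The discounted compensator formula *)

Section in_sojourn.
Context (R : realType) dS (S : finStateType dS).
Variable alpha : R.

Lemma measurable_sojourning j : measurable ([set p : Omega R S * R | sojourning p.1 j p.2]).
Proof.
have mT i : measurable_fun setT (fun p : Omega R S * R => jump_time p.1 i).
  have mj : measurable_fun setT (fun e : Omega R S => jump_time e i).
    exact: measurable_jump_time.
  exact: (measurableT_comp mj (@measurable_fst _ _ _ _)).
have mt : measurable_fun setT (fun p : Omega R S * R => p.2%:E).
  exact/measurable_EFinP.
have -> : [set p : Omega R S * R | sojourning p.1 j p.2] =
  [set p | (jump_time p.1 j < p.2%:E)%E] `&` [set p | (p.2%:E <= jump_time p.1 j.+1)%E].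
  by apply/seteqP; split=> p /=; [move=> /andP[]|move=> [h1 h2]; apply/andP].
apply: measurableI; rewrite -[X in measurable X]setTI.
  exact: emeasurable_fun_lt.
exact: emeasurable_fun_le.
Qed.

Definition in_sojourn k x (f : Omega R S * R -> R) (p : Omega R S * R) : R :=
  if sojourning p.1 k p.2 && (state p.1 k == Some x)
  then expR (- alpha * p.2) * f p else 0.

Let mexp : measurable_fun setT (fun p : Omega R S * R => expR (- alpha * p.2)).
Proof. by apply: measurableT_comp => //; exact: measurable_funM. Qed.

Lemma measurable_in_sojourn k x (f : Omega R S * R -> R) : measurable_fun setT f ->
  measurable_fun setT (in_sojourn k x f).
Proof.
move=> mf.
pose X : set (Omega R S * R) := [set p | sojourning p.1 k p.2] `&`
  (fst @^-1` [set e : Omega R S | state e k = Some x]).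
have mX : measurable X.
  apply: measurableI; first exact: measurable_sojourning.
  rewrite -[X in measurable X]setTI; apply: measurable_fst => //.
  exact: (@measurable_state _ _ _ k [set y | y = Some x]).
have -> : in_sojourn k x f = \1_X \* (fun p => expR (- alpha * p.2) * f p).
  apply/funext => p; rewrite /in_sojourn /= indicE.
  case: ifPn => [/andP[h1 /eqP h2]|h]; first by rewrite mem_set ?mul1r.
  by rewrite memNset ?mul0r// => -[h1 h2]; move: h; rewrite h1 h2 eqxx.
by apply: measurable_funM; [exact: measurable_indic|exact: measurable_funM].
Qed.

Lemma in_sojourn_ge0 k x f p : (forall p, 0 <= f p) -> 0 <= in_sojourn k x f p.
Proof. by move=> f0; rewrite /in_sojourn; case: ifP => // _; rewrite mulr_ge0 ?expR_ge0. Qed.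

End in_sojourn.

Section discounted_compensator.
Context (R : realType) dS (S : finStateType dS) (A : completePseudoMetricType R).
Hypothesis A_hausdorff : hausdorff_space A.
Variables (adm : S -> {fset A}) (q : S -> A -> {charge set S -> \bar R}).
Hypothesis q_rate : is_transition_rate adm q.
Variable pi : control S A.
Hypothesis pi_policy : is_policy adm pi.
Variables (gamma : probability S R) (P : probability (Omega R S) R).
Hypothesis P_law : is_law adm q pi gamma P.

Local Notation rho := (total_rate adm q pi).
Local Notation mu := (@lebesgue_measure R).
Local Notation hrate := (hist_rate adm q pi).
Local Notation hsurv := (hist_survival adm q pi).
Implicit Types e : Omega R S.

Variables (alpha : R) (k : nat) (z y : S).

(** A function of the history, to be factored out of conditional laws. *)
Definition entrance e : R :=
  if state e k == Some z then expR (- alpha * jump_clock k e) else 0.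

Lemma entrance_ge0 e : 0 <= entrance e.
Proof. by rewrite /entrance; case: ifP => // _; exact: expR_ge0. Qed.

Lemma entrance_absorb e : entrance (absorb k e) = entrance e.
Proof. by rewrite /entrance /jump_clock state_absorb// jump_time_absorb. Qed.

Lemma measurable_entrance : measurable_fun setT entrance.
Proof.
apply: measurable_fun_ifT => //.
- apply: (measurable_fun_bool true) => //; rewrite setTI.
  rewrite (_ : _ @^-1` _ = [set e | state e k = Some z]); last first.
    by apply/seteqP; split=> e /= /eqP.
  exact: (@measurable_state _ _ _ k [set x | x = Some z]).
- apply: measurableT_comp => //; apply: measurable_funM => //.
  exact: measurable_jump_clock.
Qed.

Lemma measurable_alive : measurable (alive k : set (Omega R S)).
Proof. exact: (@measurable_state _ _ _ k [set x | x <> None]). Qed.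

Lemma entrance_alive e : (entrance e)%:E = ((entrance e)%:E * (\1_(alive k) e)%:E)%E.
Proof.
rewrite /entrance; case: ifP => [/eqP ez|_]; last by rewrite mul0e.
by rewrite indicE mem_set ?mule1// /alive /= ez.
Qed.

Definition jump_density (p : Omega R S * R) : R := hrate k [set y] p * hsurv k p.

Lemma jump_density_ge0 p : 0 <= jump_density p.
Proof. by rewrite mulr_ge0 ?hist_rate_ge0 ?hist_survival_ge0. Qed.

Lemma measurable_jump_density : measurable_fun setT (jump_density : Omega R S * R -> R).
Proof.
by apply: measurable_funM; [exact: measurable_hist_rate|exact: measurable_hist_survival].
Qed.

Let measurable_indicE (X : set (Omega R S)) : measurable X ->
  measurable_fun setT (fun e => (\1_X e : R)%:E).
Proof. by move=> mX; apply/measurable_EFinP; exact: measurable_indic. Qed.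

(** A function of the frozen trajectory is a function of the history, so it may
    multiply both sides of an identity between conditional laws. *)
Lemma eq_history_integral (w1 w2 f : Omega R S -> \bar R) :
  measurable_fun setT w1 -> measurable_fun setT w2 -> measurable_fun setT f ->
  (forall e, 0 <= w1 e)%E -> (forall e, 0 <= w2 e)%E -> (forall e, 0 <= f e)%E ->
  (forall H, history_sigma k H -> H `<=` alive k ->
     \int[P]_(e in H) w1 e = \int[P]_(e in H) w2 e)%E ->
  (\int[P]_e (f (absorb k e) * (\1_(alive k) e)%:E * w1 e) =
   \int[P]_e (f (absorb k e) * (\1_(alive k) e)%:E * w2 e))%E.
Proof.
move=> mw1 mw2 mf w10 w20 f0 hw.
have mA := measurable_alive.
under eq_integral do rewrite -muleA.
under [RHS]eq_integral do rewrite -muleA.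
apply: (@eq_weighted_integral R _ _ _ _ _ _ P P (absorb k) (absorb k)
   (fun e => (\1_(alive k) e)%:E * w1 e)%E (fun e => (\1_(alive k) e)%:E * w2 e)%E) => //.
- exact: measurable_absorb.
- exact: measurable_absorb.
- by apply: emeasurable_funM => //; exact: measurable_indicE.
- by apply: emeasurable_funM => //; exact: measurable_indicE.
- by move=> e; rewrite mule_ge0// lee_fin.
- by move=> e; rewrite mule_ge0// lee_fin.
- move=> C mC; have hH : history_sigma k (absorb k @^-1` C `&` alive k).
    by apply: history_sigmaI; [exact: absorb_history|exact: alive_history].
  have indE (w : Omega R S -> \bar R) :
      (\int[P]_(e in absorb k @^-1` C) ((\1_(alive k) e)%:E * w e) =
       \int[P]_(e in absorb k @^-1` C `&` alive k) w e)%E.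
    rewrite integral_indicr [RHS]integral_indicr; apply: eq_integral => e _.
    by rewrite indicI/= EFinM muleAC muleC; congr (_ * _)%E; rewrite muleC.
  by rewrite !indE; apply: hw => // e [].
Qed.

Definition jump_event (B : set R) : set (Omega R S) :=
  [set e | (EFin @` B) (sojourn e k) /\ (Some @` [set y]) (state e k.+1)].

Lemma measurable_jump_event (B : set R) : measurable B -> measurable (jump_event B).
Proof.
move=> mB.
have -> : jump_event B =
    (fun e => sojourn e k) @^-1` (EFin @` B) `&` [set e | (Some @` [set y]) (state e k.+1)] by [].
apply: measurableI; last exact: measurable_state.
by rewrite -[X in measurable X]setTI; apply: measurable_sojourn => //; exact: measurable_image_EFin.
Qed.

Lemma law_jump_entrance (B : set R) : measurable B -> B `<=` [set t | 0 < t] ->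
  (\int[P]_e ((entrance e)%:E * (\1_(jump_event B) e)%:E) =
   \int[P]_e ((entrance e)%:E * \int[mu]_(t in B) (jump_density (e, t))%:E))%E.
Proof.
move=> mB B0.
have mL := measurable_jump_event mB.
have mI : measurable_fun setT (fun e => \int[mu]_(t in B) (jump_density (e, t))%:E)%E.
  apply: (@measurable_integral_on _ _ _ _ _ mu (fun p => (jump_density p)%:E)) => //.
    by apply/measurable_EFinP; exact: measurable_jump_density.
  by move=> p; rewrite lee_fin jump_density_ge0.
have := @eq_history_integral (fun e => (\1_(jump_event B) e)%:E)
  (fun e => \int[mu]_(t in B) (jump_density (e, t))%:E)%E (fun e => (entrance e)%:E).
under eq_integral do rewrite entrance_absorb -entrance_alive.
under [in X in _ = X]eq_integral do rewrite entrance_absorb -entrance_alive.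
apply => //.
- exact: measurable_indicE.
- by apply/measurable_EFinP; exact: measurable_entrance.
- by move=> e; apply: integral_ge0 => t _; rewrite lee_fin jump_density_ge0.
- by move=> e; rewrite lee_fin entrance_ge0.
- move=> H hH Ha; have mH := history_measurable hH.
  rewrite -(law_jump A_hausdorff q_rate pi_policy P_law [set y] hH Ha mB B0).
  by rewrite integral_indic// setIC.
Qed.

Lemma law_survival_entrance (s : R) (f : Omega R S -> R) : 0 < s ->
  measurable_fun setT f -> (forall e, 0 <= f e) ->
  (\int[P]_e ((entrance e)%:E * (f (absorb k e))%:E * (\1_[set e | (s%:E <= sojourn e k)%E] e)%:E) =
   \int[P]_e ((entrance e)%:E * (f (absorb k e))%:E * (hsurv k (e, s))%:E))%E.
Proof.
move=> s0 mf f0.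
have mL : measurable ([set e : Omega R S | (s%:E <= sojourn e k)%E]).
  rewrite -[X in measurable X]setTI; apply: emeasurable_fun_le => //.
  exact: measurable_sojourn.
have := @eq_history_integral (fun e => (\1_[set e : Omega R S | (s%:E <= sojourn e k)%E] e)%:E)
  (fun e => (hsurv k (e, s))%:E) (fun e => (entrance e)%:E * (f e)%:E)%E.
under eq_integral do rewrite entrance_absorb [X in (X * _)%E]muleAC -entrance_alive.
under [in X in _ = X]eq_integral do rewrite entrance_absorb [X in (X * _)%E]muleAC -entrance_alive.
apply => //.
- exact: measurable_indicE.
- apply/measurable_EFinP; apply: measurable_fun_pair1.
  exact: measurable_hist_survival.
- apply: emeasurable_funM; apply/measurable_EFinP => //; exact: measurable_entrance.
- by move=> e; rewrite lee_fin hist_survival_ge0.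
- by move=> e; rewrite mule_ge0// lee_fin ?entrance_ge0.
- move=> H hH Ha; have mH := history_measurable hH.
  rewrite -(law_sojourn_ge A_hausdorff q_rate pi_policy P_law hH Ha s0).
  by rewrite integral_indic// setIC.
Qed.

(** The density, in the time elapsed since the [k]-th jump, of the jumps from
    [z] to [y] that come next, discounted up to the [k]-th jump only. *)
Definition jump_profile (t : R) : \bar R :=
  (\int[P]_e ((entrance e)%:E * (jump_density (e, t))%:E))%E.

Lemma jump_profile_ge0 t : (0 <= jump_profile t)%E.
Proof.
by apply: integral_ge0 => e _; rewrite mule_ge0// lee_fin ?entrance_ge0 ?jump_density_ge0.
Qed.

Let prof_fun (p : Omega R S * R) : \bar R := ((entrance p.1)%:E * (jump_density p)%:E)%E.

Let mprof : measurable_fun setT prof_fun.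
Proof.
apply: emeasurable_funM; apply/measurable_EFinP; last exact: measurable_jump_density.
by apply: measurableT_comp => //; exact: measurable_entrance.
Qed.

Let prof0 p : (0 <= prof_fun p)%E.
Proof. by rewrite mule_ge0// lee_fin ?entrance_ge0 ?jump_density_ge0. Qed.

Lemma measurable_jump_profile : measurable_fun setT jump_profile.
Proof. exact: (@measurable_fun_fubini_tonelli_G _ _ _ _ R P prof_fun mprof prof0). Qed.

(** The weighted law of the sojourn time has density [jump_profile]; it is
    tested here against the remaining discount. *)
Lemma discounted_jump :
  (\int[P]_e ((if state e k.+1 == Some y
               then entrance e * expR (- alpha * fine (sojourn e k)) else 0)%:E) =
   \int[mu]_t ((expR (- alpha * t))%:E * jump_profile t))%E.
Proof.
have mexp : measurable_fun setT (fun t : R => (expR (- alpha * t))%:E).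
  by apply/measurable_EFinP; apply: measurableT_comp => //; exact: measurable_funM.
have mJ : measurable (jump_event setT) by exact: measurable_jump_event.
have mtau : measurable_fun setT (fun e : Omega R S => fine (sojourn e k) : R).
  rewrite (_ : (fun e => _) = fine \o (fun e : Omega R S => sojourn e k))//.
  by apply: measurableT_comp; [exact: fine_measurable|exact: measurable_sojourn].
have mw1 : measurable_fun setT (fun e => (entrance e)%:E * (\1_(jump_event setT) e)%:E)%E.
  apply: emeasurable_funM; last exact: measurable_indicE.
  by apply/measurable_EFinP; exact: measurable_entrance.
have := @eq_weighted_integral R _ _ _ _ _ _ P mu (fun e : Omega R S => fine (sojourn e k) : R) id
  (fun e => (entrance e)%:E * (\1_(jump_event setT) e)%:E)%E jump_profile
  mtau (@measurable_id _ _ _) mw1 measurable_jump_profile.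
have jT e : jump_event setT e <-> state e k.+1 = Some y.
  split=> [[_ [_ -> <-]]//|ey]; split; last by exists y.
  by have [|t _ ->] := @sojourn_fin _ _ _ e k; [rewrite ey|exists t].
move=> /(_ _ _ _ _ mexp) <-.
- apply: eq_integral => e _; rewrite muleC; case: eqP => ey.
    by rewrite indicE mem_set ?mule1 ?EFinM//; apply/jT.
  by rewrite indicE memNset ?mule0 ?mul0e//; apply/jT.
- by move=> e; rewrite mule_ge0// lee_fin ?entrance_ge0.
- exact: jump_profile_ge0.
(* sojourn times are positive, and [jump_profile] vanishes elsewhere *)
- move=> C mC; pose B : set R := C `&` [set t | 0 < t].
  have mB : measurable B.
    apply: measurableI => //; rewrite (_ : [set t | 0 < t] = `]0, +oo[%classic) //.
    by apply/seteqP; split => t /=; rewrite in_itv/= andbT.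
  have B0 : B `<=` [set t | 0 < t] by move=> t [].
  transitivity (\int[P]_e ((entrance e)%:E * (\1_(jump_event B) e)%:E))%E.
    rewrite integral_indicr; apply: eq_integral => e _.
    rewrite -muleA; congr (_ * _)%E; rewrite -EFinM; congr (_%:E); rewrite !indicE.
    have [|nJ] := pselect (jump_event setT e).
      move=> J; rewrite mem_set// mul1r; have ey := (jT e).1 J.
      have [|t t0 tE] := @sojourn_fin _ _ _ e k; first by rewrite ey.
      congr ((nat_of_bool _)%:R); apply/idP/idP; rewrite !inE /= tE /=.
        by move=> Ct; split; [exists t|rewrite ey; exists y].
      by move=> [[t' [Ct' _]]]; rewrite tE => -[<-].
    have nJB : ~ jump_event B e.
      by move=> [[t _ tE] ey]; apply: nJ; split => //; exists t.
    by rewrite (memNset nJ) (memNset nJB) mul0r.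
  rewrite law_jump_entrance//.
  transitivity (\int[P]_e \int[mu]_(t in B) prof_fun (e, t))%E.
    apply: eq_integral => e _; rewrite -ge0_integralZl// ?lee_fin ?entrance_ge0//.
    - apply: measurable_funTS; apply/measurable_EFinP.
      exact: measurable_fun_pair2 measurable_jump_density.
    - by move=> t _; rewrite lee_fin jump_density_ge0.
  rewrite (@fubini_tonelli_on _ _ _ _ _ P mu prof_fun B mprof prof0 mB).
  rewrite (@integral_indicr _ _ _ mu B jump_profile).
  rewrite [RHS](@integral_indicr _ _ _ mu C jump_profile).
  apply: eq_integral => t _.
  have [t0|t0] := ltP 0 t; first by rewrite /B indicI/= [X in _ * X]indicE mem_set// mulr1.
  suff -> : jump_profile t = 0%E by rewrite !mul0e.
  rewrite /jump_profile integral0_eq// => e _.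
  by rewrite /jump_density /hist_rate/= ltNge t0/= mul0r mule0.
- by move=> t; rewrite lee_fin expR_ge0.
Qed.

Local Notation sojourn_rate := (in_sojourn alpha k z (rho [set y])).

Lemma sojourn_rate_shift e s : sojourn_rate (e, s + jump_clock k e) =
  entrance e * (expR (- alpha * s) * hrate k [set y] (e, s)) *
  \1_[set e | (s%:E <= sojourn e k)%E] e.
Proof.
rewrite /in_sojourn /entrance /=.
case: (state e k =P Some z) => [ez|_]; last by rewrite andbF !mul0r.
have ek : state e k <> None by rewrite ez.
have TE : jump_time e k = (jump_clock k e)%:E.
  by rewrite /jump_clock fineK//; exact: jump_time_fin.
have sojE : sojourning e k (s + jump_clock k e) = (0 < s) && (s%:E <= sojourn e k)%E.
  by rewrite /sojourning jump_timeS TE lte_fin ltrDr EFinD addeC leeD2lE.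
rewrite sojE.
have [s0|s0] := ltP 0 s; last by rewrite /hist_rate/= ltNge s0/= !mulr0 mul0r.
rewrite /= andbT indicE.
case: (boolP (s%:E <= sojourn e k)%E) => st; last by rewrite memNset ?mulr0//=; exact/negP.
rewrite mem_set// mulr1 mulrDr expRD.
rewrite (rate_at_sojourn A_hausdorff pi_policy P_law (k := k)).
  by rewrite addrK [RHS]mulrA [X in X * _]mulrC.
by rewrite sojE s0.
Qed.

(** Shifting time to start at the [k]-th jump turns the sojourn into the event
    that it lasts at least [s], whose conditional probability is the survival
    factor of [jump_density]. *)
Lemma discounted_sojourn :
  (\int[P]_e \int[mu]_t (sojourn_rate (e, t))%:E =
   \int[mu]_t ((expR (- alpha * t))%:E * jump_profile t))%E.
Proof.
pose Y : set (Omega R S * R) := [set p | (p.2%:E <= sojourn p.1 k)%E].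
have mY : measurable Y.
  have mj : measurable_fun setT (fun e : Omega R S => sojourn e k).
    exact: measurable_sojourn.
  have mj1 := measurableT_comp mj (@measurable_fst _ _ (Omega R S) R).
  have mt : measurable_fun setT (fun p : Omega R S * R => p.2%:E).
    exact/measurable_EFinP.
  by rewrite -[Y]setTI; exact: emeasurable_fun_le mt mj1.
pose f (p : Omega R S * R) : \bar R :=
  ((entrance p.1)%:E * (expR (- alpha * p.2) * hrate k [set y] p)%:E * (\1_Y p)%:E)%E.
have f0 p : (0 <= f p)%E.
  by rewrite !mule_ge0// lee_fin ?entrance_ge0 ?mulr_ge0 ?expR_ge0 ?hist_rate_ge0.
have mh : measurable_fun setT (hrate k [set y] : Omega R S * R -> R) by exact: measurable_hist_rate.
have mf : measurable_fun setT f.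
  apply: emeasurable_funM; [apply: emeasurable_funM|]; apply/measurable_EFinP.
  - by apply: measurableT_comp => //; exact: measurable_entrance.
  - apply: measurable_funM => //.
    by apply: measurableT_comp => //; exact: measurable_funM.
  - exact: measurable_indic.
have msoj := measurable_in_sojourn alpha k z
  (measurable_total_rate A_hausdorff q pi_policy [set y]).
transitivity (\int[P]_e \int[mu]_t f (e, t))%E.
  apply: eq_integral => e _.
  rewrite (@integral_shift R (jump_clock k e) (fun t => (sojourn_rate (e, t))%:E)).
  - by apply: eq_integral => s _; rewrite sojourn_rate_shift !EFinM.
  - apply/measurable_EFinP; exact: (measurable_fun_pair2 e msoj).
  - move=> t; rewrite lee_fin; apply: in_sojourn_ge0 => p; exact: total_rate_ge0.
rewrite (@fubini_tonelli _ _ _ _ R P mu f mf f0); apply: eq_integral => s _.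
have [s0|s0] := ltP 0 s; last first.
  rewrite integral0_eq ?/jump_profile ?integral0_eq ?mule0// => e _;
    rewrite /f /jump_density /hist_rate/= ltNge s0/=.
    by rewrite mul0r mule0.
  by rewrite mulr0 mule0 mul0e.
pose g e := expR (- alpha * s) * rho [set y] (e, jump_clock k e + s).
have gE e : g (absorb k e) = expR (- alpha * s) * hrate k [set y] (e, s).
  by rewrite /g /hist_rate/= s0 /jump_clock jump_time_absorb.
have mg : measurable_fun setT g.
  apply: measurable_funM => //.
  have mr := measurable_total_rate A_hausdorff q pi_policy [set y].
  have mp : measurable_fun setT (fun e : Omega R S => (e, jump_clock k e + s) : Omega R S * R).
    apply: measurable_fun_pair => //; apply: measurable_funD => //; exact: measurable_jump_clock.
  exact: (measurableT_comp mr mp).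
have g0 e : 0 <= g e by rewrite mulr_ge0 ?expR_ge0// total_rate_ge0.
transitivity (\int[P]_e ((entrance e)%:E * (g (absorb k e))%:E *
    (\1_[set e : Omega R S | (s%:E <= sojourn e k)%E] e)%:E))%E.
  by apply: eq_integral => e _; rewrite gE.
rewrite law_survival_entrance//.
transitivity (\int[P]_e ((expR (- alpha * s))%:E * prof_fun (e, s)))%E.
  apply: eq_integral => e _.
  by rewrite gE /prof_fun /jump_density -!EFinM; congr (_%:E); ring.
apply: ge0_integralZl.
- exact: measurableT.
- exact: (measurable_fun_pair1 s mprof).
- by move=> e _; exact: prof0.
- by rewrite lee_fin expR_ge0.
Qed.

(** Splitting the discount at the next jump into that at the [k]-th one and that
    of the sojourn in between turns the left-hand side into the integral of
    [discounted_jump], which is also the one of [discounted_sojourn]. *)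
Lemma discounted_compensator :
  (\int[P]_e ((if (state e k == Some z) && (state e k.+1 == Some y)
               then expR (- alpha * jump_clock k.+1 e) else 0)%:E) =
   \int[P]_e \int[mu]_t (sojourn_rate (e, t))%:E)%E.
Proof.
rewrite discounted_sojourn -discounted_jump; apply: eq_integral => e _; congr (_%:E).
rewrite /entrance; case: (state e k =P Some z) => /= [ez|_]; last by rewrite mul0r if_same.
case: (state e k.+1 =P Some y) => // ey.
rewrite -expRD -mulrDr /jump_clock jump_timeS fineD//.
  by apply: jump_time_fin; rewrite ez.
by have [|t _ ->] := @sojourn_fin _ _ _ e k; first by rewrite ey.
Qed.

End discounted_compensator.

(** * Occupation times and their balance equation *)

Section exponential_tail.
Context (R : realType).
Local Notation mu := (@lebesgue_measure R).
Variable alpha : R.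
Hypothesis alpha_gt0 : 0 < alpha.

Lemma integral_exp_tail (a : R) :
  (\int[mu]_(t in `]a, +oo[) (alpha * expR (- alpha * t))%:E = (expR (- alpha * a))%:E)%E.
Proof.
have cexp : continuous (fun z : R^o => expR (- alpha * z)).
  move=> z; apply: continuous_comp; last exact: continuous_expR.
  by apply: continuousM => //; apply: (@continuousN _ R^o); exact: cst_continuous.
have cf : continuous (fun z : R => alpha * expR (- alpha * z)).
  move=> z; apply: (@continuousM _ R^o (fun=> alpha) (fun x => expR (- alpha * x))).
    exact: cst_continuous.
  exact: cexp.
rewrite integral_itv_obnd_cbnd; last first.
  by apply: measurable_funTS; apply/measurable_EFinP; exact: continuous_measurable_fun.
rewrite (@ge0_continuous_FTC2y _ _ (fun x => - (expR (- alpha * x))) _ 0)//.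
- by rewrite -EFinB opprK add0r.
- by move=> x _; rewrite mulr_ge0 ?expR_ge0// ltW.
- by apply: continuous_subspaceT.
- rewrite -oppr0; apply: cvgN.
  rewrite (_ : (fun x => expR (- alpha * x)) =
               (fun z => expR (- z)) \o (fun z => alpha * z)); last first.
    by apply: eq_fun => x; rewrite mulNr.
  apply: (@cvg_comp _ _ _ _ _ _ (pinfty_nbhs R)); last exact: cvgr_expR.
  exact: gt0_cvgMry.
- by apply: cvgN; apply/cvg_at_right_filter; exact: cexp.
- move=> z _.
  rewrite derive1_comp// derive1N// derive1_id mulN1r derive1_comp// derive1E.
  have /funeqP -> := @derive_expR R.
  by rewrite derive1Ml// derive1_id mulr1 mulrN opprK mulrC.
Qed.

End exponential_tail.

Section occupation.
Context (R : realType) dS (S : finStateType dS) (A : completePseudoMetricType R).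
Hypothesis A_hausdorff : hausdorff_space A.
Variables (adm : S -> {fset A}) (q : S -> A -> {charge set S -> \bar R}).
Hypothesis q_rate : is_transition_rate adm q.
Variable pi : control S A.
Hypothesis pi_policy : is_policy adm pi.
Variables (gamma : probability S R) (P : probability (Omega R S) R).
Hypothesis P_law : is_law adm q pi gamma P.
Variable alpha : R.
Hypothesis alpha_gt0 : 0 < alpha.

Local Notation mu := (@lebesgue_measure R).
Implicit Types e : Omega R S.

Definition discount k e : R :=
  if state e k is Some _ then expR (- alpha * jump_clock k e) else 0.

(** The discount held at a jump is used up during the sojourn that follows,
    except for what is left at the next jump. *)
Lemma discount_sojourn k e : state e k <> None ->
  (\int[mu]_t (if sojourning e k t then alpha * expR (- alpha * t) else 0)%:E +
   (discount k.+1 e)%:E = (discount k e)%:E)%E.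
Proof.
move=> ek.
have TE : jump_time e k = (jump_clock k e)%:E.
  by rewrite /jump_clock fineK//; exact: jump_time_fin.
have mexp (D : set R) : measurable_fun D (fun t : R => (alpha * expR (- alpha * t))%:E).
  apply: measurable_funTS; apply/measurable_EFinP; apply: measurable_funM => //.
  by apply: measurableT_comp => //; exact: measurable_funM.
have -> : discount k e = expR (- alpha * jump_clock k e).
  by rewrite /discount; case: (state e k) ek.
rewrite -(integral_exp_tail alpha_gt0).
have restr (V : set R) : (forall t, sojourning e k t = (t \in V)) ->
    (\int[mu]_t (if sojourning e k t then alpha * expR (- alpha * t) else 0)%:E =
     \int[mu]_(t in V) (alpha * expR (- alpha * t))%:E)%E.
  move=> h; rewrite [RHS]integral_mkcond; apply: eq_integral => t _.
  by rewrite patchE h; case: ifP.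
case ek1 : (state e k.+1) => [y|].
  have T1E : jump_time e k.+1 = (jump_clock k.+1 e)%:E.
    by rewrite /jump_clock fineK//; apply: jump_time_fin; rewrite ek1.
  have ab : jump_clock k e < jump_clock k.+1 e.
    by rewrite -lte_fin -TE -T1E; exact: jump_time_lt.
  rewrite (restr `]jump_clock k e, jump_clock k.+1 e]%classic); last first.
    by move=> t; rewrite /sojourning TE T1E lte_fin lee_fin; apply/idP/idP; rewrite inE/= in_itv/=.
  rewrite {1}/discount ek1 -(integral_exp_tail alpha_gt0).
  rewrite (@itv_bndbnd_setU _ _ (BRight (jump_clock k e)) (BRight (jump_clock k.+1 e)) +oo%O).
  - apply/esym; apply: ge0_integral_setU.
    + exact: measurable_itv.
    + exact: measurable_itv.
    + exact: mexp.
    + by move=> t _; rewrite lee_fin mulr_ge0 ?expR_ge0// ltW.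
    + apply/disj_setPS => t [/=]; rewrite !in_itv/= andbT => /andP[_ h1].
      by rewrite ltNge h1.
  - by rewrite bnd_simp ltW.
  - by [].
rewrite (restr `]jump_clock k e, +oo[%classic); last first.
  move=> t; rewrite /sojourning TE lte_fin jump_timeS (sojourn_absorbed ek1).
  rewrite addey ?TE// leey andbT; apply/idP/idP; by rewrite inE/= in_itv/= andbT.
by rewrite /discount ek1 adde0.
Qed.

Local Notation w := (weight pi).

Let mw x a : measurable_fun setT (w x a : Omega R S * R -> R).
Proof. exact: (measurable_weight A_hausdorff pi_policy). Qed.

Let mexp : measurable_fun setT (fun p : Omega R S * R => expR (- alpha * p.2)).
Proof. by apply: measurableT_comp => //; exact: measurable_funM. Qed.

(** The expected discounted time spent in [x] while using the action [a]. *)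
Definition occupation x a : \bar R :=
  (\int[mu]_(t in `[0%R, +oo[) ((expR (- alpha * t))%:E * \int[P]_e (w x a (e, t))%:E))%E.

Definition sojourn_integral k x (f : Omega R S * R -> R) : \bar R :=
  (\int[P]_e \int[mu]_t (in_sojourn alpha k x f (e, t))%:E)%E.

Lemma sojourn_integral_ge0 k x f : (forall p, 0 <= f p) -> (0 <= sojourn_integral k x f)%E.
Proof.
by move=> f0; do 2 apply: integral_ge0 => ? _; rewrite lee_fin; exact: in_sojourn_ge0.
Qed.

Let measurable_sojourn_inner k x (f : Omega R S * R -> R) : measurable_fun setT f -> (forall p, 0 <= f p) ->
  measurable_fun setT (fun e => (\int[mu]_t (in_sojourn alpha k x f (e, t))%:E)%E).
Proof.
move=> mf f0.
apply: (@measurable_fun_fubini_tonelli_F _ _ _ _ R mu (fun p => (in_sojourn alpha k x f p)%:E)).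
  by apply/measurable_EFinP; exact: measurable_in_sojourn.
by move=> p; rewrite lee_fin in_sojourn_ge0.
Qed.

Lemma sojourn_integral_sum k x (g : A -> R) : (forall a, 0 <= g a) ->
  sojourn_integral k x (fun p => \sum_(a <- adm x) g a * w x a p) =
  (\sum_(a <- adm x) (g a)%:E * sojourn_integral k x (w x a))%E.
Proof.
move=> g0; have w0 a p : 0 <= w x a p by exact: weight_ge0.
have inE p : in_sojourn alpha k x (fun p => \sum_(a <- adm x) g a * w x a p) p =
    \sum_(a <- adm x) g a * in_sojourn alpha k x (w x a) p.
  rewrite /in_sojourn; case: ifP => _; last by rewrite big1// => a _; rewrite mulr0.
  by rewrite mulr_sumr; apply: eq_bigr => a _; rewrite mulrCA.
rewrite /sojourn_integral.
transitivity (\int[P]_e \sum_(a <- adm x)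
    (g a)%:E * \int[mu]_t (in_sojourn alpha k x (w x a) (e, t))%:E)%E.
  apply: eq_integral => e _.
  transitivity (\int[mu]_t \sum_(a <- adm x) (g a)%:E * (in_sojourn alpha k x (w x a) (e, t))%:E)%E.
    by apply: eq_integral => t _; rewrite inE -sumEFin; apply: eq_bigr => a _; rewrite EFinM.
  have ms a : measurable_fun setT (fun t : R => (in_sojourn alpha k x (w x a) (e, t))%:E).
    apply/measurable_EFinP.
    exact: (measurable_fun_pair2 e (measurable_in_sojourn alpha k x (mw x a))).
  rewrite ge0_integral_sum//; last 2 first.
  - by move=> a; apply: measurable_funeM; exact: ms.
  - by move=> a t _; rewrite mule_ge0// lee_fin// in_sojourn_ge0.
  apply: eq_bigr => a _; apply: ge0_integralZl; first exact: measurableT.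
  - exact: ms.
  - by move=> t _; rewrite lee_fin in_sojourn_ge0.
  - by rewrite lee_fin.
rewrite ge0_integral_sum//; last 2 first.
- by move=> a; apply: measurable_funeM; exact: measurable_sojourn_inner.
- move=> a e _; rewrite mule_ge0// ?lee_fin//.
  by apply: integral_ge0 => t _; rewrite lee_fin in_sojourn_ge0.
apply: eq_bigr => a _; apply: ge0_integralZl; first exact: measurableT.
- exact: measurable_sojourn_inner.
- by move=> e _; apply: integral_ge0 => t _; rewrite lee_fin in_sojourn_ge0.
- by rewrite lee_fin.
Qed.

(** Before explosion each positive time lies in exactly one sojourn; time [0]
    is negligible and [weight] vanishes after explosion. *)
Lemma occupationE x a : occupation x a = (\sum_(k <oo) sojourn_integral k x (w x a))%E.
Proof.
have w0 p : 0 <= w x a p by exact: weight_ge0.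
(* the first factor drops time [0], at which the state is the initial one
   although no sojourn has begun *)
pose h (p : Omega R S * R) : R := (if 0 < p.2 then 1 else 0) * (expR (- alpha * p.2) * w x a p).
have mh : measurable_fun setT (fun p => (h p)%:E).
  apply/measurable_EFinP; apply: measurable_funM; last exact: measurable_funM.
  by apply: measurable_fun_ifT => //; apply: measurable_fun_ltr.
have h0 p : (0 <= (h p)%:E)%E.
  by rewrite lee_fin /h; case: ifP => _; rewrite ?mul0r// mul1r mulr_ge0 ?expR_ge0.
transitivity (\int[mu]_t \int[P]_e (h (e, t))%:E)%E.
  rewrite /occupation -integral_itv_obnd_cbnd; last first.
    apply: measurable_funTS; apply: emeasurable_funM.
      by apply/measurable_EFinP; apply: measurableT_comp => //; exact: measurable_funM.
    apply: (@measurable_fun_fubini_tonelli_G _ _ _ _ R P (fun p => (w x a p)%:E)).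
      exact/measurable_EFinP.
    by move=> p; rewrite lee_fin.
  rewrite integral_mkcond; apply: eq_integral => t _; rewrite patchE.
  case: ifPn => [|nt].
    rewrite inE/= in_itv/= andbT => t0.
    transitivity (\int[P]_e ((expR (- alpha * t))%:E * (w x a (e, t))%:E))%E.
      apply/esym; apply: ge0_integralZl; first exact: measurableT.
      - by apply/measurable_EFinP; exact: (measurable_fun_pair1 t (mw x a)).
      - by move=> e _; rewrite lee_fin.
      - by rewrite lee_fin expR_ge0.
    by apply: eq_integral => e _; rewrite /h/= t0 mul1r EFinM.
  rewrite integral0_eq// => e _; rewrite /h/=.
  case: ifPn => t0; last by rewrite mul0r.
  by move: nt; rewrite notin_setE/= in_itv/= t0.
rewrite -(@fubini_tonelli _ _ _ _ R P mu _ mh h0).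
have hE e t : (h (e, t))%:E = (\sum_(k <oo) (in_sojourn alpha k x (w x a) (e, t))%:E)%E.
  have [[k kt]|nk] := pselect (exists k, sojourning e k t).
    rewrite (@nneseriesD1 _ _ k)//; last by move=> j _; rewrite lee_fin in_sojourn_ge0.
    rewrite eseries0 ?adde0; last first.
      move=> j _ /andP[_ jk]; rewrite /in_sojourn/=.
      case: (boolP (sojourning e j t)) => //= jt.
      by rewrite (sojourning_inj jt kt) eqxx in jk.
    rewrite /h /in_sojourn/= (sojourning_gt0 kt) mul1r kt/=.
    case: ifPn => // ex; rewrite /weight/= (state_before_sojourning kt).
    by rewrite (negbTE ex) andbF mulr0.
  rewrite eseries0; last first.
    move=> j _ _; rewrite /in_sojourn/=; case: ifP => // /andP[jt _].
    by exfalso; apply: nk; exists j.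
  congr (_%:E); rewrite /h/=; case: ifPn => t0; last by rewrite mul0r.
  rewrite /weight/=; case: ifP => [/andP[_ /eqP]|_]; last by rewrite !mulr0.
  by move=> /(state_before_Some _ _ t0)[k kt _]; exfalso; apply: nk; exists k.
transitivity (\int[P]_e \sum_(k <oo) \int[mu]_t (in_sojourn alpha k x (w x a) (e, t))%:E)%E.
  apply: eq_integral => e _; under eq_integral do rewrite hE.
  apply: integral_nneseries; first exact: measurableT.
  - move=> k; apply/measurable_EFinP.
    exact: (measurable_fun_pair2 e (measurable_in_sojourn alpha k x (mw x a))).
  - by move=> k t _; rewrite lee_fin in_sojourn_ge0.
apply: integral_nneseries; first exact: measurableT.
- by move=> k; exact: measurable_sojourn_inner.
- by move=> k e _; apply: integral_ge0 => t _; rewrite lee_fin in_sojourn_ge0.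
Qed.

Definition transition k z y : \bar R :=
  (\int[P]_e ((if (state e k == Some z) && (state e k.+1 == Some y)
               then expR (- alpha * jump_clock k.+1 e) else 0)%:E))%E.

Lemma transitionE k z y : transition k z y =
  (\sum_(a <- adm z) (jump_rate q [set y] z a)%:E * sojourn_integral k z (w z a))%E.
Proof.
rewrite /transition (discounted_compensator A_hausdorff q_rate pi_policy P_law).
under eq_big_seq => a az do rewrite -(ger0_norm (jump_rate_ge0 q_rate [set y] az)).
rewrite -(@sojourn_integral_sum k z (fun a => `|jump_rate q [set y] z a|)); last first.
  by move=> a; exact: normr_ge0.
apply: eq_integral => e _; apply: eq_integral => t _.
rewrite /in_sojourn/=; case: ifP => // /andP[kt /eqP ez].
congr ((_ * _)%:E); rewrite /total_rate (bigD1 z)//= [X in _ + X]big1 ?addr0.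
  by apply: eq_big_seq => a az; rewrite ger0_norm// (jump_rate_ge0 q_rate).
move=> x xz; rewrite big1// => a _; rewrite /weight/= (state_before_sojourning kt) ez.
by rewrite (_ : (Some z == Some x) = (z == x))// eq_sym (negbTE xz) andbF mulr0.
Qed.

Definition entered k x : \bar R :=
  (\int[P]_e ((if state e k == Some x then discount k e else 0)%:E))%E.

Let mcond (X : set (Omega R S)) (b : Omega R S -> bool) (f : Omega R S -> R) :
  measurable X -> (forall e, X e <-> b e) -> measurable_fun setT f ->
  measurable_fun setT (fun e => (if b e then f e else 0)%:E).
Proof.
move=> mX Xb mf.
have -> : (fun e => (if b e then f e else 0)%:E) = (fun e => (\1_X e * f e)%:E).
  apply/funext => e; rewrite indicE; case: (boolP (b e)) => be.
    by rewrite mem_set ?mul1r//; exact/Xb.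
  by rewrite memNset ?mul0r//; apply/Xb/negP.
by apply/measurable_EFinP; apply: measurable_funM.
Qed.

Let mdisc k : measurable_fun setT (fun e => expR (- alpha * jump_clock k e)).
Proof.
apply: measurableT_comp => //; apply: measurable_funM => //.
exact: measurable_jump_clock.
Qed.

Let mtrans k z y : measurable_fun setT (fun e =>
  (if (state e k == Some z) && (state e k.+1 == Some y)
   then expR (- alpha * jump_clock k.+1 e) else 0)%:E).
Proof.
pose X := [set e : Omega R S | state e k = Some z] `&` [set e | state e k.+1 = Some y].
apply: (mcond (X := X)) => //.
- apply: measurableI.
    exact: (@measurable_state _ _ _ k [set u | u = Some z]).
  exact: (@measurable_state _ _ _ k.+1 [set u | u = Some y]).
- by move=> e; split=> [[/eqP h1 /eqP h2]|/andP[/eqP h1 /eqP h2]]; rewrite ?h1.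
Qed.

Let trans_ge0 k z y e : (0 <= (if (state e k == Some z) && (state e k.+1 == Some y)
   then expR (- alpha * jump_clock k.+1 e) else 0)%:E)%E.
Proof. by rewrite lee_fin; case: ifP => // _; exact: expR_ge0. Qed.

(** Every entry after the initial one is a jump from some state. *)
Lemma enteredS k y : entered k.+1 y = (\sum_z transition k z y)%E.
Proof.
rewrite -ge0_integral_sum//; apply: eq_integral => e _.
rewrite sumEFin; congr (_%:E); rewrite /discount.
case: (state e k.+1 =P Some y) => [ey|_]; last first.
  by rewrite big1// => z _; rewrite andbF.
have ek : state e k <> None by apply: alive_le (leqnSn k) _; rewrite ey.
case ez : (state e k) ek => [z|] // _; rewrite ey.
rewrite (bigD1 z)//= !eqxx/= big1 ?addr0// => u uz.
by rewrite (_ : (Some z == Some u) = (z == u))// eq_sym (negbTE uz).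
Qed.

Lemma entered0 x : entered 0 x = gamma [set x].
Proof.
have [<- _] := P_law.
rewrite -[X in P X]setIT -integral_indic//; last first.
  exact: (@measurable_state _ _ _ 0 (Some @` [set x])).
apply: eq_integral => e _; rewrite indicE /discount /jump_clock jump_time0/= mulr0 expR0.
case: (state e 0 =P Some x) => [ex|nx].
  by rewrite ex mem_set// /= ex; exists x.
by rewrite memNset// => -[y -> /esym].
Qed.

Lemma discount_succ k x e : state e k = Some x -> discount k.+1 e =
  \sum_y (if (state e k == Some x) && (state e k.+1 == Some y)
          then expR (- alpha * jump_clock k.+1 e) else 0).
Proof.
move=> ->; rewrite eqxx/= /discount; case: (state e k.+1) => [y|]; last by rewrite big1.
rewrite (bigD1 y)//= eqxx big1 ?addr0// => u uy.
by rewrite (_ : (Some y == Some u) = (y == u))// eq_sym (negbTE uy).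
Qed.

(** Expectation of [discount_sojourn]: what is left at the next jump is
    distributed over the states it may lead to, and is zero upon absorption. *)
Lemma entered_split k x :
  entered k x = (alpha%:E * \sum_(a <- adm x) sojourn_integral k x (w x a) +
                 \sum_y transition k x y)%E.
Proof.
pose g (p : Omega R S * R) : R := \sum_(a <- adm x) 1 * w x a p.
have mg : measurable_fun setT g by apply: measurable_sum => a; exact: measurable_funM.
have g0 p : 0 <= g p by apply: sumr_ge0 => a _; rewrite mul1r weight_ge0.
pose I e := (\int[mu]_t (in_sojourn alpha k x g (e, t))%:E)%E.
have I0 e : (0 <= I e)%E by apply: integral_ge0 => t _; rewrite lee_fin in_sojourn_ge0.
have a0 : (0 <= alpha%:E)%E by rewrite lee_fin ltW.
have E1 : (alpha%:E * \sum_(a <- adm x) sojourn_integral k x (w x a) =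
    \int[P]_e (alpha%:E * I e))%E.
  rewrite ge0_integralZl//; last exact: measurable_sojourn_inner.
  congr (_ * _)%E; have /esym := @sojourn_integral_sum k x (fun=> 1) (fun=> ler01).
  by under eq_bigr do rewrite mul1e.
have E2 : (\sum_y transition k x y = \int[P]_e \sum_y
    (if (state e k == Some x) && (state e k.+1 == Some y)
     then expR (- alpha * jump_clock k.+1 e) else 0)%:E)%E.
  by rewrite ge0_integral_sum.
have m1 : measurable_fun setT (fun e => (alpha%:E * I e)%E).
  by apply: measurable_funeM; exact: measurable_sojourn_inner.
rewrite E1 E2 -ge0_integralD//; last 3 first.
- by move=> e _; rewrite mule_ge0.
- by move=> e _; apply: sume_ge0.
- by apply: emeasurable_sum => y; exact: mtrans.
apply: eq_integral => e _; rewrite sumEFin.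
case: (state e k =P Some x) => [ex|nx]; last first.
  rewrite big1// adde0 /I integral0_eq ?mule0// => t _.
  by rewrite /in_sojourn/= (negbTE (introN eqP nx)) andbF.
have ek : state e k <> None by rewrite ex.
rewrite -(discount_sojourn ek) (discount_succ ex) ex eqxx; congr (_ + _)%E.
have mI : measurable_fun setT (fun t : R => (in_sojourn alpha k x g (e, t))%:E).
  by apply/measurable_EFinP; exact: (measurable_fun_pair2 e (measurable_in_sojourn alpha k x mg)).
transitivity (\int[mu]_t (alpha%:E * (in_sojourn alpha k x g (e, t))%:E))%E.
  apply: eq_integral => t _; rewrite /in_sojourn/= ex eqxx andbT -EFinM; congr (_%:E).
  case: ifPn => kt; last by rewrite mulr0.
  rewrite /g; under eq_bigr do rewrite mul1r.
  rewrite (weight_sum A_hausdorff pi_policy) ?ltW ?(sojourning_gt0 kt)//.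
  by rewrite (state_before_sojourning kt) ex eqxx mulr1.
apply: ge0_integralZl; first exact: measurableT.
- exact: mI.
- by move=> t _; rewrite lee_fin in_sojourn_ge0.
- exact: a0.
Qed.

Lemma transition_series z y : (\sum_(k <oo) transition k z y =
  \sum_(a <- adm z) (jump_rate q [set y] z a)%:E * occupation z a)%E.
Proof.
have w0 a p : 0 <= w z a p by exact: weight_ge0.
transitivity (\sum_(k <oo) \sum_(a <- adm z | a \in adm z)
    (jump_rate q [set y] z a)%:E * sojourn_integral k z (w z a))%E.
  by apply: eq_eseriesr => k _; rewrite transitionE big_seq.
rewrite nneseries_sum; last first.
  move=> a k az; apply: mule_ge0; first by rewrite lee_fin (jump_rate_ge0 q_rate).
  exact: sojourn_integral_ge0.
rewrite [RHS]big_seq; apply: eq_bigr => a az; rewrite nneseriesZl ?occupationE// => k _.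
exact: sojourn_integral_ge0.
Qed.

(** The entries into [x], summed over all jumps, in two ways: by what becomes of
    them ([entered_split]) and by where they come from ([enteredS]). The
    outflow stands on the left so that every term is nonnegative. *)
Lemma balance_ereal x :
  (alpha%:E * \sum_(a <- adm x) occupation x a +
     \sum_y \sum_(a <- adm x) (jump_rate q [set y] x a)%:E * occupation x a =
   gamma [set x] +
     \sum_z \sum_(a <- adm z) (jump_rate q [set x] z a)%:E * occupation z a)%E.
Proof.
have s0 k y a : (0 <= sojourn_integral k y (w y a))%E.
  by apply: sojourn_integral_ge0 => p; exact: weight_ge0.
have t0 k z y : (0 <= transition k z y)%E by apply: integral_ge0.
have m0 k : (0 <= alpha%:E * \sum_(a <- adm x) sojourn_integral k x (w x a))%E.
  by apply: mule_ge0; [rewrite lee_fin ltW|apply: sume_ge0].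
have e0 k : (0 <= entered k x)%E.
  by rewrite entered_split; apply: adde_ge0; [exact: m0|apply: sume_ge0].
transitivity (\sum_(k <oo) entered k x)%E.
  transitivity (\sum_(k <oo) (alpha%:E * \sum_(a <- adm x) sojourn_integral k x (w x a) +
                 \sum_y transition k x y))%E; last first.
    by apply: eq_eseriesr => k _; rewrite entered_split.
  rewrite nneseriesD; last 2 first.
  - by move=> k _ _; exact: m0.
  - by move=> k _ _; apply: sume_ge0.
  congr (_ + _)%E.
    rewrite nneseriesZl => [|k _]; last by apply: sume_ge0.
    rewrite nneseries_sum//; congr (_ * _)%E; apply: eq_bigr => a _.
    by rewrite occupationE.
  rewrite nneseries_sum//; apply: eq_bigr => y _; by rewrite transition_series.
rewrite nneseries_recl// entered0; congr (_ + _)%E.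
rewrite -nneseries_addn//.
transitivity (\sum_(k <oo) \sum_z transition k z x)%E.
  by apply: eq_eseriesr => k _; rewrite addn1 enteredS.
by rewrite nneseries_sum//; apply: eq_bigr => z _; rewrite transition_series.
Qed.

Lemma occupation_ge0 x a : (0 <= occupation x a)%E.
Proof.
apply: integral_ge0 => t _; apply: mule_ge0; first by rewrite lee_fin expR_ge0.
by apply: integral_ge0 => e _; rewrite lee_fin weight_ge0.
Qed.

Lemma integral_weight_le1 x a (t : R) : (\int[P]_e (w x a (e, t))%:E <= 1)%E.
Proof.
apply: (@le_trans _ _ (\int[P]_e (cst 1%E) e)%E); last first.
  by rewrite integral_cst// mul1e probability_le1.
apply: ge0_le_integral => //.
- by move=> e _; rewrite lee_fin weight_ge0.
- by apply/measurable_EFinP; exact: (measurable_fun_pair1 t (mw x a)).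
- by move=> e _; rewrite lee_fin (weight_le1 A_hausdorff pi_policy).
Qed.

Lemma integral_discount : (\int[mu]_(t in `[0%R, +oo[) (expR (- alpha * t))%:E < +oo)%E.
Proof.
have mexp1 (D : set R) : measurable_fun D (fun t : R => (expR (- alpha * t))%:E).
  apply: measurable_funTS; apply/measurable_EFinP.
  by apply: measurableT_comp => //; exact: measurable_funM.
rewrite -integral_itv_obnd_cbnd; last exact: mexp1.
have : (\int[mu]_(t in `]0%R, +oo[) (alpha%:E * (expR (- alpha * t))%:E) < +oo)%E.
  under eq_integral do rewrite -EFinM.
  by rewrite (integral_exp_tail alpha_gt0) ltry.
have -> : (\int[mu]_(t in `]0%R, +oo[) (alpha%:E * (expR (- alpha * t))%:E) =
    alpha%:E * \int[mu]_(t in `]0%R, +oo[) (expR (- alpha * t))%:E)%E.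
  apply: ge0_integralZl; [exact: measurable_itv|exact: mexp1| |].
    by move=> t _; rewrite lee_fin expR_ge0.
  by rewrite lee_fin ltW.
move=> h; rewrite ltey; apply/eqP => h2; move: h; rewrite h2.
by rewrite gt0_muley ?ltxx// lte_fin.
Qed.

Lemma occupation_lty x a : (occupation x a < +oo)%E.
Proof.
apply: le_lt_trans integral_discount; apply: ge0_le_integral => //.
- move=> t _; apply: mule_ge0; first by rewrite lee_fin expR_ge0.
  by apply: integral_ge0 => e _; rewrite lee_fin weight_ge0.
- apply: measurable_funTS; apply: emeasurable_funM.
    by apply/measurable_EFinP; apply: measurableT_comp => //; exact: measurable_funM.
  apply: (@measurable_fun_fubini_tonelli_G _ _ _ _ R P (fun p => (w x a p)%:E)).
    exact/measurable_EFinP.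
  by move=> p; rewrite lee_fin weight_ge0.
- apply: measurable_funTS; apply/measurable_EFinP.
  by apply: measurableT_comp => //; exact: measurable_funM.
- move=> t _; rewrite -[leRHS]mule1; apply: lee_wpmul2l; first by rewrite lee_fin expR_ge0.
  exact: integral_weight_le1.
Qed.

End occupation.

(** * Balance equation and criteria in the real numbers *)

Section real_balance.
Context (R : realType) dS (S : finStateType dS) (A : completePseudoMetricType R).
Hypothesis A_hausdorff : hausdorff_space A.
Variables (adm : S -> {fset A}) (q : S -> A -> {charge set S -> \bar R}).
Hypothesis q_rate : is_transition_rate adm q.

Lemma charge_finite (nu : {charge set S -> \bar R}) (s : seq S) : uniq s ->
  nu [set` s] = (\sum_(y <- s) nu [set y])%E.
Proof.
elim: s => [_|y s ih /= /andP[ys us]].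
  have -> : [set` [::]] = set0 :> set S by apply/seteqP; split=> z.
  by rewrite big_nil charge0.
have -> : [set` y :: s] = [set y] `|` [set` s].
  apply/seteqP; split=> z /=; rewrite inE; first by move=> /orP[/eqP|]; [left|right].
  by move=> [->|->]; rewrite ?eqxx ?orbT.
rewrite big_cons chargeU ?ih//; try exact: measurable_all.
by apply/seteqP; split=> z //= [-> zs]; move/negP: ys.
Qed.

Lemma rate_sum x a : a \in adm x -> \sum_y rate q y x a = 0.
Proof.
move=> ax; have [_ qT] := q_rate ax.
apply/EFin_inj; rewrite -sumEFin; transitivity (q x a [set: S]); last by rewrite qT.
have -> : [set: S] = [set` enum S] by apply/seteqP; split=> z //= _; rewrite mem_enum.
rewrite charge_finite ?enum_uniq// big_enum/=; apply: eq_bigr => y _.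
by rewrite /rate fineK// fin_num_measure//; exact: measurable_all.
Qed.

Lemma jump_rate1 y x a : jump_rate q [set y] x a = if y == x then 0 else rate q y x a.
Proof.
rewrite /jump_rate /rate; case: eqP => [->|yx]; first by rewrite setDv charge0.
by congr (fine (q x a _)); apply/seteqP; split=> z /=; [case|move=> ->].
Qed.

Variable pi : control S A.
Hypothesis pi_policy : is_policy adm pi.
Variables (gamma : probability S R) (P : probability (Omega R S) R).
Hypothesis P_law : is_law adm q pi gamma P.
Variable alpha : R.
Hypothesis alpha_gt0 : 0 < alpha.

Local Notation occ x a := (occupation pi P alpha x a).

Lemma occupation_fin x a : occ x a \is a fin_num.
Proof.
by rewrite ge0_fin_numE ?occupation_ge0// (occupation_lty A_hausdorff pi_policy P alpha_gt0).
Qed.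

(** The outflow from [x] moves to the right-hand side as the diagonal term,
    since [rate q x x a] is minus the total rate out of [x]. *)
Lemma balance_of_ereal (o : S -> A -> R) (g : R) x :
  (alpha%:E * \sum_(a <- adm x) (o x a)%:E +
     \sum_y \sum_(a <- adm x) (jump_rate q [set y] x a)%:E * (o x a)%:E =
   g%:E + \sum_z \sum_(a <- adm z) (jump_rate q [set x] z a)%:E * (o z a)%:E)%E ->
  alpha * \sum_(a <- adm x) o x a =
  g + \sum_y \sum_(a <- adm y) rate q x y a * o y a.
Proof.
have sE D z : (\sum_(a <- adm z) (jump_rate q D z a)%:E * (o z a)%:E =
    (\sum_(a <- adm z) jump_rate q D z a * o z a)%:E)%E.
  by rewrite -sumEFin; apply: eq_bigr => a _; rewrite EFinM.
rewrite (eq_bigr _ (fun y _ => sE [set y] x)) [in X in _ = X](eq_bigr _ (fun z _ => sE [set x] z)).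
rewrite !sumEFin -EFinM -!EFinD => -[h].
have outE : \sum_y \sum_(a <- adm x) jump_rate q [set y] x a * o x a =
    - \sum_(a <- adm x) rate q x x a * o x a.
  rewrite exchange_big/= -sumrN; apply: eq_big_seq => a ax.
  rewrite -mulr_suml -mulNr; congr (_ * _).
  rewrite (bigD1 x)//= jump_rate1 eqxx add0r.
  have := rate_sum ax; rewrite (bigD1 x)//= => /eqP; rewrite addrC addr_eq0 => /eqP <-.
  by apply: eq_bigr => y yx; rewrite jump_rate1 (negbTE yx).
have inE : \sum_z \sum_(a <- adm z) jump_rate q [set x] z a * o z a =
    \sum_(z | z != x) \sum_(a <- adm z) rate q x z a * o z a.
  rewrite (bigD1 x)//= big1 ?add0r => [|a _]; last by rewrite jump_rate1 eqxx mul0r.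
  apply: eq_bigr => z zx; apply: eq_bigr => a _.
  by rewrite jump_rate1 eq_sym (negbTE zx).
rewrite [X in _ = _ + X](bigD1 x)//=; move: h; rewrite outE inE; lra.
Qed.

Lemma balance_real x :
  alpha * \sum_(a <- adm x) fine (occ x a) =
  fine (gamma [set x]) + \sum_y \sum_(a <- adm y) rate q x y a * fine (occ y a).
Proof.
have := balance_ereal A_hausdorff q_rate pi_policy P_law alpha_gt0 x.
have -> : gamma [set x] = (fine (gamma [set x]))%:E.
  by rewrite fineK// fin_num_measure//; exact: measurable_all.
have oE : occupation pi P alpha = (fun y a => (fine (occ y a))%:E).
  by apply/funext => y; apply/funext => a; rewrite fineK// occupation_fin.
rewrite {1 2 3}oE; exact: (@balance_of_ereal (fun y a => fine (occ y a))).
Qed.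

Local Notation mu := (@lebesgue_measure R).

(** The functions [u] have no sign, but occupation times are finite, which
    allows the finite sums to be exchanged with both integrals. *)
Lemma value_integralE (u : S -> A -> R) :
  (\int[mu]_(t in `[0%R, +oo[) ((expR (- alpha * t))%:E *
     \int[P]_e action_integral adm (fun y a => (u y a)%:E) pi e t) =
   (\sum_x \sum_(a <- adm x) u x a * fine (occ x a))%:E)%E.
Proof.
have mw x a := measurable_weight A_hausdorff pi_policy x a.
have w0 x a p : 0 <= weight pi x a p by exact: weight_ge0.
have w1 x a p : weight pi x a p <= 1 by exact: (weight_le1 A_hausdorff pi_policy).
pose W x a t := (\int[P]_e (weight pi x a (e, t))%:E)%E.
have W0 x a t : (0 <= W x a t)%E by apply: integral_ge0 => e _; rewrite lee_fin.
have mW x a : measurable_fun setT (W x a).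
  apply: (@measurable_fun_fubini_tonelli_G _ _ _ _ R P (fun p => (weight pi x a p)%:E)).
    by apply/measurable_EFinP; exact: mw.
  by move=> p; rewrite lee_fin.
have mexp : measurable_fun setT (fun t : R => (expR (- alpha * t))%:E).
  by apply/measurable_EFinP; apply: measurableT_comp => //; exact: measurable_funM.
have iw x a t : P.-integrable setT (fun e => (weight pi x a (e, t))%:E).
  apply: measurable_bounded_integrable => //.
  - exact: (le_lt_trans (probability_le1 P measurableT) (ltry 1)).
  - exact: (measurable_fun_pair1 t (mw x a)).
  - exists 1; split; first exact: real1.
    move=> y y1 e _; rewrite /= ger0_norm//.
    exact: le_trans (w1 x a (e, t)) (ltW y1).
have iW x a : mu.-integrable `[0%R, +oo[ (fun t : R => ((expR (- alpha * t))%:E * W x a t)%E).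
  apply/integrableP; split.
    by apply: measurable_funTS; apply: emeasurable_funM => //; exact: mW.
  have -> : (\int[mu]_(t in `[0%R, +oo[) `|(expR (- alpha * t))%:E * W x a t| =
      occupation pi P alpha x a)%E.
    by apply: eq_integral => t _; rewrite gee0_abs// mule_ge0// lee_fin expR_ge0.
  exact: (occupation_lty A_hausdorff pi_policy P alpha_gt0 x a).
transitivity (\int[mu]_(t in `[0%R, +oo[) \sum_x \sum_(a <- adm x)
    ((u x a)%:E * ((expR (- alpha * t))%:E * W x a t)))%E.
  apply: eq_integral => t; rewrite inE/= in_itv/= andbT => t0.
  transitivity ((expR (- alpha * t))%:E * \int[P]_e \sum_x \sum_(a <- adm x)
      ((u x a)%:E * (weight pi x a (e, t))%:E))%E.
    congr (_ * _)%E; apply: eq_integral => e _.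
    rewrite (action_integralE A_hausdorff pi_policy)// -sumEFin; apply: eq_bigr => x _.
    by rewrite -sumEFin; apply: eq_bigr => a _; rewrite EFinM.
  have fW x a : W x a t \is a fin_num.
    rewrite ge0_fin_numE// (le_lt_trans (integral_weight_le1 A_hausdorff pi_policy P x a t))//.
    by rewrite ltry.
  rewrite integral_sum//; last first.
    by move=> x; apply: integrable_sum => // a _; apply: integrableZl => //; exact: iw.
  transitivity ((expR (- alpha * t))%:E * \sum_x \sum_(a <- adm x) (u x a)%:E * W x a t)%E.
    congr (_ * _)%E; apply: eq_bigr => x _; rewrite integral_sum//; last first.
      by move=> a; apply: integrableZl => //; exact: iw.
    by apply: eq_bigr => a _; rewrite integralZl//; exact: iw.
  have WE x a : W x a t = (fine (W x a t))%:E by rewrite fineK.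
  transitivity ((expR (- alpha * t) * \sum_x \sum_(a <- adm x) u x a * fine (W x a t))%:E).
    rewrite EFinM -sumEFin; congr (_ * _)%E; apply: eq_bigr => x _.
    by rewrite -sumEFin; apply: eq_bigr => a _; rewrite EFinM -WE.
  rewrite mulr_sumr -sumEFin; apply: eq_bigr => x _.
  rewrite mulr_sumr -sumEFin; apply: eq_bigr => a _.
  by rewrite WE -!EFinM; congr (_%:E); ring.
rewrite integral_sum//; last first.
  by move=> x; apply: integrable_sum => // a _; apply: integrableZl => //; exact: iW.
rewrite -sumEFin; apply: eq_bigr => x _; rewrite integral_sum//; last first.
  by move=> a; apply: integrableZl => //; exact: iW.
rewrite -sumEFin; apply: eq_bigr => a _; rewrite EFinM fineK ?occupation_fin//.
by apply: integralZl; [exact: measurable_itv|exact: iW].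
Qed.

End real_balance.

(** * Occupation times under a stationary policy *)

Section stationary_occupation.
Context (R : realType) dS (S : finStateType dS) (A : completePseudoMetricType R).
Hypothesis A_hausdorff : hausdorff_space A.
Variables (adm : S -> {fset A}) (phi : R.-pker S ~> Borel A).
Hypothesis phi_stationary : is_stationary adm phi.

Definition action_prob x a : R := fine (phi x [set a]).

Lemma action_prob_fin x a : phi x [set a] = (action_prob x a)%:E.
Proof.
rewrite fineK// ge0_fin_numE//; apply: le_lt_trans (ltry 1).
rewrite -(@prob_kernel _ _ _ _ _ phi x); apply: le_measure => //; rewrite inE//.
exact: measurable_point.
Qed.

Lemma action_prob_ge0 x a : 0 <= action_prob x a. Proof. exact: fine_ge0. Qed.

Lemma action_prob_sum x : \sum_(a <- adm x) action_prob x a = 1.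
Proof.
apply/EFin_inj; rewrite -sumEFin -(phi_stationary x).
pose s : seq (Borel A) := adm x.
have mD := measurable_fset A_hausdorff (adm x).
have := @integral_seq _ (Borel A) R (phi x) [set a | a \in adm x] s (fun=> 1).
rewrite integral_cst// mul1e => ->//.
- by apply: eq_bigr => a _; rewrite mul1e action_prob_fin.
- exact: fset_uniq.
- by move=> a _; exact: measurable_point.
- by rewrite phi_stationary ltry.
Qed.

Variables (P : probability (Omega R S) R) (alpha : R).
Local Notation pi := (stationary_control phi).
Local Notation mu := (@lebesgue_measure R).

Lemma stationary_weight x a p : weight pi x a p =
  if (0 <= p.2) && (state_before p.1 p.2 == Some x) then action_prob x a else 0.
Proof.
rewrite /weight; case: ifP => // /andP[t0 /eqP ex].
rewrite stationary_controlE// ex /adjoin_measure/= /pushforward/= /action_prob.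
congr (fine (phi x _)); by apply/seteqP; split=> b /= [->].
Qed.

(** While the state is [x] the action [a] is in force with the same probability
    at all times and on all trajectories; this factor comes out of both
    integrals. *)
Lemma stationary_occupation x a : a \in adm x ->
  occupation pi P alpha x a =
  ((action_prob x a)%:E * \sum_(b <- adm x) occupation pi P alpha x b)%E.
Proof.
move=> ax.
have pol := stationary_is_policy phi_stationary.
pose v (p : Omega R S * R) : R := \sum_(b <- adm x) weight pi x b p.
have mwt b : measurable_fun setT (weight pi x b : Omega R S * R -> R).
  exact: (measurable_weight A_hausdorff pol).
have mv : measurable_fun setT v by exact: measurable_sum.
have v0 p : 0 <= v p by apply: sumr_ge0 => b _; exact: weight_ge0.
pose H := (\int[mu]_(t in `[0%R, +oo[) ((expR (- alpha * t))%:E * \int[P]_e (v (e, t))%:E))%E.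
have mV : measurable_fun setT (fun t : R => (\int[P]_e (v (e, t))%:E)%E).
  apply: (@measurable_fun_fubini_tonelli_G _ _ _ _ R P (fun p => (v p)%:E)).
    exact/measurable_EFinP.
  by move=> p; rewrite lee_fin.
have mexp : measurable_fun setT (fun t : R => (expR (- alpha * t))%:E).
  by apply/measurable_EFinP; apply: measurableT_comp => //; exact: measurable_funM.
have V0 t : (0 <= \int[P]_e (v (e, t))%:E)%E by apply: integral_ge0 => e _; rewrite lee_fin.
have H0 : (0 <= H)%E.
  by apply: integral_ge0 => t _; rewrite mule_ge0// lee_fin expR_ge0.
have occE b : occupation pi P alpha x b = ((action_prob x b)%:E * H)%E.
  transitivity (\int[mu]_(t in `[0%R, +oo[) ((action_prob x b)%:E *
      ((expR (- alpha * t))%:E * \int[P]_e (v (e, t))%:E)))%E.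
    apply: eq_integral => t; rewrite inE/= in_itv/= andbT => t0.
    rewrite [RHS]muleCA; congr (_ * _)%E.
    transitivity (\int[P]_e ((action_prob x b)%:E * (v (e, t))%:E))%E.
      apply: eq_integral => e _.
      rewrite /v (weight_sum A_hausdorff pol)// stationary_weight /= t0 -EFinM.
      by case: (_ == _); rewrite ?mulr1 ?mulr0.
    apply: ge0_integralZl; first exact: measurableT.
    - by apply/measurable_EFinP; exact: (measurable_fun_pair1 t mv).
    - by move=> e _; rewrite lee_fin.
    - by rewrite lee_fin action_prob_ge0.
  apply: ge0_integralZl; first exact: measurable_itv.
  - by apply: measurable_funTS; apply: emeasurable_funM.
  - by move=> t _; rewrite mule_ge0// lee_fin expR_ge0.
  - by rewrite lee_fin action_prob_ge0.
rewrite occE; congr (_ * _)%E; under eq_bigr do rewrite occE.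
rewrite -ge0_sume_distrl => [|b _]; last by rewrite lee_fin action_prob_ge0.
by rewrite sumEFin action_prob_sum mul1e.
Qed.

End stationary_occupation.

(** * Randomized stationary policies with given probabilities *)

Section induced_policy.
Context (R : realType) dS (S : finStateType dS) (A : completePseudoMetricType R).
Variables (adm : S -> {fset A}) (p : S -> A -> R).

(** The absolute value makes this a measure for any [p], hence a kernel before
    anything is assumed about [p]. *)
Definition mixture (x : S) : {measure set (Borel A) -> \bar R} :=
  msum (fun i => mscale `|p x (nth point (adm x) i)|%:nng (dirac (nth point (adm x) i : Borel A)))
    (size (adm x)).

Lemma mixtureE x (U : set (Borel A)) : measurable U ->
  mixture x U = (\sum_(a <- adm x) `|p x a| * \1_U a)%:E.
Proof.
move=> mU; rewrite -sumEFin (big_nth point) big_mkord /mixture/= /msum.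
by apply: eq_bigr => i _; rewrite /mscale/= /dirac EFinM.
Qed.

Let measurable_mixture (U : set (Borel A)) : measurable U ->
  measurable_fun [set: S] (mixture ^~ U).
Proof. by move=> _ _ B _; exact: measurable_all. Qed.

HB.instance Definition _ := isKernel.Build _ _ S (Borel A) R mixture measurable_mixture.

Hypothesis p_ge0 : forall x a, a \in adm x -> 0 <= p x a.
Hypothesis p_sum : forall x, \sum_(a <- adm x) p x a = 1.

Let mixture_setT x : mixture x setT = 1%E.
Proof.
rewrite mixtureE// -(p_sum x); congr (_%:E); apply: eq_big_seq => a ax.
by rewrite indicT mulr1 ger0_norm// p_ge0.
Qed.

HB.instance Definition _ := Kernel_isProbability.Build _ _ S (Borel A) R mixture mixture_setT.

Lemma exists_mixture : hausdorff_space A ->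
  exists phi : R.-pker S ~> Borel A, is_stationary adm phi /\
    forall x a, a \in adm x -> phi x [set a] = (p x a)%:E.
Proof.
move=> hA; exists (mixture : R.-pker S ~> Borel A); split=> [x|x a ax].
  have mD := measurable_fset hA (adm x).
  rewrite [LHS]mixtureE// -(p_sum x); congr (_%:E); apply: eq_big_seq => a ax.
  by rewrite indicE mem_set// mulr1 ger0_norm// p_ge0.
rewrite [LHS]mixtureE; last exact: measurable_point.
congr (_%:E); rewrite (bigD1_seq a ax (fset_uniq _))/=.
rewrite indicE mem_set// mulr1 ger0_norm ?p_ge0// big1 ?addr0// => b ba.
by rewrite indicE memNset ?mulr0// => /= ab; rewrite ab eqxx in ba.
Qed.

End induced_policy.

(** * Occupation measures as feasible points *)

Section optimality.
Context (R : realType) dS (S : finStateType dS) (A : completePseudoMetricType R).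
Hypothesis A_hausdorff : hausdorff_space A.
Variables (adm : S -> {fset A}) (q : S -> A -> {charge set S -> \bar R}).
Hypothesis q_rate : is_transition_rate adm q.
Variables (alpha : R) (gamma : probability S R).
Hypothesis alpha_gt0 : 0 < alpha.
Variable P : control S A -> probability S R -> probability (Omega R S) R.
Hypothesis P_law : is_law_family adm q P.
Variables (r : S -> A -> R) (N : nat) (c : 'I_N -> S -> A -> R) (d : 'I_N -> R).

(** The factor [alpha] is the normalization of the linear program, under which
    the source term of the balance equation is [alpha] times the initial law. *)
Definition occupation_measure (pi : control S A) (x : S) (a : A) : R :=
  alpha * \sum_x0 fine (gamma [set x0]) * fine (occupation pi (P pi (dirac x0)) alpha x a).

Lemma valueE pi (u : S -> A -> R) : is_policy adm pi ->
  value adm P alpha gamma pi u =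
  (alpha^-1 * \sum_x \sum_(a <- adm x) u x a * occupation_measure pi x a)%:E.
Proof.
move=> pol; rewrite /value.
transitivity (\int[gamma]_x0 (\sum_x \sum_(a <- adm x)
    u x a * fine (occupation pi (P pi (dirac x0)) alpha x a))%:E)%E.
  by apply: eq_integral => x0 _; exact: (value_integralE A_hausdorff pol _ alpha_gt0).
have gE x0 : gamma [set x0] = (fine (gamma [set x0]))%:E.
  by rewrite fineK// fin_num_measure//; exact: measurable_all.
rewrite (@integral_seq _ S R gamma setT (enum S)).
- rewrite big_enum/=.
  transitivity (\sum_x0 (\sum_x \sum_(a <- adm x)
      u x a * fine (occupation pi (P pi (dirac x0)) alpha x a) * fine (gamma [set x0]))%:E)%E.
    apply: eq_big => [x0|x0 _]; first by rewrite inE.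
    rewrite gE -EFinM mulr_suml; congr (_%:E); apply: eq_bigr => x _.
    exact: mulr_suml.
  rewrite sumEFin; congr (_%:E).
  rewrite mulr_sumr; under [RHS]eq_bigr do rewrite mulr_sumr.
  rewrite exchange_big/=; apply: eq_bigr => x _.
  rewrite exchange_big/=; apply: eq_bigr => a _.
  rewrite /occupation_measure mulrCA mulKf ?gt_eqF//.
  by rewrite mulr_sumr; apply: eq_bigr => x0 _; ring.
- exact: enum_uniq.
- exact: measurableT.
- by move=> x0; split=> // _; rewrite mem_enum.
- by move=> x0 _; exact: measurable_all.
- exact: (le_lt_trans (probability_le1 gamma measurableT) (ltry 1)).
Qed.

Lemma occupation_measure_ge0 pi x a : 0 <= occupation_measure pi x a.
Proof.
apply: mulr_ge0; first exact: ltW.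
apply: sumr_ge0 => x0 _; apply: mulr_ge0; apply: fine_ge0 => //.
exact: occupation_ge0.
Qed.

(** The average of [balance_real] over the initial state. *)
Lemma occupation_measure_balance pi x : is_policy adm pi ->
  alpha * \sum_(a <- adm x) occupation_measure pi x a =
  alpha * fine (gamma [set x]) +
  \sum_y \sum_(a <- adm y) rate q x y a * occupation_measure pi y a.
Proof.
move=> pol.
pose o x0 y a := fine (occupation pi (P pi (dirac x0)) alpha y a).
pose g x0 := fine (gamma [set x0]).
have bal x0 : alpha * \sum_(a <- adm x) o x0 x a =
    (x0 == x)%:R + \sum_y \sum_(a <- adm y) rate q x y a * o x0 y a.
  have := balance_real A_hausdorff q_rate pol (P_law (dirac x0) pol) alpha_gt0 x.
  move=> ->; congr (_ + _); rewrite /= /dirac indicE.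
  by case: (x0 =P x) => [->|nx]; [rewrite mem_set|rewrite memNset].
have omE y a : occupation_measure pi y a = alpha * \sum_x0 g x0 * o x0 y a by [].
have lhsE : \sum_(a <- adm x) occupation_measure pi x a =
    \sum_x0 g x0 * (alpha * \sum_(a <- adm x) o x0 x a).
  under eq_bigr do rewrite omE mulr_sumr.
  rewrite exchange_big/=; apply: eq_bigr => x0 _.
  by rewrite !mulr_sumr; apply: eq_bigr => a _; rewrite mulrCA.
have rhsE : \sum_y \sum_(a <- adm y) rate q x y a * occupation_measure pi y a =
    alpha * \sum_x0 g x0 * \sum_y \sum_(a <- adm y) rate q x y a * o x0 y a.
  transitivity (\sum_y \sum_x0 \sum_(a <- adm y) alpha * (g x0 * (rate q x y a * o x0 y a))).
    apply: eq_bigr => y _; rewrite exchange_big/=; apply: eq_bigr => a _.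
    by rewrite omE !mulr_sumr; apply: eq_bigr => x0 _; ring.
  rewrite exchange_big/= mulr_sumr; apply: eq_bigr => x0 _.
  rewrite !mulr_sumr; apply: eq_bigr => y _.
  by rewrite !mulr_sumr.
rewrite lhsE rhsE -mulrDr; congr (_ * _).
under eq_bigr do rewrite bal mulrDr.
rewrite big_split/=; congr (_ + _).
by rewrite (bigD1 x)//= eqxx mulr1 big1 ?addr0// => x0 /negbTE->; rewrite mulr0.
Qed.

Lemma occupation_measure_feasible pi : feasible_policy adm P alpha gamma c d pi ->
  lp_feasible adm q alpha gamma c d (occupation_measure pi).
Proof.
move=> [pol cd]; split=> [n|x|x a _].
- by have := cd n; rewrite valueE// lee_fin ler_pdivrMl.
- exact: occupation_measure_balance.
- exact: occupation_measure_ge0.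
Qed.

Lemma lp_objectiveE eta :
  lp_objective adm alpha r eta = - (alpha^-1 * \sum_x \sum_(a <- adm x) r x a * eta x a).
Proof.
rewrite /lp_objective mulr_sumr -sumrN; apply: eq_bigr => x _.
by rewrite mulr_sumr -sumrN; apply: eq_bigr => a _; ring.
Qed.

Variables (eta : S -> A -> R) (act : S -> A) (phi : R.-pker S ~> Borel A).
Hypothesis eta_feasible : lp_feasible adm q alpha gamma c d eta.
Hypothesis phi_induced : is_induced_policy adm eta act phi.

(** At an unvisited state both sides vanish, whatever [act] is. *)
Lemma induced_split x a : a \in adm x -> eta x a = action_prob phi x a * marginal adm eta x.
Proof.
move=> ax; have [_ _ e0] := eta_feasible; have [_ phiE] := phi_induced.
rewrite /action_prob phiE//= -/(marginal adm eta x); case: ifPn => m0.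
  by rewrite divfK// gt_eqF.
rewrite -leNgt in m0; have m0' : marginal adm eta x = 0.
  by apply/eqP; rewrite eq_le m0 marginal_ge0// => b; exact: e0.
by rewrite m0' mulr0; apply: unvisited_action m0 ax; exact: e0.
Qed.

(** Both measures are [phi] times a marginal and solve the balance equation, so
    the difference of the marginals solves the homogeneous balance equation of
    the generator [B] of [phi], and [balance_unique] applies. *)
Lemma induced_occupation_measure x a : a \in adm x ->
  occupation_measure (stationary_control phi) x a = eta x a.
Proof.
have [st _] := phi_induced; have [_ bal _] := eta_feasible.
have pol := stationary_is_policy st.
set pi := stationary_control phi in pol *.
have omS y b : b \in adm y ->
    occupation_measure pi y b = action_prob phi y b * \sum_(b' <- adm y) occupation_measure pi y b'.
  move=> bY; rewrite /occupation_measure -mulr_sumr mulrCA; congr (_ * _).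
  rewrite exchange_big/= mulr_sumr; apply: eq_bigr => x0 _.
  rewrite -mulr_sumr mulrCA; congr (_ * _).
  apply/EFin_inj; rewrite fineK ?(occupation_fin A_hausdorff pol)//.
  rewrite (stationary_occupation A_hausdorff st)// EFinM; congr (_ * _)%E.
  by rewrite -sumEFin; apply: eq_bigr => b' _; rewrite fineK ?(occupation_fin A_hausdorff pol).
suff h0 y : \sum_(b <- adm y) occupation_measure pi y b - marginal adm eta y = 0.
  move=> ax; rewrite omS// induced_split//; congr (_ * _).
  by apply/eqP; rewrite -subr_eq0 h0.
pose B y x := \sum_(b <- adm y) rate q x y b * action_prob phi y b.
apply: (@balance_unique R S alpha B
  (fun y => \sum_(b <- adm y) occupation_measure pi y b - marginal adm eta y)) => //.
- move=> u v uv; rewrite /B big_seq; apply: sumr_ge0 => b bv.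
  by rewrite mulr_ge0 ?action_prob_ge0// (rate_ge0 q_rate).
- move=> v; rewrite /B exchange_big/= big_seq big1// => b bv.
  by rewrite -mulr_suml (rate_sum q_rate)// mul0r.
- move=> u; rewrite mulrBr occupation_measure_balance// /marginal bal opprD addrACA subrr add0r.
  rewrite -sumrB; apply: eq_bigr => v _; rewrite -/(marginal adm eta v) /B mulr_suml -sumrB.
  apply: eq_big_seq => b bv; rewrite omS// induced_split//; ring.
Qed.

Lemma induced_value u : value adm P alpha gamma (stationary_control phi) u =
  (alpha^-1 * \sum_x \sum_(a <- adm x) u x a * eta x a)%:E.
Proof.
have [st _] := phi_induced.
rewrite valueE; last exact: stationary_is_policy.
congr ((_ * _)%:E); apply: eq_bigr => x _; apply: eq_big_seq => a ax.
by rewrite induced_occupation_measure.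
Qed.

(** Every feasible policy has the reward of a feasible point, and the point of
    the induced policy is [eta]. *)
Lemma induced_constrained_optimal :
  (forall eta', lp_feasible adm q alpha gamma c d eta' ->
     lp_objective adm alpha r eta <= lp_objective adm alpha r eta') ->
  constrained_optimal adm P alpha gamma r c d (stationary_control phi).
Proof.
move=> opt; have [st _] := phi_induced; have [cd _ _] := eta_feasible.
have feas : feasible_policy adm P alpha gamma c d (stationary_control phi).
  split; first exact: stationary_is_policy.
  by move=> n; rewrite induced_value lee_fin ler_pdivrMl.
split=> //; apply/eqP; rewrite eq_le; apply/andP; split.
  by apply: ereal_sup_ubound; exists (stationary_control phi).
apply: ge_ereal_sup => _ [pi' feas' <-].
have [pol' _] := feas'; rewrite valueE// induced_value lee_fin.
have := opt _ (occupation_measure_feasible feas').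
by rewrite !lp_objectiveE lerN2.
Qed.

End optimality.

Theorem corollary3p14 (R : realType)
  (dS : measure_display) (S : finStateType dS)
  (A : completePseudoMetricType R) (A_polish : polish A)
  (adm : S -> {fset A})
  (q : S -> A -> {charge set S -> \bar R}) (q_rate : is_transition_rate adm q)
  (N : nat) (r : S -> A -> R) (c : 'I_N -> S -> A -> R) (d : 'I_N -> R)
  (alpha : R) (alpha_gt0 : 0 < alpha) (gamma : probability S R)
  (P : control S A -> probability S R -> probability (Omega R S) R)
  (P_law : is_law_family adm q P)
  (eta : S -> A -> R)
  (eta_opt : optimal_basic_solution adm q alpha gamma r c d eta)
  (act : S -> A) (act_adm : forall x, act x \in adm x) :
  (exists phi : R.-pker S ~> Borel A, is_induced_policy adm eta act phi) /\
  (forall phi : R.-pker S ~> Borel A, is_induced_policy adm eta act phi ->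
     constrained_optimal adm P alpha gamma r c d (stationary_control phi) /\
     (randomizations adm phi <= N)%N).
Proof.
have [[feas opt] basic] := eta_opt; have [hA _] := A_polish.
have [_ _ e0] := feas.
split=> [|phi ind]; last first.
  split; first exact: (induced_constrained_optimal hA q_rate alpha_gt0 P_law feas ind opt).
  by apply: (randomizations_le q_rate basic) ind; exact: ltW.
pose p x a : R := if 0 < marginal adm eta x then eta x a / marginal adm eta x else (a == act x)%:R.
have p0 x a : a \in adm x -> 0 <= p x a.
  by move=> ax; rewrite /p; case: ifPn => // m0; rewrite divr_ge0 ?e0// ltW.
have p1 x : \sum_(a <- adm x) p x a = 1.
  rewrite /p; case: (boolP (0 < marginal adm eta x)) => m0.
    by rewrite -mulr_suml divff// gt_eqF.
  by rewrite (bigD1_seq (act x) (act_adm x) (fset_uniq _))/= eqxx big1 ?addr0// => a /negbTE->.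
have [phi [st phiE]] := exists_mixture p0 p1 hA.
by exists phi; split=> // x a ax; rewrite phiE.
Qed.
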